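(* Let $D$ be a domain in $\mathbb{C}$, let $A$ be a closed polar subset of $D$, let $f$ be holomorphic on $D\setminus A$, and let $z_0\in A$. Then the following are equivalent: (1) $(\{z_0\}\times\mathbb{C})\cap(\Gamma_f)^\ast_{D\times\mathbb{C}}=\varnothing$; (2) for every $R>0$ the set $\{z\in D\setminus A:|f(z)|\ge R\}$ is not thin at $z_0$. Moreover, if the set $\{z\in D\setminus A:|f(z)|\ge R\}$ is thin at $z_0$ for some $R>0$, then there exists $w_0\in\mathbb{C}$ with $|w_0|\le R$ such that $\Gamma_f$ is not pluri-thin at $(z_0,w_0)$ (and therefore $(z_0,w_0)\in(\Gamma_f)^\ast_{D\times\mathbb{C}}$).
   Context: $\Gamma_f=\{(z,f(z)):z\in D\setminus A\}$. For a pluripolar set $E$ in a domain $\Omega\subset\mathbb{C}^n$, its pluripolar hull is $E^\ast_\Omega=\{z\in\Omega:\ \text{for every plurisubharmonic } u \text{ on }\Omega,\ u|_E\equiv-\infty\implies u(z)=-\infty\}$. A set $S\subset\mathbb{C}$ is thin at $\zeta\in\mathbb{C}$ if either $\zeta$ is not an accumulation point of $S\setminus\{\zeta\}$, or there is a subharmonic function $u$ defined in a neighbourhood of $\zeta$ with $\limsup_{z\to\zeta,\,z\in S\setminus\{\zeta\}}u(z)<u(\zeta)$. Pluri-thin at a point of $\mathbb{C}^n$ is defined in the same way with plurisubharmonic functions in a neighbourhood of the point in $\mathbb{C}^n$. *)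

(* Defs.v *)
From HB Require Import structures.
From mathcomp Require Import all_boot all_order all_algebra.
From mathcomp Require Import all_classical all_reals all_analysis.
From mathcomp Require Import Rstruct Rstruct_topology.
From mathcomp Require Import complex.

Set Implicit Arguments.
Unset Strict Implicit.
Unset Printing Implicit Defensive.

Import Order.TTheory GRing.Theory Num.Theory.
Import numFieldNormedType.Exports.
Local Open Scope classical_set_scope.
Local Open Scope ring_scope.
Local Open Scope complex_scope.

Notation RR := Rdefinitions.R.
Notation CC := (complex RR).

(** C with its normed (Euclidean) metric topology. *)
HB.instance Definition _ := PseudoPointedMetric.copy CC CC^o.

Definition circ (a : CC) (r t : RR) : CC :=
  a + Complex (r * cos t) (r * sin t).

Definition usc_on {T : topologicalType} (U : set T) (u : T -> \bar RR) :=
  forall z, U z -> forall c : RR, (u z < c%:E)%E ->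
    \forall y \near z, (u y < c%:E)%E.

(** Subharmonic functions on an open set [U] of C (the function identically
    [-oo] is allowed): upper semicontinuous, [< +oo], and satisfying the local
    sub-mean value inequality on small circles. *)
Definition subharmonic_on (U : set CC) (u : CC -> \bar RR) : Prop :=
  [/\ open U,
      (forall z, U z -> (u z < +oo)%E),
      usc_on U u &
      forall a, U a -> exists2 rho : RR, 0 < rho /\ ball a rho%:C `<=` U &
        forall r : RR, 0 < r -> r < rho ->
          (u a <= ((2 * pi)^-1)%R%:E *
             \int[lebesgue_measure]_(t in `[0%R, (2 * pi)%R]) u (circ a r t))%E].

Definition psh_on (W : set (CC * CC)%type) (u : (CC * CC)%type -> \bar RR) : Prop :=
  [/\ open W,
      (forall p, W p -> (u p < +oo)%E),
      usc_on W u &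
      forall a b : (CC * CC)%type,
        subharmonic_on [set l | W (a.1 + l * b.1, a.2 + l * b.2)]
                       (fun l => u (a.1 + l * b.1, a.2 + l * b.2))].

Definition domain (D : set CC) : Prop := [/\ D !=set0, open D & connected D].

Definition holomorphic_on (U : set CC) (f : CC -> CC) : Prop :=
  open U /\ forall z, U z -> exists l : CC,
    (fun h : CC => (f (z + h) - f z) / h) @ 0^' --> l.

Definition polar (E : set CC) : Prop :=
  forall a, E a -> exists2 r : RR, 0 < r &
    exists u : CC -> \bar RR,
      [/\ subharmonic_on (ball a r%:C) u,
          (exists2 z, ball a r%:C z & u z != -oo%E) &
          forall z, ball a r%:C z -> E z -> u z = -oo%E].

Definition graph (D A : set CC) (f : CC -> CC) : set (CC * CC)%type :=
  [set p | (D `\` A) p.1 /\ p.2 = f p.1].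

Definition pluripolar_hull (E W : set (CC * CC)%type) : set (CC * CC)%type :=
  [set z | W z /\ forall u, psh_on W u ->
     (forall p, E p -> u p = -oo%E) -> u z = -oo%E].

Definition accum {T : topologicalType} (S : set T) (z : T) : Prop :=
  forall V, nbhs z V -> exists y, [/\ y != z, S y & V y].

Definition thin (S : set CC) (z : CC) : Prop :=
  ~ accum S z \/
  exists V u, [/\ open V, V z, subharmonic_on V u &
    (limf_esup u (within (S `\ z) (nbhs z)) < u z)%E].

Definition pluri_thin (S : set (CC * CC)%type) (z : (CC * CC)%type) : Prop :=
  ~ accum S z \/
  exists V u, [/\ open V, V z, psh_on V u &
    (limf_esup u (within (S `\ z) (nbhs z)) < u z)%E].

(* Main.v *)
Require Import Defs.
From HB Require Import structures.
From mathcomp Require Import all_boot all_order all_algebra.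
From mathcomp Require Import all_classical all_reals all_analysis.
From mathcomp Require Import Rstruct Rstruct_topology.
From mathcomp Require Import complex.
From mathcomp Require Import exp trigo measurable_realfun ring lra.
Import Order.TTheory GRing.Theory Num.Theory.
Import numFieldNormedType.Exports.
Local Open Scope classical_set_scope.
Local Open Scope ring_scope.
Local Open Scope complex_scope.

(** The potential theory is built on a test-function form of the sub-mean value inequality: [u] is
    subharmonic iff [u < Re P] on small circles, for a polynomial [P], forces [u <= Re P] at the
    centre.  In this form maxima, gluing, decreasing limits and Perron envelopes need no integral.

    If [{|f| >= R}] is not thin at [z0] for any [R], fix a compact subset of the graph.  Gluing
    [k log |w - f z| + q z], with [q] a barrier of the polar set [A], to the floor
    [-1 + log^+ (|w| / M) + 2 (E z - m)^+] yields a plurisubharmonic function that is [<= -1] on that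
    compact part and almost [>= 0] above a point where [|f|] is large.  The upper envelope over all
    such functions, minimised over [w], is superharmonic near [z0], so non-thinness gives one that
    is almost [>= 0] above [z0].  A series of these is [-oo] on the graph and finite above [z0].

    If [{|f| >= R}] is thin at [z0], then so is its union with [A], hence [f] has a limit [w0] at [z0]
    in the fine topology; comparing [u (z, w)] with [u (z, f z)] by doubling of variables shows
    [u (z0, w0) <= limsup u] along the graph for every plurisubharmonic [u]. *)

Set Implicit Arguments.
Unset Strict Implicit.
Unset Printing Implicit Defensive.

(** * Complex numbers and semicontinuity *)

(** The test form agrees with the integral form because real parts of polynomials approximate
    Lipschitz functions on a circle uniformly. Explicit Fejer sums do this and, their kernel being
    positive, also supply Harnack's inequality, so no Poisson kernel appears.

    Upper envelopes are in general not semicontinuous, and regularising one could change its value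
    at the single point [z0], where it matters. The Perron families therefore consist of lower
    semicontinuous minorants of the competitors, whose supremum is lower semicontinuous as it
    stands.

    In the thin case [z0] lies in [A], so the graph contains no analytic disc through [(z0, w0)] and
    the sub-mean value inequality cannot be applied along the graph. Doubling replaces it: the
    inequality is used only on small discs parallel to tangents of the graph, away from [z0], and
    the resulting bound on [u (z, w0)] is carried to [z0] by the fine topology. *)

Ltac slim :=
  repeat match goal with
  | H : ?T |- _ =>
    lazymatch T with
    | is_true (@Order.le _ _ _ _) => fail
    | is_true (@Order.lt _ _ _ _) => fail
    | @eq _ _ _ => fail
    | _ => clear H
    end
  end.
Ltac unlet := repeat match goal with x := _ |- _ => clearbody x end.
Ltac rlra := unlet; slim; lra.
Ltac rnra := unlet; slim; nra.
Ltac rsplit := apply/andP; split; rlra.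

Definition cabs (z : CC) : RR := complex.Re `|z|.

Lemma cabsE (z : CC) : `|z| = (cabs z)%:C.
Proof. rewrite /cabs normc_def; reflexivity. Qed.

Lemma cabs_ge0 z : 0 <= cabs z.
Proof. by rewrite -lecR -cabsE normr_ge0. Qed.

Lemma cabsM z w : cabs (z * w) = cabs z * cabs w.
Proof. by apply: complexI; rewrite rmorphM -!cabsE normrM. Qed.

Lemma cabsD z w : cabs (z + w) <= cabs z + cabs w.
Proof. by rewrite -lecR rmorphD -!cabsE ler_normD. Qed.

Lemma cabsN z : cabs (- z) = cabs z.
Proof. by apply: complexI; rewrite -!cabsE normrN. Qed.

Lemma cabs_sub z w : cabs (z - w) = cabs (w - z).
Proof. by rewrite -cabsN opprB. Qed.

Lemma cabs0 : cabs 0 = 0.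
Proof. by apply: complexI; rewrite -cabsE normr0. Qed.

Lemma cabs1 : cabs 1 = 1.
Proof. by apply: complexI; rewrite -cabsE normr1. Qed.

Lemma cabs_eq0 z : (cabs z == 0) = (z == 0).
Proof. by rewrite -(inj_eq (@complexI RR)) -cabsE normr_eq0. Qed.

Lemma cabs_gt0 z : (0 < cabs z) = (z != 0).
Proof. by rewrite lt_def cabs_ge0 andbT cabs_eq0. Qed.

Lemma cabsV z : cabs z^-1 = (cabs z)^-1.
Proof. by apply: complexI; rewrite fmorphV -!cabsE normfV. Qed.

Lemma cabsX z n : cabs (z ^+ n) = cabs z ^+ n.
Proof. by apply: complexI; rewrite rmorphXn -!cabsE normrX. Qed.

Lemma cabs_real (x : RR) : cabs x%:C = `|x|.
Proof. by apply: complexI; rewrite -cabsE normc_def /= expr0n addr0 sqrtr_sqr. Qed.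

Lemma cabs_sqr z : cabs z ^+ 2 = complex.Re z ^+ 2 + complex.Im z ^+ 2.
Proof. by rewrite /cabs normc_def /= sqr_sqrtr // addr_ge0 // sqr_ge0. Qed.

Lemma Re_le_cabs z : `|complex.Re z| <= cabs z.
Proof.
rewrite -(@ler_pXn2r _ 2) ?nnegrE ?cabs_ge0 // cabs_sqr real_normK ?num_real //.
by rewrite lerDl sqr_ge0.
Qed.

Lemma Im_le_cabs z : `|complex.Im z| <= cabs z.
Proof.
rewrite -(@ler_pXn2r _ 2) ?nnegrE ?cabs_ge0 // cabs_sqr real_normK ?num_real //.
by rewrite lerDr sqr_ge0.
Qed.

Lemma cabs_le_ReIm z : cabs z <= `|complex.Re z| + `|complex.Im z|.
Proof.
rewrite -(@ler_pXn2r _ 2) ?nnegrE ?cabs_ge0 ?addr_ge0 // cabs_sqr.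
rewrite sqrrD !real_normK ?num_real // -addrA lerD2l lerDr.
by rewrite mulrn_wge0 // mulr_ge0.
Qed.

Lemma cabs_dist z w : `|cabs z - cabs w| <= cabs (z - w).
Proof.
have h1 := cabsD (z - w) w; have h2 := cabsD (w - z) z.
rewrite !subrK in h1 h2; rewrite (cabs_sub w z) in h2.
by rewrite ler_norml; apply/andP; split; lra.
Qed.

Lemma cReD (x y : CC) : complex.Re (x + y) = complex.Re x + complex.Re y.
Proof. by case: x y => [a b] [c d]. Qed.
Lemma cImD (x y : CC) : complex.Im (x + y) = complex.Im x + complex.Im y.
Proof. by case: x y => [a b] [c d]. Qed.
Lemma cReN (x : CC) : complex.Re (- x) = - complex.Re x.
Proof. by case: x => [a b]. Qed.
Lemma cImN (x : CC) : complex.Im (- x) = - complex.Im x.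
Proof. by case: x => [a b]. Qed.
Lemma cReM (x y : CC) : complex.Re (x * y) =
  complex.Re x * complex.Re y - complex.Im x * complex.Im y.
Proof. by case: x y => [a b] [c d]. Qed.
Lemma cImM (x y : CC) : complex.Im (x * y) =
  complex.Re x * complex.Im y + complex.Im x * complex.Re y.
Proof. by case: x y => [a b] [c d]. Qed.

Lemma ballCE (a y : CC) (r : RR) : ball a r%:C y <-> cabs (y - a) < r.
Proof.
change (@ball CC CC^o a r%:C y <-> cabs (y - a) < r).
rewrite -ball_normE /ball_ /=; change (`|a - y| < r%:C <-> cabs (y - a) < r).
by rewrite cabsE ltcR cabs_sub.
Qed.

Lemma nbhsCE (a : CC) (V : set CC) :
  nbhs a V <-> exists2 r : RR, 0 < r & forall y, cabs (y - a) < r -> V y.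
Proof.
split.
  move=> /nbhs_ballP [e e0 sub].
  have eE : e = (complex.Re e)%:C.
    by apply/eqP; rewrite eq_complex /= eqxx /= eq_sym -(ger0_Im (ltW e0)) eqxx.
  exists (complex.Re e); first by rewrite -ltcR -eE.
  by move=> y hy; apply: sub; rewrite eE; apply/ballCE.
move=> [r r0 sub]; apply/nbhs_ballP; exists r%:C; first by rewrite /= ltcR.
by move=> y /ballCE; exact: sub.
Qed.

Lemma nbhsC2E (p : CC * CC) (V : set (CC * CC)%type) :
  nbhs p V <-> exists2 r : RR, 0 < r &
    forall y, cabs (y.1 - p.1) < r -> cabs (y.2 - p.2) < r -> V y.
Proof.
split.
  move=> [[A B] /= [/nbhsCE [r r0 hr] /nbhsCE [s s0 hs]] sub].
  exists (Num.min r s); first by rewrite lt_min r0.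
  by move=> y; rewrite !lt_min => /andP[h1 _] /andP[_ h2]; apply: sub; split;
    [exact: hr|exact: hs].
move=> [r r0 h]; exists ([set y | cabs (y - p.1) < r], [set y | cabs (y - p.2) < r]).
  by split; apply/nbhsCE; exists r.
by move=> y [/=]; exact: h.
Qed.

Lemma openCE (U : set CC) :
  open U <-> forall a, U a -> exists2 r : RR, 0 < r & forall y, cabs (y - a) < r -> U y.
Proof.
rewrite openE; split => [h a /h /nbhsCE //|h a /h hh].
by apply/nbhsCE.
Qed.

Lemma open_cball (a : CC) (r : RR) : open [set y | cabs (y - a) < r].
Proof.
apply/openCE => y /= hy; exists (r - cabs (y - a)); first by rewrite subr_gt0.
move=> x hx /=; have := cabsD (x - y) (y - a); rewrite subrKA => h; lra.
Qed.

Lemma ball_setE (a : CC) (r : RR) : ball a r%:C = [set y | cabs (y - a) < r].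
Proof. by apply/seteqP; split => y /ballCE. Qed.

Lemma cvgCE {T : Type} (F : set_system T) {FF : Filter F} (g : T -> CC) (l : CC) :
  (forall e : RR, 0 < e -> \forall x \near F, cabs (g x - l) < e) -> g @ F --> l.
Proof. by move=> h V /nbhsCE [r r0 sub]; near=> x; apply: sub; near: x; exact: h.
Unshelve. all: by end_near. Qed.

Lemma continuous_cplx : continuous (fun p : RR * RR => Complex p.1 p.2).
Proof.
move=> [x y]; apply: cvgCE => e e0.
have e2 : 0 < e / 2 by lra.
exists ([set a | `|x - a| < e/2], [set b | `|y - b| < e/2]) => /=.
  by split; apply: (nbhsx_ballx _ (e/2) e2).
move=> [a b] /= [ha hb].
apply: le_lt_trans (cabs_le_ReIm _) _; rewrite cReD cImD cReN cImN /=.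
by rewrite (distrC a) (distrC b); lra.
Qed.

Lemma compact_bounded_closed (K : set CC) (r : RR) :
  closed K -> (forall z, K z -> cabs z <= r) -> compact K.
Proof.
move=> cK bK.
have cS : compact ([set` `[-r, r]] `*` [set` `[-r, r]] : set (RR * RR)).
  by apply: compact_setX; exact: segment_compact.
apply: (subclosed_compact cK (continuous_compact (continuous_subspaceT continuous_cplx) cS)).
move=> z /bK zr; exists (complex.Re z, complex.Im z); last by case: (z).
have h1 := le_trans (Re_le_cabs z) zr; have h2 := le_trans (Im_le_cabs z) zr.
by rewrite !ler_norml in h1 h2; split; rewrite /= in_itv.
Qed.

Lemma compact_disc (a : CC) (r : RR) : compact [set z | cabs (z - a) <= r].
Proof.
apply: (@compact_bounded_closed _ (r + cabs a)).
  rewrite -openC; apply/openCE => y /= /negP; rewrite -ltNge => hy.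
  exists (cabs (y - a) - r); first by rewrite subr_gt0.
  move=> x hx /=; apply/negP; rewrite -ltNge.
  have := cabsD (y - x) (x - a); rewrite subrKA (cabs_sub y x) => h; lra.
by move=> z /= hz; have := cabsD (z - a) a; rewrite subrK => h; lra.
Qed.

Lemma compact_circle (a : CC) (r : RR) : compact [set z | cabs (z - a) = r].
Proof.
have cl : closed [set z | cabs (z - a) = r].
  rewrite -openC; apply/openCE => y /= /eqP hy.
  exists `|cabs (y - a) - r|; first by rewrite normr_gt0 subr_eq0.
  move=> x hx /= E; have := cabs_dist (y - a) (x - a).
  by rewrite E (_ : y - a - (x - a) = y - x) ?(cabs_sub y x); [lra|ring].
have sub : [set z | cabs (z - a) = r] `<=` [set z | cabs (z - a) <= r] by move=> z /= ->.
exact: (subclosed_compact cl (@compact_disc a r) sub).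
Qed.

(** Semicontinuity of the restriction to [K], which need not be open: it is applied to circles,
    closed discs and products of compact sets. *)
Definition usc_rel {T : topologicalType} (K : set T) (u : T -> \bar RR) :=
  forall z, K z -> forall c : RR, (u z < c%:E)%E ->
    \forall y \near z, K y -> (u y < c%:E)%E.

(** Without a maximum, the superlevel sets [{u >= u y}] generate a proper filter on [K]. At a
    cluster point [x] some [s x] has a larger value, and semicontinuity at [x] separates a
    neighbourhood of [x] from [{u >= u (s x)}]. *)
Lemma usc_rel_max {T : topologicalType} (K : set T) (u : T -> \bar RR) :
  compact K -> K !=set0 -> usc_rel K u ->
  exists2 x, K x & forall y, K y -> (u y <= u x)%E.
Proof.
move=> cK [x0 Kx0] hu; apply: contrapT => nmax.
have ex y : exists z, K y -> K z /\ (u y < u z)%E.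
  have [Ky|nKy] := pselect (K y); last by exists y.
  apply: contrapT => h; apply: nmax; exists y => // z Kz.
  by rewrite leNgt; apply/negP => yz; apply: h; exists z.
have [s hs] := choice ex.
pose F : set_system T := [set A | exists2 y, K y & forall z, K z -> (u y <= u z)%E -> A z].
have FF : ProperFilter F.
  split; first by move=> [y Ky]; apply => //.
  split.
  - by exists x0.
  - move=> A B [y Ky hA] [z Kz hB].
    have [yz|zy] := leP (u y) (u z).
      exists z => // t Kt zt; split; [apply: hA => //; exact: le_trans zt|exact: hB].
    exists y => // t Kt yt; split; [exact: hA|apply: hB => //; exact: le_trans (ltW zy) yt].
  - by move=> A B AB [y Ky hA]; exists y => // z Kz yz; exact: AB (hA _ Kz yz).
have [x [Kx clx]] : K `&` cluster F !=set0 by apply: cK; exists x0.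
have [Ksx uxs] := hs x Kx.
have [Kssx usss] := hs (s x) Ksx.
have [c /andP[uc cu]] : exists c : RR, (u x < c%:E <= u (s x))%E.
  case E : (u (s x)) uxs => [t| |] uxs.
  - by exists t; rewrite uxs lexx.
  - by move: usss; rewrite E ltNge leey.
  - by move: uxs; rewrite ltNge leNye.
have /= nb := hu x Kx c uc.
have FA : F [set z | K z /\ (u (s x) <= u z)%E] by exists (s x).
have [z [[Kz sz] /(_ Kz) zc]] := clx _ _ FA nb.
by move: zc; rewrite ltNge (le_trans cu sz).
Qed.

Lemma usc_on_rel {T : topologicalType} (U K : set T) (u : T -> \bar RR) :
  K `<=` U -> usc_on U u -> usc_rel K u.
Proof. by move=> KU hu z /KU Uz c /(hu _ Uz); apply: filterS => y. Qed.

(** * Complex derivatives *)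

Lemma is_derive_eps (R : realType) (f : R -> R) (x df : R) : is_derive x 1 f df ->
  forall e : R, 0 < e -> exists2 d : R, 0 < d &
    forall h, `|h| < d -> `|f (x + h) - f x - df * h| <= e * `|h|.
Proof.
move=> [dx dE] e e0.
have cv : (fun h => h^-1 *: (f (h *: 1 + x) - f x)) @ 0^' --> df.
  by rewrite -dE; exact: dx.
have := cv _ (nbhsx_ballx df e e0).
move=> /nbhs_ballP [d d0 hd]; exists d => // h hh.
have [->|h0] := eqVneq h 0.
  by rewrite addr0 mulr0 subr0 subrr normr0 mulr0.
have := hd h; rewrite /ball /= sub0r normrN => /(_ hh h0).
rewrite [h *: 1]mulr1 (addrC h) /GRing.scale /= => hb.
have -> : f (x + h) - f x - df * h = - (df - h^-1 * (f (x + h) - f x)) * h.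
  by field.
by rewrite normrM normrN ler_wpM2r // ltW.
Qed.

(** A derivative without quotients: the point [y = z] is included, so the chain rule needs no case
    distinction on vanishing increments. *)
Definition cdiff (F : CC -> CC) (z l : CC) :=
  forall e : RR, 0 < e -> exists2 d : RR, 0 < d &
    forall y, cabs (y - z) < d -> cabs (F y - F z - l * (y - z)) <= e * cabs (y - z).

Lemma cdiff_cst c z : cdiff (fun=> c) z 0.
Proof.
move=> e e0; exists 1 => // y _; rewrite mul0r subr0 subrr cabs0.
by rewrite mulr_ge0 ?cabs_ge0 // ltW.
Qed.

Lemma cdiff_id z : cdiff id z 1.
Proof.
move=> e e0; exists 1 => // y _; rewrite mul1r subrr cabs0.
by rewrite mulr_ge0 ?cabs_ge0 // ltW.
Qed.

Lemma cdiffD F G z l m : cdiff F z l -> cdiff G z m ->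
  cdiff (fun y => F y + G y) z (l + m).
Proof.
move=> hF hG e e0; have e2 : 0 < e / 2 by lra.
have [d1 d10 h1] := hF _ e2; have [d2 d20 h2] := hG _ e2.
exists (Num.min d1 d2); first by rewrite lt_min d10.
move=> y; rewrite lt_min => /andP[/h1 y1 /h2 y2].
have -> : F y + G y - (F z + G z) - (l + m) * (y - z) =
  (F y - F z - l * (y - z)) + (G y - G z - m * (y - z)) by ring.
apply: le_trans (cabsD _ _) _; lra.
Qed.

Lemma cdiff_lip F z l : cdiff F z l -> exists2 d : RR, 0 < d &
  forall y, cabs (y - z) < d -> cabs (F y - F z) <= (cabs l + 1) * cabs (y - z).
Proof.
move=> /(_ 1 ltr01) [d d0 h]; exists d => // y /h hy.
rewrite -(subrK (l * (y - z)) (F y - F z)); apply: le_trans (cabsD _ _) _.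
by rewrite cabsM; lra.
Qed.

Lemma cdiff_cont F z l : cdiff F z l -> forall e : RR, 0 < e ->
  exists2 d : RR, 0 < d & forall y, cabs (y - z) < d -> cabs (F y - F z) < e.
Proof.
move=> /cdiff_lip [d d0 h] e e0; have l0 := cabs_ge0 l.
have l1 : 0 < cabs l + 1 by lra.
exists (Num.min d (e / (cabs l + 1))); first by rewrite lt_min d0 divr_gt0.
move=> y; rewrite lt_min => /andP[/h hy]; rewrite ltr_pdivlMr // mulrC.
exact: le_lt_trans.
Qed.

Lemma cdiff_comp F G z l m : cdiff G z m -> cdiff F (G z) l ->
  cdiff (F \o G) z (l * m).
Proof.
move=> hG hF e e0; have l0 := cabs_ge0 l; have m0 := cabs_ge0 m.
have l1 : 0 < cabs l + 1 by lra.
have m1 : 0 < cabs m + 1 by lra.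
have ea : 0 < e / 2 / (cabs m + 1) by rewrite !divr_gt0.
have eb : 0 < e / 2 / (cabs l + 1) by rewrite !divr_gt0.
have [d1 d10 h1] := hF _ ea; have [d2 d20 h2] := hG _ eb.
have [d3 d30 h3] := cdiff_lip hG; have [d4 d40 h4] := cdiff_cont hG d10.
exists (Num.min (Num.min d2 d3) d4); first by rewrite !lt_min d20 d30.
move=> y; rewrite !lt_min => /andP[/andP[/h2 y2 /h3 y3] /h4 /h1 y4] /=.
have -> : F (G y) - F (G z) - l * m * (y - z) =
   (F (G y) - F (G z) - l * (G y - G z)) + l * (G y - G z - m * (y - z)) by ring.
apply: le_trans (cabsD _ _) _; rewrite cabsM.
have t0 := cabs_ge0 (y - z).
have A : cabs (F (G y) - F (G z) - l * (G y - G z)) <= e / 2 * cabs (y - z).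
  apply: le_trans y4 _; apply: le_trans (ler_wpM2l (ltW ea) y3) _.
  by rewrite mulrA divfK ?gt_eqF.
have B : cabs l * cabs (G y - G z - m * (y - z)) <= e / 2 * cabs (y - z).
  apply: le_trans (_ : (cabs l + 1) * (e / 2 / (cabs l + 1) * cabs (y - z)) <= _).
    apply: ler_pM => //; first exact: cabs_ge0.
    by rewrite lerDl.
  by rewrite mulrA mulrCA mulfV ?mulr1 // gt_eqF.
lra.
Qed.

Lemma cdiffM F G z l m : cdiff F z l -> cdiff G z m ->
  cdiff (fun y => F y * G y) z (l * G z + F z * m).
Proof.
move=> hF hG e e0.
have l0 := cabs_ge0 l; have m0 := cabs_ge0 m; have f0 := cabs_ge0 (F z).
have g0 := cabs_ge0 (G z).
have l1 : 0 < cabs l + 1 by lra.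
have m1 : 0 < cabs m + 1 by lra.
have f1 : 0 < cabs (F z) + 1 by lra.
have g1 : 0 < cabs (G z) + 1 by lra.
have [d1 d10 h1] := hF _ (divr_gt0 (divr_gt0 e0 (ltr0Sn _ 2)) g1).
have [d2 d20 h2] := hG _ (divr_gt0 (divr_gt0 e0 (ltr0Sn _ 2)) f1).
have [d3 d30 h3] := cdiff_lip hF.
have [d4 d40 h4] := cdiff_cont hG (divr_gt0 (divr_gt0 e0 (ltr0Sn _ 2)) l1).
exists (Num.min (Num.min d1 d2) (Num.min d3 d4)); first by rewrite !lt_min d10 d20 d30.
move=> y; rewrite !lt_min => /andP[/andP[/h1 y1 /h2 y2] /andP[/h3 y3 /h4 y4]].
have -> : F y * G y - F z * G z - (l * G z + F z * m) * (y - z) =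
  (F y - F z - l * (y - z)) * G z + F z * (G y - G z - m * (y - z))
  + (F y - F z) * (G y - G z) by ring.
apply: le_trans (cabsD _ _) _; have := cabsD ((F y - F z - l * (y - z)) * G z) (F z * (G y - G z - m * (y - z))).
rewrite !cabsM => hh.
have t0 := cabs_ge0 (y - z); set t := cabs (y - z) in t0 y1 y2 y3 y4 *.
have key (c : RR) : 0 <= c -> e / 3 / (c + 1) * t * c <= e / 3 * t.
  move=> c0; have c1 : 0 < c + 1 by lra.
  have -> : e / 3 / (c + 1) * t * c = e / 3 * t * (c / (c + 1)).
    by field; rewrite gt_eqF.
  apply: ler_piMr; first by rewrite mulr_ge0 //; lra.
  by rewrite ler_pdivrMr // mul1r; lra.
have A := le_trans (ler_wpM2r g0 y1) (key _ g0).
have B := le_trans (ler_wpM2l f0 y2).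
have B' : cabs (F z) * cabs (G y - G z - m * (y - z)) <= e / 3 * t.
  by apply: B; rewrite mulrC; exact: key.
have C' : cabs (F y - F z) * cabs (G y - G z) <= e / 3 * t.
  apply: le_trans (ler_pM (cabs_ge0 _) (cabs_ge0 _) y3 (ltW y4)) _.
  by rewrite mulrC mulrA divfK ?gt_eqF.
lra.
Qed.

Lemma cdiffN F z l : cdiff F z l -> cdiff (fun y => - F y) z (- l).
Proof.
move=> h; have := cdiffM (cdiff_cst (-1) z) h; rewrite mul0r add0r mulN1r.
by under [X in cdiff X]eq_fun do rewrite mulN1r.
Qed.

Lemma cdiffB F G z l m : cdiff F z l -> cdiff G z m ->
  cdiff (fun y => F y - G y) z (l - m).
Proof. by move=> hF /cdiffN hG; exact: cdiffD. Qed.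

Lemma cdiff_poly (P : {poly CC}) z : exists l, cdiff (horner P) z l.
Proof.
elim/poly_ind: P => [|P c [l hl]].
  exists 0; rewrite (_ : horner 0 = fun=> 0); first exact: cdiff_cst.
  by apply/funext => y; rewrite horner0.
eexists; rewrite (_ : horner _ = fun y => P.[y] * y + c).
  by apply: cdiffD; [apply: cdiffM; [exact: hl|exact: cdiff_id]|exact: cdiff_cst].
by apply/funext => y; rewrite hornerMXaddC.
Qed.

Lemma cdiff_inv (c z : CC) : z != c -> exists l, cdiff (fun y => (y - c)^-1) z l.
Proof.
move=> zc; have zc0 : z - c != 0 by rewrite subr_eq0.
have r0 : 0 < cabs (z - c) by rewrite cabs_gt0.
exists (- (z - c) ^- 2) => e e0; set r := cabs (z - c) in r0.
exists (Num.min (r / 2) (e * r ^+ 3 / 2)).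
  by rewrite lt_min !divr_gt0 // mulr_gt0 // exprn_gt0.
move=> y; rewrite lt_min => /andP[y1 y2].
have yr : r / 2 < cabs (y - c).
  have := cabsD (y - c) (z - y); rewrite addrC subrKA -/r (cabs_sub z y); lra.
have yc0 : y - c != 0 by rewrite -cabs_gt0; lra.
have -> : (y - c)^-1 - (z - c)^-1 - - (z - c) ^- 2 * (y - z) =
   (y - z) ^+ 2 / ((y - c) * (z - c) ^+ 2).
  by field; rewrite zc0 yc0.
rewrite (cabsM (_ ^+ 2)) cabsV (cabsM (y - c)) (cabsX (y - z)) (cabsX (z - c)).
rewrite -/r ler_pdivrMr; last first.
  by rewrite mulr_gt0 ?exprn_gt0 //; lra.
rewrite expr2 -!mulrA [leRHS]mulrCA; apply: ler_wpM2l; first exact: cabs_ge0.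
apply: le_trans (ltW y2) _; rewrite -mulrA; apply: ler_wpM2l; first exact: ltW.
rewrite exprS mulrAC; apply: ler_wpM2r; first by rewrite exprn_ge0 // ltW.
exact: ltW.
Qed.

(** * The complex exponential *)

Definition cexp (z : CC) : CC :=
  Complex (expR (complex.Re z) * cos (complex.Im z))
          (expR (complex.Re z) * sin (complex.Im z)).

Lemma cexpD z w : cexp (z + w) = cexp z * cexp w.
Proof.
rewrite /cexp cReD cImD expRD cosD sinD; case: z w => [a b] [c d] /=.
by apply/eqP; rewrite eq_complex /=; apply/andP; split; apply/eqP; ring.
Qed.

Lemma cabs_cexp z : cabs (cexp z) = expR (complex.Re z).
Proof.
apply/eqP; rewrite -(@eqrXn2 _ 2) ?cabs_ge0 ?expR_ge0 // cabs_sqr /=.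
by rewrite !exprMn -mulrDr cos2Dsin2 mulr1.
Qed.

Lemma cdiff_cexp0 : cdiff cexp 0 1.
Proof.
move=> e e0.
(* The bounds [A] and [B] below add up to [9 e1 m], whence [e / 12]; [e1 <= 1] keeps [E] bounded. *)
have [e1 [e10 e1a e1b]] : exists e1 : RR, [/\ 0 < e1, e1 <= e / 12 & e1 <= 1].
  exists (Num.min (e / 12) 1); rewrite lt_min !ge_min !lexx orbT ltr01 andbT.
  by split => //; lra.
have [d1 d10 h1] := is_derive_eps (is_derive_expR 0) e10.
have [d2 d20 h2] := is_derive_eps (is_derive_cos 0) e10.
have [d3 d30 h3] := is_derive_eps (is_derive_sin 0) e10.
exists (Num.min (Num.min d1 d2) (Num.min d3 e1)); first by rewrite !lt_min d10 d20 d30.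
move=> y; rewrite subr0 !lt_min => /andP[/andP[y1 y2] /andP[y3 y4]].
have rx := Re_le_cabs y; have ix := Im_le_cabs y.
have {}h1 := h1 _ (le_lt_trans rx y1); have {}h2 := h2 _ (le_lt_trans ix y2).
have {}h3 := h3 _ (le_lt_trans ix y3).
rewrite !add0r expR0 mul1r in h1; rewrite !add0r cos0 sin0 oppr0 mul0r subr0 in h2.
rewrite !add0r sin0 cos0 mul1r subr0 in h3.
have E0 : cexp 0 = 1 by rewrite /cexp /= expR0 cos0 sin0 mulr1 mulr0.
rewrite E0 mul1r; apply: le_trans (cabs_le_ReIm _) _.
rewrite !cReD !cImD !cReN !cImN /= subr0.
move: rx ix h1 h2 h3 y4; set x := complex.Re y; set t := complex.Im y.
set E := expR x; set C := cos t; set S := sin t; set m := cabs y.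
move=> rx ix h1 h2 h3 y4.
have m0 : 0 <= m := cabs_ge0 y.
have hE : `|E - 1| <= 2 * m.
  have := ler_normD (E - 1 - x) x; rewrite subrK => h.
  have : e1 * `|x| <= m by nra.
  lra.
have hE2 : `|E| <= 3.
  by have := ler_normD (E - 1) 1; rewrite subrK normr1 => h; lra.
have A : `|E * C - 1 - x| <= e1 * m + 3 * (e1 * m).
  have -> : E * C - 1 - x = (E - 1 - x) + E * (C - 1) by ring.
  apply: le_trans (ler_normD _ _) _; rewrite normrM; apply: lerD.
    by apply: le_trans h1 _; rewrite ler_pM2l.
  by apply: ler_pM => //; apply: le_trans h2 _; rewrite ler_pM2l.
have B : `|E * S - t| <= 3 * (e1 * m) + 2 * m * e1.
  have -> : E * S - t = E * (S - t) + (E - 1) * t by ring.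
  apply: le_trans (ler_normD _ _) _; rewrite !normrM; apply: lerD.
    by apply: ler_pM => //; apply: le_trans h3 _; rewrite ler_pM2l.
  by apply: ler_pM => //; lra.
nra.
Qed.

Lemma cdiff_ext F G z l : F =1 G -> cdiff F z l -> cdiff G z l.
Proof. by move=> /funext ->. Qed.

Lemma cdiff_cexp z : cdiff cexp z (cexp z).
Proof.
have h : cdiff (fun y : CC => y - z) z 1.
  by have := cdiffB (cdiff_id z) (cdiff_cst z z); rewrite subr0.
have h0 : cdiff cexp (z - z) 1 by rewrite subrr; exact: cdiff_cexp0.
have := cdiffM (cdiff_cst (cexp z) z) (cdiff_comp h h0).
rewrite mul0r add0r mul1r mulr1; apply: cdiff_ext => y /=.
by rewrite -cexpD addrC subrK.
Qed.

(** * Goursat's theorem and the mean value property *)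

Notation mu := (@lebesgue_measure RR).

Definition Iab (a b : RR) (f : RR -> RR) : RR := Rintegral mu [set` `[a, b]] f.

(** Points [y] outside the interval count as well, so that subintervals inherit the property at
    once. *)
Definition ctson (a b : RR) (f : RR -> RR) := forall x, a <= x <= b ->
  forall e : RR, 0 < e -> exists2 d : RR, 0 < d & forall y, `|y - x| < d -> `|f y - f x| < e.

Lemma ctson_integrable a b f : ctson a b f -> mu.-integrable [set` `[a, b]] (EFin \o f).
Proof.
move=> h; apply: continuous_compact_integrable; first exact: segment_compact.
apply: continuous_in_subspaceT => x /set_mem /=; rewrite in_itv /= => xab.
move=> V /nbhs_ballP [e e0 sub]; have [d d0 hd] := h x xab _ e0.
apply/nbhs_ballP; exists d => // y; rewrite /ball /= distrC => yx.
by apply: sub; rewrite /ball /= distrC; exact: hd.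
Qed.

Lemma ctson_sub a b c d f : a <= c -> d <= b -> ctson a b f -> ctson c d f.
Proof. by move=> ac db h x /andP[cx xd]; apply: h; rsplit. Qed.

Lemma ctsonB a b f g : ctson a b f -> ctson a b g -> ctson a b (fun x => f x - g x).
Proof.
move=> hf hg x xab e e0; have e2 : 0 < e / 2 by rlra.
have [d d0 hd] := hf x xab _ e2; have [d' d0' hd'] := hg x xab _ e2.
exists (Num.min d d'); first by rewrite lt_min d0.
move=> y; rewrite lt_min => /andP[/hd y1 /hd' y2].
have := ler_normB (f y - f x) (g y - g x).
rewrite (_ : f y - f x - (g y - g x) = f y - g y - (f x - g x)); last ring.
rlra.
Qed.

Lemma ctson_cst a b c : ctson a b (fun=> c).
Proof. by move=> x _ e e0; exists 1 => // y _; rewrite subrr normr0. Qed.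

Lemma Iab_split a b c f : a <= c -> c <= b -> ctson a b f ->
  Iab a b f = Iab a c f + Iab c b f.
Proof.
move=> ac cb /ctson_integrable hf.
have := @Rintegral_itvB RR f (BLeft a) (BRight b) c hf.
rewrite !bnd_simp => /(_ ac cb) h.
have E : Rintegral mu [set` `]c, b]] f = Iab c b f.
  apply: Rintegral_itv_obnd_cbnd; apply: integrableS hf => //.
  by apply: subset_itvr; rewrite bnd_simp.
rewrite -E; move: h; rewrite -/(Iab a b f) -/(Iab a c f) => <-.
by move: (Iab a b f) (Iab a c f) => p q; rewrite addrC subrK.
Qed.

Lemma IabB a b f g : ctson a b f -> ctson a b g ->
  Iab a b (fun x => f x - g x) = Iab a b f - Iab a b g.
Proof. by move=> /ctson_integrable hf /ctson_integrable hg; exact: RintegralB. Qed.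

Lemma Iab_cst a b c : a <= b -> Iab a b (fun=> c) = c * (b - a).
Proof.
move=> ab; rewrite /Iab Rintegral_cst //; congr (_ * _).
have /= E := @lebesgue_measure_itv RR `[a, b].
apply: (etrans (congr1 fine E)); rewrite lte_fin.
by move: ab; rewrite le_eqVlt => /orP[/eqP ->|->]; rewrite ?ltxx ?subrr.
Qed.

Lemma le_Iab a b f g : ctson a b f -> ctson a b g ->
  (forall x, a <= x <= b -> f x <= g x) -> Iab a b f <= Iab a b g.
Proof.
move=> /ctson_integrable hf /ctson_integrable hg fg; apply: le_Rintegral => //.
Qed.

Lemma Iab_dist a b f c e : a <= b -> ctson a b f ->
  (forall x, a <= x <= b -> `|f x - c| <= e) -> `|Iab a b f - c * (b - a)| <= e * (b - a).
Proof.
move=> ab hf h.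
have hc := ctsonB hf (@ctson_cst a b c).
have -> : Iab a b f - c * (b - a) = Iab a b (fun x => f x - c).
  by rewrite IabB // ?Iab_cst //; exact: ctson_cst.
rewrite ler_norml; apply/andP; split.
  have := le_Iab (@ctson_cst a b (- e)) hc; rewrite Iab_cst // mulNr; apply.
  by move=> x /h; rewrite ler_norml => /andP[].
have := le_Iab hc (@ctson_cst a b e); rewrite Iab_cst //; apply.
by move=> x /h; rewrite ler_norml => /andP[].
Qed.

Definition rdiff (u : RR -> RR -> RR) (x y ux uy : RR) :=
  forall e : RR, 0 < e -> exists2 d : RR, 0 < d & forall x' y',
    `|x' - x| < d -> `|y' - y| < d ->
    `|u x' y' - u x y - ux * (x' - x) - uy * (y' - y)| <= e * (`|x' - x| + `|y' - y|).

Lemma rdiff_cont u x y ux uy : rdiff u x y ux uy ->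
  forall e : RR, 0 < e -> exists2 d : RR, 0 < d & forall x' y',
    `|x' - x| < d -> `|y' - y| < d -> `|u x' y' - u x y| < e.
Proof.
move=> /(_ 1 ltr01) [d d0 h] e e0; pose K := 2 + `|ux| + `|uy|.
have K0 : 0 < K by rewrite /K; have := normr_ge0 ux; have := normr_ge0 uy; rlra.
have eK : 0 < e / (2 * K) by rewrite divr_gt0 //; rlra.
exists (Num.min d (e / (2 * K))); first by rewrite lt_min d0.
move=> x' y'; rewrite !lt_min => /andP[xd xe] /andP[yd ye].
have := h x' y' xd yd; rewrite mul1r => hh.
set D := u x' y' - u x y in hh *.
have h1 : `|D| <= `|D - ux * (x' - x) - uy * (y' - y)| + `|ux * (x' - x)| + `|uy * (y' - y)|.
  rewrite {1}(_ : D = (D - ux * (x' - x) - uy * (y' - y)) + ux * (x' - x) + uy * (y' - y)); last ring.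
  by apply: le_trans (ler_normD _ _) _; rewrite lerD2r ler_normD.
have h2 : `|ux| * `|x' - x| <= `|ux| * (e / (2 * K)) by rewrite ler_wpM2l // ltW.
have h3 : `|uy| * `|y' - y| <= `|uy| * (e / (2 * K)) by rewrite ler_wpM2l // ltW.
rewrite !normrM in h1.
have : K * (e / (2 * K)) = e / 2 by field; rewrite gt_eqF.
rewrite /K in eK *; nra.
Qed.

Definition pw (n : nat) : RR := (1 / 2) ^+ n.

Lemma pw_gt0 n : 0 < pw n. Proof. by rewrite exprn_gt0. Qed.

Lemma pw_small (e : RR) : 0 < e -> exists n, pw n < e.
Proof.
move=> e0; have cv : pw @ \oo --> (0 : RR).
  by apply: cvg_expr; rewrite ltr_norml; rsplit.
have [N _ hN] := cv _ (nbhsx_ballx (0 : RR) e e0).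
exists N; have := hN N (leqnn N); rewrite /ball /= sub0r normrN.
by rewrite gtr0_norm // pw_gt0.
Qed.

Lemma nested_point (s : nat -> RR) (c d : RR) : 0 <= d ->
  (forall n, s n <= s n.+1) -> (forall n, s n.+1 + d * pw n.+1 <= s n + d * pw n) ->
  exists x, forall n, s n <= x <= s n + d * pw n.
Proof.
move=> d0 h1 h2.
have mono m n : (m <= n)%N -> s m <= s n.
  move=> /subnK <-; elim: (n - m)%N => // i IH; rewrite addSn; exact: le_trans (h1 _).
have mono2 m n : (m <= n)%N -> s n + d * pw n <= s m + d * pw m.
  move=> /subnK <-; elim: (n - m)%N => // i IH; rewrite addSn; exact: le_trans (h2 _) IH.
have ub m n : s n <= s m + d * pw m.
  have p0 i : 0 <= d * pw i by rewrite mulr_ge0 // ltW // pw_gt0.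
  have [mn|nm] := leqP m n.
    by apply: le_trans (mono2 _ _ mn); rewrite lerDl.
  by apply: le_trans (mono _ _ (ltnW nm)) _; rewrite lerDl.
have S : has_sup (range s).
  split; first by exists (s 0%N), 0%N.
  by exists (s 0%N + d * pw 0) => _ [n _ <-]; exact: ub.
exists (sup (range s)) => n; apply/andP; split.
  by apply: ub_le_sup; [exact: (proj2 S)|exists n].
by apply: ge_sup; [exact: (proj1 S)|move=> _ [m _ <-]; exact: ub].
Qed.

(* Goursat's bisection argument for a pair with [u_x = v_y]; only this half of the Cauchy-Riemann
   equations is needed. *)
Section RectFlux.
Variables (u v : RR -> RR -> RR) (x0 y0 h k : RR).
Hypotheses (h0 : 0 < h) (k0 : 0 < k).
Hypothesis CR : forall x y, x0 <= x <= x0 + h -> y0 <= y <= y0 + k ->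
  exists ux uy vx, rdiff u x y ux uy /\ rdiff v x y vx ux.

(** Outward flux of the field [(u, - v)] through the boundary of the rectangle, that is, the
    imaginary part of the contour integral of [u + i v]. *)
Let J (x y h k : RR) : RR :=
  Iab y (y + k) (fun t => u (x + h) t - u x t) - Iab x (x + h) (fun t => v t (y + k) - v t y).

Let cu x : x0 <= x <= x0 + h -> ctson y0 (y0 + k) (u x).
Proof.
move=> hx y hy e e0; have [ux [uy [vx [du _]]]] := CR hx hy.
have [d d0 hd] := rdiff_cont du e0; exists d => // y' y'd.
by apply: hd => //; rewrite subrr normr0.
Qed.

Let cv y : y0 <= y <= y0 + k -> ctson x0 (x0 + h) (v^~ y).
Proof.
move=> hy x hx e e0; have [ux [uy [vx [_ dv]]]] := CR hx hy.
have [d d0 hd] := rdiff_cont dv e0; exists d => // x' x'd.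
by apply: hd => //; rewrite subrr normr0.
Qed.

Let J_quarter x y a b : 0 < a -> 0 < b -> x0 <= x -> x + a <= x0 + h ->
  y0 <= y -> y + b <= y0 + k ->
  J x y a b = J x y (a / 2) (b / 2) + J (x + a / 2) y (a / 2) (b / 2)
    + J x (y + b / 2) (a / 2) (b / 2) + J (x + a / 2) (y + b / 2) (a / 2) (b / 2).
Proof.
move=> a0 b0 hx hxa hy hyb; rewrite /J.
have Ea : x + a / 2 + a / 2 = x + a by field.
have Eb : y + b / 2 + b / 2 = y + b by field.
have ha : a / 2 < a by rlra.
have hb : b / 2 < b by rlra.
have ha0 : 0 < a / 2 by rlra.
have hb0 : 0 < b / 2 by rlra.
rewrite Ea Eb.
have U z : x0 <= z <= x0 + h -> ctson y (y + b) (u z).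
  by move=> hz; apply: ctson_sub (cu hz).
have V z : y0 <= z <= y0 + k -> ctson x (x + a) (v^~ z).
  by move=> hz; apply: ctson_sub (cv hz).
have X1 : x0 <= x <= x0 + h by rsplit.
have X2 : x0 <= x + a / 2 <= x0 + h by rsplit.
have X3 : x0 <= x + a <= x0 + h by rsplit.
have Y1 : y0 <= y <= y0 + k by rsplit.
have Y2 : y0 <= y + b / 2 <= y0 + k by rsplit.
have Y3 : y0 <= y + b <= y0 + k by rsplit.
have sU z (hz : x0 <= z <= x0 + h) : Iab y (y + b) (u z) =
    Iab y (y + b / 2) (u z) + Iab (y + b / 2) (y + b) (u z).
  by apply: Iab_split; [rlra|rlra|exact: U].
have sV z (hz : y0 <= z <= y0 + k) : Iab x (x + a) (v^~ z) =
    Iab x (x + a / 2) (v^~ z) + Iab (x + a / 2) (x + a) (v^~ z).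
  by apply: Iab_split; [rlra|rlra|exact: V].
have U1 z (hz : x0 <= z <= x0 + h) : ctson y (y + b / 2) (u z).
  by apply: ctson_sub (U z hz); rlra.
have U2 z (hz : x0 <= z <= x0 + h) : ctson (y + b / 2) (y + b) (u z).
  by apply: ctson_sub (U z hz); rlra.
have V1 z (hz : y0 <= z <= y0 + k) : ctson x (x + a / 2) (v^~ z).
  by apply: ctson_sub (V z hz); rlra.
have V2 z (hz : y0 <= z <= y0 + k) : ctson (x + a / 2) (x + a) (v^~ z).
  by apply: ctson_sub (V z hz); rlra.
rewrite !IabB; auto.
rewrite !sU // !sV //.
ring.
Qed.

Let good n (p : RR * RR) := [/\ x0 <= p.1, p.1 + h * pw n <= x0 + h, y0 <= p.2,
   p.2 + k * pw n <= y0 + k & `|J x0 y0 h k| * pw n ^+ 2 <= `|J p.1 p.2 (h * pw n) (k * pw n)|].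

(** The premise [good n p] sits inside the existential so that [choice] yields a total successor
    map. *)
Let step n p : exists q : RR * RR, good n p ->
  [/\ good n.+1 q, p.1 <= q.1, q.1 + h * pw n.+1 <= p.1 + h * pw n,
      p.2 <= q.2 & q.2 + k * pw n.+1 <= p.2 + k * pw n].
Proof.
case: (pselect (good n p)) => [gp|ng]; last by exists p.
have [g1 g2 g3 g4 g5] := gp.
have a0 : 0 < h * pw n by rewrite mulr_gt0 // pw_gt0.
have b0 : 0 < k * pw n by rewrite mulr_gt0 // pw_gt0.
have := J_quarter a0 b0 g1 g2 g3 g4.
set a := h * pw n in a0 g2 g5 *; set b := k * pw n in b0 g4 g5 *.
have pS : pw n.+1 = 1 / 2 * pw n by exact: exprS.
have aE : h * pw n.+1 = a / 2 by rewrite /a pS; field.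
have bE : k * pw n.+1 = b / 2 by rewrite /b pS; field.
have pE : pw n.+1 ^+ 2 = pw n ^+ 2 / 4 by rewrite pS; field.
set J1 := J _ _ (a / 2) _; set J2 := J _ _ (a / 2) _; set J3 := J _ _ (a / 2) _.
set J4 := J _ _ (a / 2) _ => JE.
set T := `|J x0 y0 h k| * pw n ^+ 2 in g5.
have : T / 4 <= `|J1| \/ T / 4 <= `|J2| \/ T / 4 <= `|J3| \/ T / 4 <= `|J4|.
  have [|n1] := leP (T / 4) `|J1|; first by left.
  have [|n2] := leP (T / 4) `|J2|; first by right; left.
  have [|n3] := leP (T / 4) `|J3|; first by right; right; left.
  have [|n4] := leP (T / 4) `|J4|; first by right; right; right.
  have := ler_normD (J1 + J2 + J3) J4; have := ler_normD (J1 + J2) J3.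
  have := ler_normD J1 J2; rewrite -JE; rlra.
have TE : `|J x0 y0 h k| * pw n.+1 ^+ 2 = T / 4 by rewrite pE mulrA.
move=> [H|[H|[H|H]]].
- exists (p.1, p.2) => _; rewrite /good /= TE aE bE; split; try split => //; rlra.
- exists (p.1 + a / 2, p.2) => _; rewrite /good /= TE aE bE; split; try split => //; rlra.
- exists (p.1, p.2 + b / 2) => _; rewrite /good /= TE aE bE; split; try split => //; rlra.
- exists (p.1 + a / 2, p.2 + b / 2) => _; rewrite /good /= TE aE bE; split; try split => //; rlra.
Qed.

Lemma rect_flux : J x0 y0 h k = 0.
Proof.
have [f hf] := choice (fun np : nat * (RR * RR) => step np.1 np.2).
pose s := fix s n := if n is m.+1 then f (m, s m) else (x0, y0).
have gs n : good n (s n).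
  elim: n => [|n IH]; last by have [] := hf (n, s n) IH.
  by rewrite /good /= /pw !expr0 expr1n !mulr1; split.
have [x hx] : exists x, forall n, (s n).1 <= x <= (s n).1 + h * pw n.
  apply: nested_point; [exact: x0|exact: ltW| |] => n;
  by have [] := hf (n, s n) (gs n).
have [y hy] : exists y, forall n, (s n).2 <= y <= (s n).2 + k * pw n.
  apply: nested_point; [exact: y0|exact: ltW| |] => n;
  by have [] := hf (n, s n) (gs n).
have hx0 := hx 0%N; have hy0 := hy 0%N.
rewrite /= /pw expr0 !mulr1 in hx0 hy0.
have [ux [uy [vx [du dv]]]] := CR hx0 hy0.
apply/eqP; rewrite -normr_eq0; apply/eqP/le_anti; rewrite normr_ge0 andbT.
apply/ler_addgt0Pr => e e0; rewrite add0r.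
pose L := h + k; have L0 : 0 < L by rewrite addr_gt0.
(* Linearisation at the limit point bounds the flux of the small rectangle by [2 e' (a + b) ^ 2].
   Undoing the scaling leaves [2 e' L ^ 2], which this choice makes [e / 2]. *)
have e1 : 0 < e / (4 * L ^+ 2) by rewrite divr_gt0 // mulr_gt0 // exprn_gt0.
set e' := e / (4 * L ^+ 2) in e1 *.
have [d1 d10 hd1] := du _ e1; have [d2 d20 hd2] := dv _ e1.
have [n hn] : exists n, L * pw n < Num.min d1 d2.
  have m0 : 0 < Num.min d1 d2 by rewrite lt_min d10.
  have mL : 0 < Num.min d1 d2 / L by rewrite divr_gt0.
  have [N hN] := pw_small mL; exists N.
  by rewrite mulrC -ltr_pdivlMr.
rewrite lt_min in hn; case/andP: hn => hn1 hn2.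
have [g1 g2 g3 g4 g5] := gs n.
have := hx n; have := hy n.
set p := (s n).1 in g1 g2 g5 *; set q := (s n).2 in g3 g4 g5 *.
have P0 := pw_gt0 n; set P := pw n in P0 hn1 hn2 g2 g4 g5 *.
set a := h * P in g2 g5 *; set b := k * P in g4 g5 *.
have a0 : 0 < a by rewrite mulr_gt0.
have b0 : 0 < b by rewrite mulr_gt0.
have LE : L * P = a + b by rewrite /L mulrDl.
rewrite LE in hn1 hn2.
move=> /andP[qy yq] /andP[px xp].
have eu x' y' : p <= x' <= p + a -> q <= y' <= q + b ->
    `|u x' y' - u x y - ux * (x' - x) - uy * (y' - y)| <= e' * (a + b).
  move=> /andP[p1 p2] /andP[q1 q2].
  have X : `|x' - x| <= a by rewrite ler_norml; rsplit.
  have Y : `|y' - y| <= b by rewrite ler_norml; rsplit.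
  apply: le_trans (hd1 _ _ _ _) _; try rlra.
  by rewrite ler_pM2l //; rlra.
have ev x' y' : p <= x' <= p + a -> q <= y' <= q + b ->
    `|v x' y' - v x y - vx * (x' - x) - ux * (y' - y)| <= e' * (a + b).
  move=> /andP[p1 p2] /andP[q1 q2].
  have X : `|x' - x| <= a by rewrite ler_norml; rsplit.
  have Y : `|y' - y| <= b by rewrite ler_norml; rsplit.
  apply: le_trans (hd2 _ _ _ _) _; try rlra.
  by rewrite ler_pM2l //; rlra.
have pp : p <= p <= p + a by rsplit.
have pa : p <= p + a <= p + a by rsplit.
have qq : q <= q <= q + b by rsplit.
have qb : q <= q + b <= q + b by rsplit.
have cU z : p <= z <= p + a -> ctson q (q + b) (u z).
  move=> /andP[z1 z2]; have hz : x0 <= z <= x0 + h by rsplit.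
  by apply: ctson_sub (cu hz).
have cV z : q <= z <= q + b -> ctson p (p + a) (v^~ z).
  move=> /andP[z1 z2]; have hz : y0 <= z <= y0 + k by rsplit.
  by apply: ctson_sub (cv hz).
have A : `|Iab q (q + b) (fun t => u (p + a) t - u p t) - ux * a * b| <= 2 * e' * (a + b) * b.
  have := @Iab_dist q (q + b) (fun t => u (p + a) t - u p t) (ux * a) (2 * e' * (a + b)).
  rewrite (_ : q + b - q = b); last ring.
  apply; first rlra.
    by apply: ctsonB; exact: cU.
  move=> t ht; have := eu _ t pa ht; have := eu _ t pp ht.
  set A1 := (X in `|X|); set A2 := (X in _ -> `|X| <= _ -> _).
  rewrite (_ : u (p + a) t - u p t - ux * a = A2 - A1); last by rewrite /A1 /A2; ring.
  by have := ler_normB A2 A1; rlra.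
have B : `|Iab p (p + a) (fun t => v t (q + b) - v t q) - ux * b * a| <= 2 * e' * (a + b) * a.
  have := @Iab_dist p (p + a) (fun t => v t (q + b) - v t q) (ux * b) (2 * e' * (a + b)).
  rewrite (_ : p + a - p = a); last ring.
  apply; first rlra.
    by apply: ctsonB; exact: cV.
  move=> t ht; have := ev t _ ht qb; have := ev t _ ht qq.
  set A1 := (X in `|X|); set A2 := (X in _ -> `|X| <= _ -> _).
  rewrite (_ : v t (q + b) - v t q - ux * b = A2 - A1); last by rewrite /A1 /A2; ring.
  by have := ler_normB A2 A1; rlra.
have Jle : `|J p q a b| <= 2 * e' * (a + b) ^+ 2.
  rewrite /J; set I1 := Iab q _ _ in A *; set I2 := Iab p _ _ in B *.
  have := ler_normB (I1 - ux * a * b) (I2 - ux * b * a).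
  rewrite (_ : I1 - ux * a * b - (I2 - ux * b * a) = I1 - I2); last ring.
  by rewrite expr2; rlra.
have : `|J x0 y0 h k| * P ^+ 2 <= 2 * e' * L ^+ 2 * P ^+ 2.
  by apply: le_trans g5 _; apply: le_trans Jle _; rewrite -LE exprMn mulrA.
rewrite ler_pM2r ?exprn_gt0 // => /le_trans; apply.
rewrite (_ : 2 * e' * L ^+ 2 = e / 2); last by rewrite /e'; field; rewrite gt_eqF.
rlra.
Qed.

End RectFlux.

Lemma circ_cexp a (s t : RR) : a + cexp (Complex s t) = circ a (expR s) t.
Proof. by []. Qed.

Lemma cabs_circ a (r t : RR) : 0 <= r -> cabs (circ a r t - a) = r.
Proof.
move=> r0; rewrite /circ addrC addKr.
apply/eqP; rewrite -(@eqrXn2 _ 2) ?cabs_ge0 // cabs_sqr /=.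
by rewrite !exprMn -mulrDr cos2Dsin2 mulr1.
Qed.

Definition hol_disc (F : CC -> CC) (a : CC) (r : RR) :=
  forall z, cabs (z - a) <= r -> exists l, cdiff F z l.

Lemma pi2_gt0 : 0 < 2 * pi :> RR.
Proof. by rewrite mulr_gt0 // pi_gt0. Qed.

Lemma cdiff_rdiff G (x y : RR) (l : CC) : cdiff G (Complex x y) l ->
  rdiff (fun x y => complex.Re (G (Complex x y))) x y (complex.Re l) (- complex.Im l) /\
  rdiff (fun x y => complex.Im (G (Complex x y))) x y (complex.Im l) (complex.Re l).
Proof.
move=> h.
have key e : 0 < e -> exists2 d : RR, 0 < d & forall x' y' : RR, `|x' - x| < d -> `|y' - y| < d ->
   cabs (G (Complex x' y') - G (Complex x y) - l * (Complex (x' - x) (y' - y)))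
     <= e * (`|x' - x| + `|y' - y|).
  move=> e0; have [d d0 hd] := h e e0.
  have d2 : 0 < d / 2 by lra.
  exists (d / 2) => // x' y' hx hy.
  have lt : cabs (Complex x' y' - Complex x y) <= `|x' - x| + `|y' - y|.
    exact: le_trans (cabs_le_ReIm _) _.
  apply: le_trans (hd (Complex x' y') _) _; first by lra.
  by rewrite ler_wpM2l // ltW.
split=> e e0; have [d d0 hd] := key e e0; exists d => // x' y' hx hy;
  have := hd x' y' hx hy; set D := _ - _ - _ => hD.
- apply: le_trans (_ : `|complex.Re D| <= _); last exact: le_trans (Re_le_cabs _) hD.
  rewrite /D !cReD !cReN cReM /=.
  by rewrite le_eqVlt; apply/orP; left; apply/eqP; congr (`|_|); ring.
- apply: le_trans (_ : `|complex.Im D| <= _); last exact: le_trans (Im_le_cabs _) hD.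
  rewrite /D !cImD !cImN cImM /=.
  by rewrite le_eqVlt; apply/orP; left; apply/eqP; congr (`|_|); ring.
Qed.

Lemma rdiff_ctson u v (a b : RR) (x : RR) :
  (forall y, a <= y <= b -> exists ux uy, rdiff u x y ux uy) -> v = u x -> ctson a b v.
Proof.
move=> h -> y yab e e0; have [ux [uy hu]] := h y yab.
have [d d0 hd] := rdiff_cont hu e0; exists d => // y' hy'.
by apply: hd => //; rewrite subrr normr0.
Qed.

(* In logarithmic coordinates [a + exp (s + i t)] the flux through the sides [t = 0] and [t = 2 pi]
   cancels, so the circle mean does not depend on the radius. *)
Lemma mean_value F a (r : RR) : 0 < r -> hol_disc F a r ->
  Iab 0 (2 * pi) (fun t => complex.Re (F (circ a r t))) = 2 * pi * complex.Re (F a).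
Proof.
move=> r0 hF; pose G z := F (a + cexp z).
have dG x y : x <= ln r -> exists l, cdiff G (Complex x y) l.
  move=> xr; have [|l hl] := hF (a + cexp (Complex x y)).
    by rewrite addrC addKr cabs_cexp /= -(lnK r0) ler_expR.
  exists (l * (0 + cexp (Complex x y))).
  exact: cdiff_comp (cdiffD (cdiff_cst a _) (cdiff_cexp _)) hl.
pose u x y := complex.Re (G (Complex x y)).
pose v x y := complex.Im (G (Complex x y)).
have cu x : x <= ln r -> ctson 0 (2 * pi) (u x).
  move=> xr; apply: (@rdiff_ctson u _ _ _ x) => // y _.
  have [l /cdiff_rdiff [hu _]] := dG x y xr.
  by exists (complex.Re l), (- complex.Im l).
have P2 := pi2_gt0.
have step x : x < ln r -> Iab 0 (2 * pi) (u (ln r)) = Iab 0 (2 * pi) (u x).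
  move=> xr; have h0 : 0 < ln r - x by rewrite subr_gt0.
  have CRx s t : x <= s <= x + (ln r - x) -> 0 <= t <= 0 + 2 * pi ->
      exists ux uy vx, rdiff u s t ux uy /\ rdiff v s t vx ux.
    rewrite (addrC x) subrK => /andP[_ sr] _; have [l /cdiff_rdiff [hu hv]] := dG s t sr.
    by exists (complex.Re l), (- complex.Im l), (complex.Im l).
  have := rect_flux h0 P2 CRx.
  rewrite add0r (addrC x) subrK.
  have per (t : RR) : v t (2 * pi) = v t 0.
    rewrite /v /G /cexp /=.
    have -> : cos (2 * pi) = cos (0 : RR) by rewrite mulr_natl cos2pi cos0.
    by have -> : sin (2 * pi) = sin (0 : RR) by rewrite mulr_natl sin2pi sin0.
  have -> : (fun t : RR => v t (2 * pi) - v t 0) = fun=> 0.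
    by apply/funext => t; rewrite per subrr.
  rewrite Iab_cst; last exact: ltW.
  rewrite mul0r subr0 IabB; [|exact: cu|by apply: cu; exact: ltW].
  by move=> /eqP; rewrite subr_eq0 => /eqP.
have uE : (fun t => complex.Re (F (circ a r t))) = u (ln r).
  by apply/funext => t; rewrite /u /G circ_cexp lnK.
rewrite uE; apply/eqP; rewrite -subr_eq0 -normr_eq0; apply/eqP/le_anti.
rewrite normr_ge0 andbT; apply/ler_addgt0Pr => e e0; rewrite add0r.
have e1 : 0 < e / (2 * pi) by rewrite divr_gt0.
have [l hl] : exists l, cdiff F a l by apply: hF; rewrite subrr cabs0 ltW.
have [d d0 hd] := cdiff_cont hl e1.
(* The mean is the same on the circle of radius [q], where [F] is already within [e / (2 pi)] of
   [F a]. *)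
pose q := Num.min (r / 2) (d / 2).
have q0 : 0 < q by rewrite lt_min; apply/andP; split; lra.
have qr : q < r by rewrite gt_min; apply/orP; left; lra.
have qd : q < d by rewrite gt_min; apply/orP; right; lra.
have lq : ln q < ln r by rewrite ltr_ln.
rewrite (step _ lq).
have := @Iab_dist 0 (2 * pi) (u (ln q)) (complex.Re (F a)) (e / (2 * pi)) (ltW P2) (cu _ (ltW lq)).
rewrite !subr0 divfK ?gt_eqF // (mulrC (2 * pi)); apply => t _.
rewrite /u /G circ_cexp lnK // -cReN -cReD; apply: le_trans (Re_le_cabs _) _.
by apply/ltW/hd; rewrite cabs_circ // ltW.
Qed.

Lemma hol_disc_ctson F a (r : RR) b c : 0 < r -> hol_disc F a r ->
  ctson b c (fun t => complex.Re (F (circ a r t))).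
Proof.
move=> r0 hF; apply: (@rdiff_ctson (fun x y => complex.Re (F (a + cexp (Complex x y)))) _ _ _ (ln r)).
  move=> y _; have [|l hl] := hF (a + cexp (Complex (ln r) y)).
    by rewrite addrC addKr cabs_cexp /= lnK.
  have := cdiff_comp (cdiffD (cdiff_cst a _) (cdiff_cexp _)) hl.
  by move=> /cdiff_rdiff [hu _]; eexists _, _; exact: hu.
by apply/funext => t; rewrite circ_cexp lnK.
Qed.

Lemma hol_poly (P : {poly CC}) a r : hol_disc (horner P) a r.
Proof. by move=> z _; exact: cdiff_poly. Qed.

Lemma cRe_sum (I : finType) (F : I -> CC) :
  complex.Re (\sum_i F i) = \sum_i complex.Re (F i).
Proof. by elim/big_rec2 : _ => // i x y _ <-; rewrite cReD. Qed.

Lemma cabsD_sqr (z w : CC) :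
  cabs (z + w) ^+ 2 = cabs z ^+ 2 + cabs w ^+ 2 + 2 * complex.Re (z * w^*).
Proof. rewrite !cabs_sqr cReD cImD cReM; case: z w => [a b] [c d] /=; ring. Qed.

Lemma mulc_conj (z : CC) : z * z^* = (cabs z ^+ 2)%:C.
Proof.
apply/eqP; rewrite eq_complex cReM cImM cabs_sqr; case: z => [a b] /=.
by apply/andP; split; apply/eqP; ring.
Qed.

Lemma cRe2 (z : CC) : complex.Re (2 * z) = 2 * complex.Re z.
Proof. by rewrite mulr_natl mulr2n cReD mulr_natl mulr2n. Qed.

Lemma cRe_scale (a : RR) (z : CC) : complex.Re (a%:C * z) = a * complex.Re z.
Proof. by rewrite cReM /= mul0r subr0. Qed.

(** * The Fejer kernel *)

Definition geom (n : nat) (x : CC) : CC := \sum_(k < n) x ^+ k.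

Lemma geomS n x : geom n.+1 x = geom n x + x ^+ n.
Proof. by rewrite /geom big_ord_recr. Qed.

Lemma geomSl n x : geom n.+1 x = 1 + x * geom n x.
Proof.
rewrite /geom big_ord_recl expr0 mulr_sumr; congr (_ + _).
by apply: eq_bigr => i _; rewrite -exprS.
Qed.

(** An analytic polynomial whose real part on the unit circle is [n] times the classical Fejer
    kernel; see [fejer_re]. *)
Definition fejer (n : nat) : {poly CC} :=
  \sum_(k < n) (1 + 2%:P * ('X * \sum_(m < k) 'X^m)).

Lemma fejerE n x : (fejer n).[x] = \sum_(k < n) (1 + 2 * (x * geom k x)).
Proof.
rewrite /fejer horner_sum; apply: eq_bigr => k _.
rewrite hornerD !hornerM hornerX !hornerC horner_sum.
by congr (_ + _ * (_ * _)); apply: eq_bigr => i _; rewrite hornerXn.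
Qed.

(** For [|x| = 1] the product of [x ^ k] with the conjugate of [x ^ n] is the conjugate of
    [x ^ (n - k)], and [n - k] runs through [1, ..., n]. This is the cross term in the induction of
    [fejer_re]. *)
Lemma geom_conj n x : cabs x = 1 -> geom n x * (x ^+ n)^* = (x * geom n x)^*.
Proof.
move=> x1; elim: n => [|n IH]; first by rewrite /geom big_ord0 mul0r mulr0 conjc0.
have -> : (x * geom n.+1 x)^* = x^* * (1 + geom n x * (x ^+ n)^* ).
  by rewrite geomSl rmorphM rmorphD rmorph1 IH.
rewrite geomS exprS rmorphM mulrDl.
have -> : x ^+ n * (x^* * (x ^+ n)^* ) = x^*.
  by rewrite mulrCA mulc_conj cabsX x1 !expr1n mulr1.
ring.
Qed.

Lemma fejer_re n x : cabs x = 1 -> complex.Re (fejer n).[x] = cabs (geom n x) ^+ 2.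
Proof.
move=> x1; rewrite fejerE; elim: n => [|n IH].
  by rewrite /geom !big_ord0 cabs0 expr0n.
rewrite big_ord_recr cReD IH geomS cabsD_sqr cabsX x1 !expr1n -addrA; congr (_ + _).
rewrite geom_conj // cReD cRe2; congr (_ + _ * _).
by case: (x * _).
Qed.

(** [(x - 1) * geom n x = x ^ n - 1] has modulus at most 2. *)
Lemma fejer_tail n x : cabs x = 1 ->
  complex.Re (fejer n).[x] * cabs (x - 1) ^+ 2 <= 4.
Proof.
move=> x1; rewrite fejer_re // -exprMn -cabsM mulrC -subrX1.
have := cabsD (x ^+ n) (-1); rewrite cabsN cabs1 cabsX x1 expr1n => h.
have := cabs_ge0 (x ^+ n - 1); nra.
Qed.

(** For [|x| <= 1 / 5] the geometric tail is at most [(1 / 5) / (1 - 1 / 5) = 1 / 4], so each of the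
    [n] summands keeps a real part of at least [1 - 2 / 4]. *)
Lemma fejer_small n x : cabs x <= 1 / 5 -> n%:R / 2 <= complex.Re (fejer n).[x].
Proof.
move=> x5; rewrite fejerE cRe_sum.
have U k : cabs (x * geom k x) <= 1 / 4.
  elim: k => [|k IH]; first by rewrite /geom big_ord0 mulr0 cabs0.
  rewrite geomSl cabsM; have := cabsD 1 (x * geom k x); rewrite cabs1 => h.
  have := cabs_ge0 (1 + x * geom k x); have := cabs_ge0 x; nra.
rewrite (_ : n%:R / 2 = \sum_(k < n) (1 / 2 : RR)); last first.
  by rewrite sumr_const card_ord -[RHS]mulr_natl div1r.
apply: ler_sum => k _; rewrite cReD cRe2 /=.
have := le_trans (Re_le_cabs _) (U k); rewrite ler_norml => /andP[h _].
lra.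
Qed.

Lemma fejer0 n : (fejer n).[0] = n%:R.
Proof.
rewrite fejerE (eq_bigr (fun=> 1)) => [|k _]; last by rewrite mul0r mulr0 addr0.
by rewrite sumr_const card_ord.
Qed.

Definition zeta (n : nat) : CC := cexp (Complex 0 (2 * pi / n%:R)).

Lemma cexp_pow (t : RR) m : cexp (Complex 0 t) ^+ m = cexp (Complex 0 (t * m%:R)).
Proof.
elim: m => [|m IH].
  by rewrite expr0 mulr0 /cexp /= expR0 cos0 sin0 mulr1 mulr0.
rewrite exprS IH -cexpD; congr cexp; apply/eqP; rewrite eq_complex /= addr0 eqxx /=.
by rewrite -natr1 mulrDr mulr1 addrC.
Qed.

Lemma cabs_zeta n : cabs (zeta n) = 1.
Proof. by rewrite cabs_cexp expR0. Qed.

Lemma zeta_pow n : (0 < n)%N -> zeta n ^+ n = 1.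
Proof.
move=> n0; rewrite /zeta cexp_pow divfK ?pnatr_eq0 -?lt0n //.
by rewrite /cexp /= expR0 mulr_natl cos2pi sin2pi mulr1 mulr0.
Qed.

Lemma zeta_pow_neq1 n m : (0 < m < n)%N -> zeta n ^+ m != 1.
Proof.
move=> /andP[m0 mn]; rewrite /zeta cexp_pow eq_complex negb_and.
apply/orP; left; rewrite /= expR0 mul1r.
have n0 : 0 < n%:R :> RR by rewrite ltr0n (leq_ltn_trans _ mn).
have -> : 2 * pi / n%:R * m%:R = (pi * m%:R / n%:R : RR) *+ 2.
  by rewrite -mulr_natl; field; rewrite gt_eqF.
set y : RR := _ / _.
have y0 : 0 < y by rewrite divr_gt0 // mulr_gt0 ?pi_gt0 // ltr0n.
have y1 : y < pi by rewrite ltr_pdivrMr // ltr_pM2l ?pi_gt0 // ltr_nat.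
have s0 : 0 < sin y by rewrite sin_gt0_pi // y0 y1.
have c1 := cos2Dsin2 y.
rewrite mulr2n cosD; apply/negP => /eqP h.
have : 0 < sin y ^+ 2 by rewrite exprn_gt0.
by rewrite -!expr2 in h; lra.
Qed.

Lemma sum_zeta n m : (0 < m < n)%N -> \sum_(j < n) zeta n ^+ j ^+ m = 0.
Proof.
move=> /[dup] mn /zeta_pow_neq1 h1.
have n0 : (0 < n)%N by case/andP: mn => m0; exact: leq_ltn_trans.
have : zeta n ^+ m ^+ n - 1 = 0.
  by rewrite -exprM mulnC exprM zeta_pow // expr1n subrr.
rewrite subrX1 => /eqP; rewrite mulf_eq0 subr_eq0 (negbTE h1) /= => /eqP h.
by rewrite -[RHS]h; apply: eq_bigr => j _; rewrite -!exprM mulnC.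
Qed.

(** Summation over the [n]-th roots of unity kills every power [x ^ m] with [0 < m < n]; only the
    constant terms survive. *)
Lemma fejer_partition n x : (0 < n)%N ->
  \sum_(j < n) (fejer n).[x * zeta n ^+ j] = (n * n)%:R.
Proof.
move=> n0; under eq_bigr do rewrite fejerE.
rewrite exchange_big /=.
rewrite (eq_bigr (fun=> n%:R)) => [|k _]; last first.
  rewrite big_split /= sumr_const card_ord -mulr_sumr.
  rewrite (_ : \sum_i _ = 0) ?mulr0 ?addr0 //.
  under eq_bigr do rewrite /geom mulr_sumr.
  rewrite exchange_big /= big1 // => m _.
  under eq_bigr do rewrite -exprS exprMn.
  rewrite -mulr_sumr sum_zeta ?mulr0 //.
  by rewrite /= (leq_ltn_trans _ (ltn_ord k)).
by rewrite sumr_const card_ord natrM mulr_natr.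
Qed.

(* Discrete convolution with the kernel over the [n]-th roots of unity; positivity of the kernel on
   [|x| <= 1 / 5] gives a Harnack inequality for the approximating polynomial. *)
Lemma fejer_approx (c : CC -> RR) (k r e : RR) : 0 < r -> 0 <= k -> 0 < e ->
  (forall x y, cabs x = r -> cabs y = r -> `|c x - c y| <= k * cabs (x - y)) ->
  exists P : {poly CC}, (forall x, cabs x = r -> `|c x - complex.Re P.[x]| < e) /\
   forall C : RR, (forall x, cabs x = r -> c x <= C) ->
     forall z, cabs z <= r / 5 -> complex.Re P.[z] - C <= (complex.Re P.[0] - C) / 2.
Proof.
move=> r0 k0 e0 lipc.
(* [d] makes the first error term [k d r] less than [e / 2]; [n] does the same for the second one,
   [4 k r / (n d)]. *)
pose d := e / (2 * (k * r + 1)).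
have kr0 : 0 <= k * r by rewrite mulr_ge0 // ltW.
have d0 : 0 < d by rewrite divr_gt0 // mulr_gt0 //; lra.
pose n := (Num.bound (8 * (k * r) / (e * d))).+1.
have n0 : (0 < n)%N by [].
have nn0 : 0 < n%:R :> RR by rewrite ltr0n.
have nb : 8 * (k * r) / (e * d) < n%:R.
  have h0 : 0 <= 8 * (k * r) / (e * d) by apply: divr_ge0; apply: mulr_ge0 => //; exact: ltW.
  by apply: lt_trans (archi_boundP h0) _; rewrite ltr_nat.
pose w := zeta n; have w1 : cabs w = 1 by exact: cabs_zeta.
have wj j : cabs (w ^+ j) = 1 by rewrite cabsX w1 expr1n.
have wj0 j : w ^+ j != 0 by rewrite -cabs_gt0 wj.
have rC0 : r%:C != 0 :> CC by rewrite -cabs_gt0 cabs_real gtr0_norm.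
pose y (j : nat) : CC := r%:C / w ^+ j.
have yr j : cabs (y j) = r by rewrite cabsM cabsV wj cabs_real gtr0_norm // invr1 mulr1.
pose X (j : nat) (x : CC) := (x / r%:C) * w ^+ j.
pose g j : {poly CC} := fejer n \Po ((w ^+ j / r%:C) *: 'X).
have gE j x : (g j).[x] = (fejer n).[X j x].
  by rewrite /g horner_comp hornerZ hornerX /X; congr (_.[_]); ring.
pose K j x : RR := complex.Re (g j).[x] / (n * n)%:R.
pose P : {poly CC} := \sum_(j < n) (c (y j) / (n * n)%:R)%:C *: g j.
have n20 : 0 < (n * n)%:R :> RR by rewrite ltr0n muln_gt0.
have PE x : complex.Re P.[x] = \sum_(j < n) c (y j) * K j x.
  rewrite /P horner_sum cRe_sum; apply: eq_bigr => j _.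
  by rewrite hornerZ cReM /= mul0r subr0 /K mulrAC -mulrA.
have Ksum x : \sum_(j < n) K j x = 1.
  rewrite /K -mulr_suml; under eq_bigr do rewrite gE.
  rewrite -cRe_sum /X fejer_partition //.
  rewrite (_ : complex.Re _ = (n * n)%:R) ?divff ?gt_eqF //.
  by rewrite -[(n * n)%:R : CC](@rmorph_nat _ _ (real_complex RR)).
have Kcirc j x : cabs x = r -> 0 <= K j x /\ K j x * cabs (x - y j) ^+ 2 <= 4 * r ^+ 2 / (n * n)%:R.
  move=> xr; have X1 : cabs (X j x) = 1.
    by rewrite /X !cabsM cabsV xr cabs_real gtr0_norm // wj mulr1 divff // gt_eqF.
  have -> : cabs (x - y j) = r * cabs (X j x - 1).
    rewrite -{1}(gtr0_norm r0) -cabs_real -cabsM -[LHS](mulr1) -(wj j) -cabsM.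
    by congr cabs; rewrite /X /y; field; rewrite rC0 wj0.
  rewrite /K gE; split.
    by rewrite divr_ge0 ?(ltW n20) // fejer_re // exprn_ge0 // cabs_ge0.
  rewrite mulrAC ler_pM2r ?invr_gt0 // exprMn mulrCA.
  by rewrite (mulrC 4) ler_pM2l ?exprn_gt0 // fejer_tail.
exists P; split.
  move=> x xr; rewrite PE.
  have -> : c x = \sum_(j < n) c x * K j x by rewrite -mulr_sumr Ksum mulr1.
  rewrite -sumrB; apply: le_lt_trans (ler_norm_sum _ _ _) _.
  apply: (@le_lt_trans _ _ (\sum_(j < n) (k * d * r * K j x + k * (4 * r / (n * n)%:R / d)))).
    apply: ler_sum => j _; rewrite -mulrBl normrM.
    have [K0 K1] := Kcirc j x xr; rewrite (ger0_norm K0).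
    have L := lipc x (y j) xr (yr j).
    set t := cabs (x - y j) in L K1.
    have t0 : 0 <= t := cabs_ge0 _.
    apply: le_trans (ler_wpM2r K0 L) _.
    set Kv := K j x in K0 K1 *; set Q := 4 * r ^+ 2 / (n * n)%:R in K1.
    have dr0 : 0 < d * r by rewrite mulr_gt0.
    (* Instead of separating near nodes from far ones: [t <= d r + t ^ 2 / (d r)], weighted by the
       kernel, whose product with [t ^ 2] is at most [Q]. *)
    have key : t * Kv <= d * r * Kv + Q / (d * r).
      rewrite -(ler_pM2r dr0) mulrDl divfK ?gt_eqF //.
      have : 0 <= Kv * ((d * r) ^+ 2 - t * (d * r) + t ^+ 2).
        by apply: mulr_ge0 => //; move: (d * r) dr0 => q q0; clear -q0 t0; nra.
      by move: (d * r) K1 => q K1; clear -K1; lra.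
    rewrite (_ : k * d * r * Kv + _ = k * (d * r * Kv + Q / (d * r))); last first.
      by rewrite /Q; field; rewrite !gt_eqF // nn0.
    by rewrite -[leLHS]mulrA; apply: ler_wpM2l.
  rewrite big_split /= -mulr_sumr Ksum mulr1 sumr_const card_ord.
  have A : k * d * r < e / 2.
    rewrite /d (_ : k * _ * r = e / 2 * (k * r / (k * r + 1))); last first.
      by field; rewrite gt_eqF //; lra.
    rewrite gtr_pMr; last lra.
    by rewrite ltr_pdivrMr; lra.
  have B : k * (4 * r / (n * n)%:R / d) *+ n < e / 2.
    rewrite -mulr_natr natrM.
    rewrite (_ : _ * n%:R = 8 * (k * r) / (e * d) / n%:R * (e / 2)); last first.
      by field; rewrite !gt_eqF.
    rewrite gtr_pMl; last lra.
    by rewrite ltr_pdivrMr // mul1r.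
  lra.
move=> C cC z zr.
have rew x : complex.Re P.[x] - C = \sum_(j < n) (c (y j) - C) * K j x.
  rewrite PE -[in LHS](mulr1 C) -(Ksum x) mulr_sumr -sumrB.
  by apply: eq_bigr => j _; rewrite mulrBl.
(* Harnack's inequality termwise: the weights [c (y j) - C] are nonpositive, and the kernel at [z]
   is at least half its value at [0]. *)
rewrite !rew mulr_suml; apply: ler_sum => j _.
have cj : c (y j) - C <= 0 by rewrite subr_le0 cC.
have X0 : X j 0 = 0 by rewrite /X mul0r mul0r.
have Xz : cabs (X j z) <= 1 / 5.
  rewrite /X !cabsM cabsV wj mulr1 cabs_real gtr0_norm // ler_pdivrMr //.
  by rewrite mulrC mulrA mulr1.
rewrite -mulrA; apply: ler_wnM2l => //.
rewrite /K !gE X0 fejer0 mulrAC ler_pM2r ?invr_gt0 //.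
by have := fejer_small n Xz; rewrite -[n%:R : CC](@rmorph_nat _ _ (real_complex RR)).
Qed.

(** * Circle means of functions bounded above *)

Lemma sube_ge0_fin (R : realType) (C : R) (y : \bar R) :
  (y <= C%:E)%E -> (0 <= C%:E - y)%E.
Proof.
case: y => [a| |]; first by rewrite -EFinB !lee_fin subr_ge0.
  by rewrite leNgt ltry.
by move=> _; rewrite leey.
Qed.

Section BoundedAboveIntegral.
Local Open Scope ereal_scope.
Context d (T : measurableType d) (R : realType) (m : {measure set T -> \bar R}).
Variables (D : set T) (mD : measurable D) (L : R) (mL : m D = L%:E).

Lemma le_integral_measurable (f g : T -> \bar R) :
  measurable_fun D f -> measurable_fun D g -> (forall x, D x -> f x <= g x) ->
  \int[m]_(x in D) f x <= \int[m]_(x in D) g x.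
Proof.
move=> mf mg fg; rewrite integralE [leRHS]integralE; apply: leeB.
- apply: ge0_le_integral => //; try exact: measurable_funepos.
  by move=> x Dx; rewrite !funeposE; apply: le_max2 => //; exact: fg.
- apply: ge0_le_integral => //; try exact: measurable_funeneg.
  by move=> x Dx; rewrite !funenegE; apply: le_max2 => //; rewrite leeN2; exact: fg.
Qed.

(* Functions bounded above may fail to be integrable, so every statement on them is reflected to the
   nonnegative function [C - f]. *)
Lemma integral_reflect (f : T -> \bar R) (C : R) : (0 <= C)%R ->
  measurable_fun D f -> (forall x, D x -> f x <= C%:E) ->
  \int[m]_(x in D) f x = (C * L)%:E - \int[m]_(x in D) (C%:E - f x).
Proof.
move=> C0 mf fC.
have mp := measurable_funepos mf; have mn := measurable_funeneg mf.
have hC x : D x -> 0 <= C%:E - f^\+ x.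
  move=> Dx; apply: sube_ge0_fin; rewrite funeposE ge_max lee_fin C0 andbT; exact: fC.
have C0' : 0 <= C%:E :> \bar R by rewrite lee_fin.
have pC x : D x -> f^\+ x <= C%:E.
  by move=> Dx; rewrite funeposE ge_max C0' andbT; exact: fC.
have mCp : measurable_fun D (fun x => C%:E - f^\+ x).
  by apply: emeasurable_funB => //; exact: measurable_cst.
have E1 : \int[m]_(x in D) (C%:E - f x) =
    \int[m]_(x in D) (C%:E - f^\+ x) + \int[m]_(x in D) f^\- x.
  rewrite -ge0_integralD //.
  apply: eq_integral => x /set_mem Dx.
  rewrite {1}(funeposneg f).
  have := pC x Dx; have := funepos_ge0 f x; have := funeneg_ge0 f x.
  case: (f^\+ x) => [a| |] //; case: (f^\- x) => [b| |] // *.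
  by rewrite -!EFinB -!EFinD; congr EFin; ring.
have E2 : (C * L)%:E = \int[m]_(x in D) (C%:E - f^\+ x) + \int[m]_(x in D) f^\+ x.
  rewrite -ge0_integralD //.
  rewrite (eq_integral (cst C%:E)); first by rewrite integral_cst // mL.
  move=> x /set_mem Dx /=; have := pC x Dx; have := funepos_ge0 f x.
  case: (f^\+ x) => [a| |] // *.
  by rewrite -EFinB -EFinD subrK.
have A0 : 0 <= \int[m]_(x in D) (C%:E - f^\+ x).
  exact: integral_ge0.
have P0 : 0 <= \int[m]_(x in D) f^\+ x by apply: integral_ge0 => x _; exact: funepos_ge0.
have N0 : 0 <= \int[m]_(x in D) f^\- x by apply: integral_ge0 => x _; exact: funeneg_ge0.
rewrite integralE E1; move: E2 A0 P0 N0.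
case: (\int[m]_(x in D) (C%:E - f^\+ x)) => [a| |];
  case: (\int[m]_(x in D) f^\+ x) => [p| |];
  case: (\int[m]_(x in D) f^\- x) => [n| |]; try by move=> ? ? ? ?.
by move=> [->] _ _ _; rewrite -!EFinD; congr EFin; ring.
Qed.

Lemma le_integralD (f g : T -> \bar R) (C : R) : (0 <= C)%R ->
  measurable_fun D f -> measurable_fun D g ->
  (forall x, D x -> f x <= C%:E) -> (forall x, D x -> g x <= C%:E) ->
  \int[m]_(x in D) f x + \int[m]_(x in D) g x <= \int[m]_(x in D) (f x + g x).
Proof.
move=> C0 mf mg fC gC; have CC0 : (0 <= C + C)%R by exact: addr_ge0.
rewrite (integral_reflect C0 mf fC) (integral_reflect C0 mg gC).
rewrite (@integral_reflect (fun x => f x + g x) (C + C) CC0); last 2 first.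
- exact: emeasurable_funD.
- by move=> x Dx; rewrite EFinD; apply: leeD; [exact: fC|exact: gC].
have mc h : measurable_fun D h -> measurable_fun D (fun x => C%:E - h x).
  by move=> mh; apply: emeasurable_funB => //; exact: measurable_cst.
rewrite (_ : \int[m]_(x in D) ((C + C)%:E - _) =
   \int[m]_(x in D) (C%:E - f x) + \int[m]_(x in D) (C%:E - g x)); last first.
  rewrite -ge0_integralD //; try exact: mc;
    try by move=> x Dx; apply: sube_ge0_fin; by [exact: fC|exact: gC].
  apply: eq_integral => x /set_mem Dx; move: (fC x Dx) (gC x Dx).
  case: (f x) => [a| |] //; case: (g x) => [b| |] // *.
  by rewrite -!EFinD; congr EFin; ring.
have A0 : 0 <= \int[m]_(x in D) (C%:E - f x).
  by apply: integral_ge0 => x Dx; apply: sube_ge0_fin; exact: fC.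
have B0 : 0 <= \int[m]_(x in D) (C%:E - g x).
  by apply: integral_ge0 => x Dx; apply: sube_ge0_fin; exact: gC.
move: A0 B0; case: (\int[m]_(x in D) (C%:E - f x)) => [a| |] //;
  case: (\int[m]_(x in D) (C%:E - g x)) => [b| |] // _ _.
by rewrite -!EFinD lee_fin; lra.
Qed.

(** Monotone convergence for the increasing nonnegative functions [C - f n]. The hypothesis on [b]
    says that the infimum of the [f n] is at most [g]. *)
Lemma integral_decreasing_ge (f : nat -> T -> \bar R) (g : T -> \bar R) (C : R) (c : R) :
  (0 <= C)%R -> (forall n, measurable_fun D (f n)) -> measurable_fun D g ->
  (forall n x, D x -> f n x <= C%:E) -> (forall n x, D x -> f n.+1 x <= f n x) ->
  (forall x b, D x -> g x < b%:E -> exists n, f n x < b%:E) ->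
  (forall x, D x -> g x <= C%:E) ->
  (forall n, c%:E <= \int[m]_(x in D) f n x) -> c%:E <= \int[m]_(x in D) g x.
Proof.
move=> C0 mf mg fC df fg gC cf.
have dec n k x : D x -> f (n + k)%N x <= f n x.
  by move=> Dx; elim: k => [|k IH]; rewrite ?addn0 // addnS; exact: le_trans (df _ _ Dx) IH.
pose h n x := C%:E - f n x.
have mh n : measurable_fun D (h n).
  by apply: emeasurable_funB => //; exact: measurable_cst.
have h0 n x : D x -> 0 <= h n x by move=> Dx; apply: sube_ge0_fin; exact: fC.
have nh x : D x -> nondecreasing_seq (h ^~ x).
  by move=> Dx n k /subnKC <-; apply: leeB => //; exact: dec.
have hle n : \int[m]_(x in D) h n x <= (C * L - c)%:E.
  have := cf n; rewrite (integral_reflect C0 (mf n) (fC n)).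
  have : 0 <= \int[m]_(x in D) h n x by apply: integral_ge0 => x Dx; exact: h0.
  rewrite /h; case: (\int[m]_(x in D) (C%:E - f n x)) => [a| |] // _.
  by rewrite -EFinD !lee_fin; lra.
have lim_le : \int[m]_(x in D) limn (h ^~ x) <= (C * L - c)%:E.
  rewrite monotone_convergence //.
  apply: lime_le; last by apply: nearW => n; exact: hle.
  apply: ereal_nondecreasing_is_cvgn => n k nk.
  by apply: ge0_le_integral => // x Dx; [exact: h0|exact: nh].
have gle : \int[m]_(x in D) (C%:E - g x) <= \int[m]_(x in D) limn (h ^~ x).
  apply: ge0_le_integral => //.
  - by move=> x Dx; apply: sube_ge0_fin; exact: gC.
  - by apply: emeasurable_funB => //; exact: measurable_cst.
  - by apply: emeasurable_fun_cvg mh _ => x Dx; apply: ereal_nondecreasing_is_cvgn; exact: nh.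
  move=> x Dx; have lE : limn (h ^~ x) = ereal_sup (range (h ^~ x)).
    by apply/cvg_lim => //; exact: ereal_nondecreasing_cvgn (nh x Dx).
  have key (b : R) : b%:E < C%:E - g x -> b%:E <= limn (h ^~ x).
    move=> hb; have [n hn] : exists n, f n x < (C - b)%:E.
      apply: fg => //; move: hb; case: (g x) (gC x Dx) => [a| |] //.
        by rewrite -EFinB !lte_fin => _ ?; lra.
      by rewrite ltNyr.
    rewrite lE; apply: (@le_trans _ _ (h n x)); last by apply: ereal_sup_ubound; exists n.
    rewrite /h; move: hn (fC n x Dx); case: (f n x) => [a| |] //.
      by rewrite -EFinB !lte_fin !lee_fin => ? ?; lra.
    by move=> _ _ /=; rewrite leey.
  have := gC x Dx; case E : (g x) => [a| |] // _.
    rewrite -EFinB; apply/lee_addgt0Pr => e e0.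
    rewrite -leeBlDr //= -EFinB; apply: key; rewrite E -EFinB lte_fin; lra.
  have -> : limn (h ^~ x) = +oo; last by rewrite leey.
  by apply/eqyP => b b0; apply: key; rewrite E /= ltry.
rewrite (integral_reflect C0 mg gC); have := le_trans gle lim_le.
have : 0 <= \int[m]_(x in D) (C%:E - g x).
  by apply: integral_ge0 => x Dx; apply: sube_ge0_fin; exact: gC.
case: (\int[m]_(x in D) (C%:E - g x)) => [a| |] // _.
by rewrite -EFinD !lee_fin; lra.
Qed.

End BoundedAboveIntegral.

Definition Sc (r : RR) : set CC := [set l | cabs l = r].

(** The centre is fixed at [0]; other circles are reached by translating the function, see
    [cmean_circ]. *)
Definition cmean (g : CC -> \bar RR) (r : RR) : \bar RR :=
  ((2 * pi)^-1%:E * \int[mu]_(t in `[0%R, (2 * pi)%R]) g (circ 0%R r t))%E.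

Lemma Sc_circ (r t : RR) : 0 < r -> Sc r (circ 0%R r t).
Proof. by move=> r0; rewrite /Sc /= -[circ _ _ _]subr0 cabs_circ // ltW. Qed.

Lemma circ_cont (r t : RR) : 0 < r -> forall e : RR, 0 < e -> exists2 d : RR, 0 < d &
  forall t', `|t' - t| < d -> cabs (circ 0%R r t' - circ 0%R r t) < e.
Proof.
move=> r0 e e0; have [d d0 hd] := cdiff_cont (@cdiff_cexp (Complex (ln r) t)) e0.
exists d => // t' ht; have := hd (Complex (ln r) t').
rewrite -[cexp (Complex _ t')]add0r -[cexp (Complex _ t)]add0r !circ_cexp lnK //.
by apply; rewrite (le_lt_trans (cabs_le_ReIm _)) //= subrr normr0 add0r.
Qed.

Lemma usc_rel_circ g (r : RR) : 0 < r -> usc_rel (Sc r) g ->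
  measurable_fun setT ((fun t => g (circ 0%R r t)) : measurableTypeR RR -> \bar RR).
Proof.
move=> r0 ug; rewrite (_ : (fun t => _) = (fun t => (- (- g (circ 0%R r t)))%E)); last first.
  by apply/funext => t; rewrite oppeK.
apply: measurableT_comp => //; apply: lower_semicontinuous_measurable => t a ha.
have gl : (g (circ 0%R r t) < (- a)%:E)%E by rewrite EFinN lteNr.
have /nbhsCE [s s0 hs] := ug _ (Sc_circ t r0) _ gl.
have [d d0 hd] := circ_cont t r0 s0.
exists [set t' | `|t' - t| < d].
  by apply/nbhs_ballP; exists d => // t'; rewrite /ball /= distrC.
move=> t' /hd /hs /(_ (Sc_circ t' r0)); by rewrite EFinN lteNr.
Qed.

Lemma mu_period : mu [set` `[0, (2 * pi)%R]] = (2 * pi)%:E.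
Proof.
have /= -> := @lebesgue_measure_itv RR `[0, 2 * pi].
by rewrite lte_fin pi2_gt0 oppr0 adde0.
Qed.

Lemma usc_circle_bounded g (r : RR) : 0 < r -> usc_rel (Sc r) g ->
  (forall l, Sc r l -> (g l < +oo)%E) ->
  exists2 C : RR, 0 <= C & forall l, Sc r l -> (g l <= C%:E)%E.
Proof.
move=> r0 ug gy.
have cS : compact (Sc r).
  have := @compact_circle 0 r; congr compact; apply/funext => z /=.
  by rewrite subr0.
have [x Sx hx] : exists2 x, Sc r x & forall y, Sc r y -> (g y <= g x)%E.
  by apply: usc_rel_max cS _ ug; exists (circ 0%R r 0); exact: Sc_circ.
exists (Num.max 0 (fine (g x))); first by rewrite le_max lexx.
move=> l /hx /le_trans; apply; have := gy x Sx.
case: (g x) => [a| |] //= _; last by rewrite leNye.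
by rewrite lee_fin le_max lexx orbT.
Qed.

Lemma cmean_le_hol g F (r : RR) : 0 < r -> hol_disc F 0 r -> usc_rel (Sc r) g ->
  (forall l, Sc r l -> (g l <= (complex.Re (F l))%:E)%E) ->
  (cmean g r <= (complex.Re (F 0))%:E)%E.
Proof.
move=> r0 hF ug gF; have P2 := pi2_gt0.
have cF := @hol_disc_ctson F 0 r 0 (2 * pi) r0 hF.
have iF := ctson_integrable cF.
have le1 : (\int[mu]_(t in `[0%R, (2 * pi)%R]) g (circ 0%R r t) <=
   \int[mu]_(t in `[0%R, (2 * pi)%R]) (complex.Re (F (circ 0%R r t)))%:E)%E.
  apply: le_integral_measurable => //.
  - by apply: measurable_funTS; exact: usc_rel_circ.
  - exact: (measurable_int mu).
  - by move=> t _; apply: gF; exact: Sc_circ.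
have E : (\int[mu]_(t in `[0%R, (2 * pi)%R]) (complex.Re (F (circ 0%R r t)))%:E =
   (2 * pi * complex.Re (F 0))%:E)%E.
  rewrite -(mean_value r0 hF) /Iab /Rintegral fineK //.
  exact: integrable_fin_num.
rewrite E in le1; rewrite /cmean.
apply: le_trans (lee_wpmul2l _ le1) _; first by rewrite lee_fin invr_ge0 ltW.
by rewrite -EFinM mulrA mulVf ?mul1r // gt_eqF.
Qed.

Lemma cmean_ge_cst g (r c : RR) :
  ((2 * pi * c)%:E <= \int[mu]_(t in `[0%R, (2 * pi)%R]) g (circ 0%R r t))%E ->
  (c%:E <= cmean g r)%E.
Proof.
have P2 := pi2_gt0.
move=> h; rewrite /cmean -[c](mulKf (lt0r_neq0 P2)) EFinM.
by apply: lee_wpmul2l => //; rewrite lee_fin invr_ge0 ltW.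
Qed.

(* Upper approximation of an upper semicontinuous function by the sup-convolutions
   [sup_y (max (g y) (-k) - k |x - y|)]. *)
Lemma usc_lip_approx g (r C : RR) : 0 < r -> 0 <= C -> usc_rel (Sc r) g ->
  (forall l, Sc r l -> (g l <= C%:E)%E) ->
  exists c : nat -> CC -> RR,
  [/\ forall k x y, `|c k x - c k y| <= k%:R * cabs (x - y),
      forall k x, Sc r x -> (g x <= (c k x)%:E)%E,
      forall k x, c k x <= C,
      forall k x, c k.+1 x <= c k x &
      forall x b, Sc r x -> (g x < b%:E)%E -> exists k, c k x < b].
Proof.
move=> r0 C0 ug gC.
(* Truncation at [- k] makes the values finite where [g] is [-oo]. The truncation level and the
   Lipschitz constant are tied to the same [k], so the approximations decrease. *)
pose G' (k : nat) y : RR := fine (maxe (g y) (- k%:R)%:E).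
pose A k x := [set G' k y - k%:R * cabs (x - y) | y in Sc r].
pose p0 := circ 0%R r 0; have Sp0 : Sc r p0 by exact: Sc_circ.
have gE k y : Sc r y -> (maxe (g y) (- k%:R)%:E = (G' k y)%:E)%E.
  move=> /gC; rewrite /G'; case: (g y) => [a| |] // _; first by rewrite -EFin_max.
  by rewrite maxNye.
have GC k y : Sc r y -> G' k y <= C.
  move=> Sy; rewrite -lee_fin -gE // ge_max gC //= lee_fin.
  by apply: le_trans C0; rewrite oppr_le0.
have Ag k y : Sc r y -> (g y <= (G' k y)%:E)%E.
  by move=> Sy; rewrite -gE // le_max lexx.
have kpos k z : 0 <= k%:R * cabs z by rewrite mulr_ge0 // cabs_ge0.
have Aub k x : ubound (A k x) C.
  by move=> _ [y Sy <-]; rewrite lerBlDr; apply: le_trans (GC k y Sy) _; rewrite lerDl.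
have A0 k x : A k x !=set0 by exists (G' k p0 - k%:R * cabs (x - p0)), p0.
have Asup k x : has_sup (A k x) by split; [exact: A0|exists C; exact: Aub].
have inA k x y : Sc r y -> G' k y - k%:R * cabs (x - y) <= sup (A k x).
  by move=> Sy; apply: ub_le_sup; [exact: (proj2 (Asup k x))|exists y].
exists (fun k x => sup (A k x)); split.
- have half k x y : sup (A k x) <= sup (A k y) + k%:R * cabs (x - y).
    apply: ge_sup; first exact: A0.
  move=> _ [z Sz <-]; have := inA k y z Sz.
    have : cabs (y - z) <= cabs (x - y) + cabs (x - z).
      by have := cabsD (y - x) (x - z); rewrite subrKA (cabs_sub y x).
    set a := cabs (y - z); set b := cabs (x - y); set c := cabs (x - z) => abc.
    have : k%:R * a <= k%:R * b + k%:R * c by rewrite -mulrDr ler_wpM2l.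
    by move=> ? ?; rlra.
  move=> k x y; rewrite ler_norml; have := half k x y; have := half k y x.
  by rewrite (cabs_sub y x) => ? ?; rsplit.
- move=> k x Sx; apply: le_trans (Ag k x Sx) _; rewrite lee_fin.
  by have := inA k x x Sx; rewrite subrr cabs0 mulr0 subr0.
- by move=> k x; apply: ge_sup; [exact: A0|exact: Aub].
- move=> k x; apply: ge_sup; first exact: A0.
  move=> _ [y Sy <-]; apply: le_trans (inA k x y Sy).
  apply: lerB; last by rewrite ler_wpM2r ?cabs_ge0 // ler_nat.
  rewrite -lee_fin -!gE //; apply: le_max2 => //.
  by rewrite lee_fin lerN2 ler_nat.
move=> x b Sx gb.
have [b' gb' b'b] : exists2 b' : RR, (g x < b'%:E)%E & b' < b.
  case: (g x) gb => [a| |] //; rewrite ?lte_fin => ab.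
    by exists ((a + b) / 2); rewrite ?lte_fin; lra.
  by exists (b - 1); [rewrite ltNyr|lra].
have /nbhsCE [d d0 hd] := ug x Sx _ gb'.
(* Within distance [d] of [x], [g < b'] and [- k <= b']; beyond [d] the penalty [k d] is at least
   [C + |b'|], which brings a value below [C] down to [b']. *)
pose k := (Num.bound (`|b'| + (C + `|b'|) / d)).
have h0 : 0 <= (C + `|b'|) / d by rewrite divr_ge0 ?addr_ge0 // ltW.
have kb : `|b'| + (C + `|b'|) / d < k%:R by apply: archi_boundP; rewrite addr_ge0.
exists k; apply: le_lt_trans b'b; apply: ge_sup; first exact: A0.
  move=> _ [y Sy <-].
have [yx|xy] := ltP (cabs (y - x)) d.
  apply: (@le_trans _ _ (G' k y)); first by rewrite lerBlDr lerDl.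
  rewrite -lee_fin -gE // ge_max (ltW (hd y yx Sy)) lee_fin /=.
  by have := ler_norm (- b'); rewrite normrN; rlra.
have h1 : (C + `|b'|) <= k%:R * cabs (x - y).
  rewrite cabs_sub; apply: le_trans (_ : k%:R * d <= _); last by rewrite ler_wpM2l.
  rewrite -ler_pdivrMr //; apply: le_trans (ltW kb); by rewrite lerDr.
have := GC k y Sy; have := ler_norm (- b'); rewrite normrN; rlra.
Qed.

(* For an upper semicontinuous [g] this says that [c] is at most the mean of [g] on the circle; see
   [ctest_cmean] and [cmean_ctest]. *)
Definition ctest (g : CC -> \bar RR) (r : RR) (c : \bar RR) := forall P : {poly CC},
  (forall l, Sc r l -> (g l < (complex.Re P.[l])%:E)%E) -> (c <= (complex.Re P.[0])%:E)%E.

(** The Fejer approximation raised by [e], which puts it strictly above [c] and turns the bound [C]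
    of Harnack's inequality into [C + e]. *)
Lemma fejer_above c k (r e : RR) : 0 < r -> 0 < e ->
  (forall x y : CC, `|c x - c y| <= k%:R * cabs (x - y)) ->
  exists P : {poly CC}, [/\ forall x, Sc r x -> c x < complex.Re P.[x],
    forall x, Sc r x -> complex.Re P.[x] < c x + 2 * e &
    forall C : RR, (forall x, c x <= C) -> forall z, cabs z <= r / 5 ->
      complex.Re P.[z] - (C + e) <= (complex.Re P.[0] - (C + e)) / 2].
Proof.
move=> r0 e0 lip; have [P [h1 h2]] := fejer_approx r0 (ler0n _ k) e0 (fun x y _ _ => lip x y).
exists (P + e%:C%:P); have E z : complex.Re (P + e%:C%:P).[z] = complex.Re P.[z] + e.
  by rewrite hornerD hornerC cReD.
split.
- by move=> x /h1; rewrite E ltr_norml => /andP[? ?]; rlra.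
- by move=> x /h1; rewrite E ltr_norml => /andP[? ?]; rlra.
- move=> C cC z zr; rewrite !E.
  have := h2 C (fun x _ => cC x) z zr; rlra.
Qed.

Lemma lt_ereal_between (x : \bar RR) (b : RR) : (x < b%:E)%E ->
  exists2 c : RR, (x < c%:E)%E & c < b.
Proof.
case: x => [a| |] //; rewrite ?lte_fin => ab.
  by exists ((a + b) / 2); rewrite ?lte_fin; lra.
by exists (b - 1); [rewrite ltNyr|lra].
Qed.

(** A strict polynomial majorant on the circle whose value at the centre nearly attains the mean.
    The last clause is Harnack's inequality: a very negative mean forces the majorant, hence any
    subharmonic [g], to be very negative on a smaller disc. *)
Lemma cmean_majorant g (r C c : RR) : 0 < r -> 0 <= C -> usc_rel (Sc r) g ->
  (forall l, Sc r l -> (g l <= C%:E)%E) -> (cmean g r < c%:E)%E ->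
  exists P : {poly CC}, [/\ forall l, Sc r l -> (g l < (complex.Re P.[l])%:E)%E,
    complex.Re P.[0] < c &
    forall z, cabs z <= r / 5 -> complex.Re P.[z] <= (complex.Re P.[0] + (C + 1)) / 2].
Proof.
move=> r0 C0 ug gC /lt_ereal_between [c' mc' c'c]; have P2 := pi2_gt0.
have [cs [lip gcs csC dec conv]] := usc_lip_approx r0 C0 ug gC.
have ctk k : ctson 0 (2 * pi) (fun t => cs k (circ 0 r t)).
  move=> t _ e e0; have k1 : 0 < k%:R + 1 :> RR by rewrite ltr_wpDl.
  have [d d0 hd] := circ_cont t r0 (divr_gt0 e0 k1).
  exists d => // t' /hd; rewrite ltr_pdivlMr // mulrC => h.
  apply: le_lt_trans (lip k _ _) _; apply: le_lt_trans h.
  by apply: ler_wpM2r; [exact: cabs_ge0|rewrite lerDl].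
have ik k := ctson_integrable (ctk k).
have fin k : (\int[mu]_(t in `[0%R, (2 * pi)%R]) (cs k (circ 0%R r t))%:E =
   (Iab 0 (2 * pi) (fun t => cs k (circ 0%R r t)))%:E)%E.
  by rewrite /Iab /Rintegral fineK //; apply: integrable_fin_num => //; exact: ik.
have [k hk] : exists k, Iab 0 (2 * pi) (fun t => cs k (circ 0%R r t)) < 2 * pi * c'.
  apply: contrapT => nk; move: mc'; apply/negP; rewrite -leNgt.
  apply: cmean_ge_cst.
  have H := @integral_decreasing_ge _ _ _ mu _ (measurable_itv _) _ mu_period
    (fun k t => (cs k (circ 0%R r t))%:E) (fun t => g (circ 0%R r t)) C (2 * pi * c') C0.
  refine (H _ _ _ _ _ _ _); clear H.
  - by move=> k; exact: (measurable_int mu (ik k)).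
  - by apply: measurable_funTS; exact: usc_rel_circ.
  - by move=> k t _; rewrite lee_fin csC.
  - by move=> k t _; rewrite lee_fin dec.
  - move=> t b _ gb; have [k hk] := conv _ _ (Sc_circ t r0) gb.
    by exists k; rewrite lte_fin.
  - by move=> t _; apply: gC; exact: Sc_circ.
  by move=> k; rewrite fin lee_fin leNgt; apply/negP => hk; apply: nk; exists k.
pose e := Num.min 1 ((c - c') / 4).
have e0 : 0 < e by rewrite lt_min ltr01 divr_gt0 // subr_gt0.
have e1 : e <= 1 by rewrite ge_min lexx.
have ec : e <= (c - c') / 4 by rewrite ge_min lexx orbT.
have [P [h1 h2 h3]] := fejer_above r0 e0 (lip k).
have hP := @hol_poly P 0 r.
have mv := mean_value r0 hP.
have cP' := @hol_disc_ctson (horner P) 0 r 0 (2 * pi) r0 hP.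
have key : Iab 0 (2 * pi) (fun t => complex.Re P.[circ 0%R r t])
    - Iab 0 (2 * pi) (fun t => cs k (circ 0%R r t)) <= 2 * pi * (2 * e).
  rewrite -IabB //.
  have := @le_Iab 0 (2 * pi) _ (fun=> 2 * e) (ctsonB cP' (ctk k)) (@ctson_cst _ _ _).
  rewrite Iab_cst; last exact: ltW.
  rewrite subr0 (mulrC (2 * e)).
  by apply=> t _; have := h2 _ (Sc_circ t r0); rlra.
have P0c : complex.Re P.[0] < c.
  rewrite -(ltr_pM2l P2) -mv.
  have : 2 * pi * (2 * e) <= 2 * pi * ((c - c') / 2) by rewrite ler_pM2l //; rlra.
  have : 2 * pi * (c' + (c - c') / 2) < 2 * pi * c by rewrite ltr_pM2l //; rlra.
  by rewrite mulrDr => ? ?; rlra.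
exists P; split => //.
  by move=> l Sl; apply: le_lt_trans (gcs k l Sl) _; rewrite lte_fin; exact: h1.
move=> z zr; have := h3 C (csC k) z zr; have : C + e <= C + 1 by rewrite lerD2l.
by move=> ? ?; rlra.
Qed.

Lemma ctest_cmean g (r : RR) c : 0 < r -> usc_rel (Sc r) g ->
  (forall l, Sc r l -> (g l < +oo)%E) -> ctest g r c -> (c <= cmean g r)%E.
Proof.
move=> r0 ug gy ct; have [C C0 gC] := usc_circle_bounded r0 ug gy.
rewrite leNgt; apply/negP => mc.
have [c' mc' c'c] : exists2 c' : RR, (cmean g r < c'%:E)%E & (c'%:E <= c)%E.
  move: mc; case: c ct => [c| |] ct mc; [by exists c| |by move: mc; rewrite ltNge leNye].
  exists (Num.max 0 (fine (cmean g r)) + 1); last by rewrite leey.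
  move: mc; case: (cmean g r) => [a| |] // _; last by rewrite ltNyr.
  by rewrite lte_fin /= ltr_pwDr // le_max lexx orbT.
have [P [h1 h2 _]] := cmean_majorant r0 C0 ug gC mc'.
have := le_trans c'c (ct P h1); rewrite lee_fin; rlra.
Qed.

Lemma cmean_ctest g (r : RR) c : 0 < r -> usc_rel (Sc r) g ->
  (c <= cmean g r)%E -> ctest g r c.
Proof.
move=> r0 ug cg P gP; apply: le_trans cg _.
by apply: cmean_le_hol r0 (@hol_poly P 0 r) ug _ => l /gP /ltW.
Qed.

Lemma mule_distr_le (R : realType) (c : R) (a b : \bar R) : 0 < c ->
  (c%:E * a + c%:E * b <= c%:E * (a + b))%E.
Proof.
move=> c0; have c0' : (0 < c%:E :> \bar R)%E by rewrite lte_fin.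
case: a => [a| |]; case: b => [b| |].
  by change ((c * a + c * b)%:E <= (c * (a + b))%:E)%E; rewrite mulrDr.
all: by rewrite /= ?(gt0_muley c0') ?(gt0_muleNy c0') /= ?leey ?leNye.
Qed.

Lemma le_cmeanD g1 g2 (r : RR) : 0 < r -> usc_rel (Sc r) g1 -> usc_rel (Sc r) g2 ->
  (forall l, Sc r l -> (g1 l < +oo)%E) -> (forall l, Sc r l -> (g2 l < +oo)%E) ->
  (cmean g1 r + cmean g2 r <= cmean (fun l => g1 l + g2 l) r)%E.
Proof.
move=> r0 u1 u2 y1 y2; have P2 := pi2_gt0.
have [C1 C10 gC1] := usc_circle_bounded r0 u1 y1.
have [C2 C20 gC2] := usc_circle_bounded r0 u2 y2.
have C0 : 0 <= Num.max C1 C2 by rewrite le_max C10.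
have D1 l : Sc r l -> (g1 l <= (Num.max C1 C2)%:E)%E.
  by move=> /gC1 /le_trans; apply; rewrite lee_fin le_max lexx.
have D2 l : Sc r l -> (g2 l <= (Num.max C1 C2)%:E)%E.
  by move=> /gC2 /le_trans; apply; rewrite lee_fin le_max lexx orbT.
have H := @le_integralD _ _ _ mu _ (measurable_itv _) _ mu_period
  (fun t => g1 (circ 0%R r t)) (fun t => g2 (circ 0%R r t)) _ C0.
have {H} : (\int[mu]_(t in `[0%R, (2 * pi)%R]) g1 (circ 0%R r t) +
   \int[mu]_(t in `[0%R, (2 * pi)%R]) g2 (circ 0%R r t) <=
   \int[mu]_(t in `[0%R, (2 * pi)%R]) (g1 (circ 0%R r t) + g2 (circ 0%R r t)))%E.
  refine (H _ _ _ _); try by apply: measurable_funTS; exact: usc_rel_circ.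
    by move=> t _; apply: D1; exact: Sc_circ.
  by move=> t _; apply: D2; exact: Sc_circ.
have c0 : 0 < (2 * pi)^-1 :> RR by rewrite invr_gt0.
move=> H; rewrite /cmean; apply: le_trans (lee_wpmul2l _ H); last first.
  by rewrite lee_fin ltW.
exact: mule_distr_le.
Qed.

(** * The sub-mean value property in test form *)

Definition smv (g : CC -> \bar RR) :=
  exists2 rho : RR, 0 < rho & forall r, 0 < r -> r < rho -> ctest g r (g 0).

Lemma ctest_cst (c : \bar RR) (r : RR) : 0 < r -> ctest (fun=> c) r c.
Proof.
move=> r0; case: c => [c| |] P h; last by rewrite leNye.
  apply: (@cmean_ctest (fun=> c%:E) r c%:E r0) => //.
    by move=> l _ d hd; apply: filterE => y _.
  apply: cmean_ge_cst.
  rewrite [X in (_ <= X)%E](_ : _ = (2 * pi * c)%:E) //.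
  apply: etrans (integral_cst mu (measurable_itv _) c%:E) _.
  by apply: etrans (congr1 (fun z => c%:E * z)%E mu_period) _; rewrite -EFinM mulrC.
by have := h _ (Sc_circ 0 r0); rewrite ltNge leey.
Qed.

Lemma smv_local g h (d : RR) : 0 < d -> (forall l, cabs l < d -> g l = h l) -> smv g -> smv h.
Proof.
move=> d0 gh [rho rho0 hr]; exists (Num.min rho d); first by rewrite lt_min rho0.
move=> r r0; rewrite lt_min => /andP[r1 r2] P hP; rewrite -gh ?cabs0 //.
apply: (hr r r0 r1 P) => l lr; rewrite gh; first exact: hP.
by rewrite lr.
Qed.

Lemma ctest_max g h r c d : ctest g r c -> ctest h r d ->
  ctest (fun l => maxe (g l) (h l)) r (maxe c d).
Proof.
move=> hg hh P hP; rewrite ge_max; apply/andP; split.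
  by apply: hg => l /hP; rewrite gt_max => /andP[].
by apply: hh => l /hP; rewrite gt_max => /andP[].
Qed.

Lemma smv_max g h : smv g -> smv h -> smv (fun l => maxe (g l) (h l)).
Proof.
move=> [r1 r10 h1] [r2 r20 h2]; exists (Num.min r1 r2); first by rewrite lt_min r10.
move=> r r0; rewrite lt_min => /andP[rr1 rr2].
by apply: ctest_max; [exact: h1|exact: h2].
Qed.

Lemma ctest_ge g h r c : (forall l, Sc r l -> (g l <= h l)%E) -> ctest g r c -> ctest h r c.
Proof. by move=> gh hg P hP; apply: hg => l Sl; apply: le_lt_trans (gh _ Sl) (hP _ Sl). Qed.

Lemma smv_ge g h : (forall l, (g l <= h l)%E) -> g 0 = h 0 -> smv g -> smv h.
Proof.
move=> gh g0 [rho rho0 hr]; exists rho => // r r0 rr; rewrite -g0.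
by apply: ctest_ge (hr r r0 rr).
Qed.

Lemma adde_lt_split (x y : \bar RR) (c : RR) : (x < +oo)%E -> (y < +oo)%E ->
  (x + y < c%:E)%E -> exists a b : RR, [/\ (x < a%:E)%E, (y < b%:E)%E & a + b < c].
Proof.
case: x => [x| |] // _; case: y => [y| |] // _.
- rewrite -EFinD lte_fin => h; exists (x + (c - x - y) / 3), (y + (c - x - y) / 3).
  by rewrite !lte_fin; split; lra.
- move=> _; exists (x + 1), (c - x - 2); rewrite ltNyr !lte_fin; split => //; lra.
- move=> _; exists (c - y - 2), (y + 1); rewrite ltNyr !lte_fin; split => //; lra.
- move=> _; exists (c - 1), 0; rewrite !ltNyr; split => //; lra.
Qed.

Lemma lte_sumE (x y : \bar RR) (a b c : RR) : (x < a%:E)%E -> (y < b%:E)%E -> a + b < c ->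
  (x + y < c%:E)%E.
Proof.
case: x => [x| |] //; case: y => [y| |] // xa yb abc; rewrite ?addNye ?addeNy ?ltNyr //.
rewrite -EFinD !lte_fin in xa yb *; lra.
Qed.

Lemma usc_relD {T : topologicalType} (K : set T) u v :
  (forall z, K z -> (u z < +oo)%E) -> (forall z, K z -> (v z < +oo)%E) ->
  usc_rel K u -> usc_rel K v -> usc_rel K (fun z => u z + v z)%E.
Proof.
move=> u1 v1 hu hv z Kz c /(adde_lt_split (u1 z Kz) (v1 z Kz)) [a [b [ua vb abc]]].
have hU := hu z Kz _ ua; have hV := hv z Kz _ vb.
apply: filterS2 hU hV => y h1 h2 Ky; exact: lte_sumE (h1 Ky) (h2 Ky) abc.
Qed.

Lemma usc_on_of_rel {T : topologicalType} (U : set T) u : open U -> usc_rel U u -> usc_on U u.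
Proof.
move=> oU h z Uz c uc; have := h z Uz c uc.
by apply: filterS2 (open_nbhs_nbhs (conj oU Uz)) => y Uy; apply.
Qed.

(** A polynomial above [g + h] does not split into one above [g] and one above [h], so additivity
    goes through the integral means. *)
Lemma smvD g h (d : RR) : 0 < d ->
  usc_rel [set l | cabs l < d] g -> usc_rel [set l | cabs l < d] h ->
  (forall l, cabs l < d -> (g l < +oo)%E) -> (forall l, cabs l < d -> (h l < +oo)%E) ->
  smv g -> smv h -> smv (fun l => g l + h l)%E.
Proof.
move=> d0 ug uh gy hy [r1 r10 h1] [r2 r20 h2].
exists (Num.min d (Num.min r1 r2)); first by rewrite !lt_min d0 r10.
move=> r r0; rewrite !lt_min => /andP[rd /andP[rr1 rr2]].
have sub l : Sc r l -> cabs l < d by move=> ->.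
have usub u : usc_rel [set l | cabs l < d] u -> usc_rel (Sc r) u.
  by move=> hu z Sz c /(hu z (sub z Sz)); apply: filterS => y hy' /sub /hy'.
have gy' l : Sc r l -> (g l < +oo)%E by move=> /sub; exact: gy.
have hy' l : Sc r l -> (h l < +oo)%E by move=> /sub; exact: hy.
apply: cmean_ctest => //; first by apply: usc_relD => //; exact: usub.
apply: le_trans (le_cmeanD r0 (usub _ ug) (usub _ uh) gy' hy').
apply: leeD; apply: ctest_cmean => //; try exact: usub; [exact: h1|exact: h2].
Qed.

Lemma ctest_pos_scale g (r c : RR) (x : \bar RR) : 0 < c -> ctest g r x ->
  ctest (fun l => c%:E * g l)%E r (c%:E * x)%E.
Proof.
move=> c0 hr P hP.
have E z : complex.Re (c^-1%:C%:P * P).[z] = c^-1 * complex.Re P.[z].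
  by rewrite hornerM hornerC cReM /= mul0r subr0.
have := hr (c^-1%:C%:P * P); rewrite E => H.
have {}H : (x <= (c^-1 * complex.Re P.[0%R])%:E)%E.
  apply: H => l Sl; rewrite E EFinM lte_pdivlMl //; exact: hP.
by rewrite -lee_pdivlMl // -EFinM.
Qed.

Lemma smv_scale g (c : RR) : 0 < c -> smv g -> smv (fun l => c%:E * g l)%E.
Proof.
by move=> c0 [rho rho0 hr]; exists rho => // r r0 rr; apply: ctest_pos_scale => //; exact: hr.
Qed.

Lemma ctest_scale g (r : RR) (b : CC) c : b != 0 ->
  ctest g (r * cabs b) c -> ctest (fun l => g (l * b)) r c.
Proof.
move=> b0 hg P hP; have := hg (P \Po (b^-1 *: 'X)).
rewrite horner_comp hornerZ hornerX mulr0; apply => l Sl.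
have := hP (l / b); rewrite divfK // horner_comp hornerZ hornerX mulrC; apply.
have bn : cabs b != 0 by rewrite cabs_eq0.
by rewrite /Sc /=; apply: (mulIf bn); rewrite -cabsM mulrC mulVKf.
Qed.

Lemma smv_linear g (b : CC) : smv g -> smv (fun l => g (l * b)).
Proof.
move=> [rho rho0 hr].
have [->|b0] := eqVneq b 0.
  exists 1 => // r r0 _; rewrite mulr0.
  have -> : (fun l => g (l * 0)) = fun=> g 0 by apply/funext => l; rewrite mulr0.
  exact: ctest_cst.
have b1 : 0 < cabs b by rewrite cabs_gt0.
exists (rho / cabs b); first by rewrite divr_gt0.
move=> r r0; rewrite ltr_pdivlMr // => rr; rewrite mul0r.
by apply: ctest_scale => //; apply: hr => //; rewrite mulr_gt0.
Qed.

(** The linear term is the real part of a polynomial in [h], and [cabs h ^ 2] is constant on circles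
    about [0]: a quadratic perturbation thus exceeds a test polynomial by a constant there. *)
Lemma cabsD_expand (z h : CC) :
  cabs (z + h) ^+ 2 = cabs z ^+ 2 + complex.Re (2 * (z^* * h)) + cabs h ^+ 2.
Proof. by rewrite cabsD_sqr cRe2 !cReM; case: z h => [a b] [c d] /=; ring. Qed.

Definition ccont (q : CC -> RR) (z : CC) := forall e : RR, 0 < e ->
  exists2 d : RR, 0 < d & forall y, cabs (y - z) < d -> `|q y - q z| < e.

Lemma ccont_cst c z : ccont (fun=> c) z.
Proof. by move=> e e0; exists 1 => // y _; rewrite subrr normr0. Qed.

Lemma ccontD p q z : ccont p z -> ccont q z -> ccont (fun y => p y + q y) z.
Proof.
move=> hp hq e e0; have e2 : 0 < e / 2 by lra.
have [d1 d10 h1] := hp _ e2; have [d2 d20 h2] := hq _ e2.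
exists (Num.min d1 d2); first by rewrite lt_min d10.
move=> y; rewrite lt_min => /andP[/h1 y1 /h2 y2].
rewrite (_ : _ - _ = (p y - p z) + (q y - q z)); last ring.
by apply: le_lt_trans (ler_normD _ _) _; lra.
Qed.

Lemma ccontM p q z : ccont p z -> ccont q z -> ccont (fun y => p y * q y) z.
Proof.
move=> hp hq e e0.
pose A := `|p z| + `|q z| + 1; have A0 : 0 < A by rewrite ltr_wpDl // addr_ge0.
pose t := Num.min 1 (e / (3 * A)).
have t0 : 0 < t by rewrite lt_min ltr01 divr_gt0 // mulr_gt0.
have [d1 d10 h1] := hp _ t0; have [d2 d20 h2] := hq _ t0.
exists (Num.min d1 d2); first by rewrite lt_min d10.
move=> y; rewrite lt_min => /andP[/h1 y1 /h2 y2].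
rewrite (_ : _ - _ = (p y - p z) * (q y - q z) + p z * (q y - q z) + (p y - p z) * q z); last ring.
have t1 : t <= 1 by rewrite ge_min lexx.
have tA : t * A <= e / 3.
  rewrite -ler_pdivlMr // ge_min; apply/orP; right.
  by rewrite (_ : e / (3 * A) = e / 3 / A) //; field; rewrite gt_eqF.
apply: le_lt_trans (ler_normD _ _) _.
have := ler_normD ((p y - p z) * (q y - q z)) (p z * (q y - q z)); rewrite !normrM.
rewrite /A in tA; move: y1 y2 tA; set a := `|p y - p z|; set b := `|q y - q z|.
have a0 : 0 <= a := normr_ge0 _; have b0 : 0 <= b := normr_ge0 _.
have p0 := normr_ge0 (p z); have q0 := normr_ge0 (q z).
set c := `|p z| in p0 *; set f := `|q z| in q0 *; set X := `|_ + _|.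
move=> y1 y2 tA X1.
have h3 : a * b <= t by apply: le_trans (ler_pM a0 b0 (ltW y1) (le_trans (ltW y2) t1)) _; rewrite mulr1.
have h4 : c * b <= c * t by rewrite ler_wpM2l // ltW.
have h5 : a * f <= t * f by rewrite ler_wpM2r // ltW.
by clear -h3 h4 h5 tA X1 e0; lra.
Qed.

Lemma ccontN q z : ccont q z -> ccont (fun y => - q y) z.
Proof.
by move=> h e /h [d d0 hd]; exists d => // y /hd; rewrite -opprD normrN.
Qed.

Lemma ccont_cabs z : ccont cabs z.
Proof. by move=> e e0; exists e => // y; apply: le_lt_trans (cabs_dist _ _). Qed.

Lemma ccont_Re F z l : cdiff F z l -> ccont (fun y => complex.Re (F y)) z.
Proof.
move=> hF e e0; have [d d0 hd] := cdiff_cont hF e0; exists d => // y /hd.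
by apply: le_lt_trans; rewrite -cReN -cReD Re_le_cabs.
Qed.

Lemma ccont_poly (P : {poly CC}) z : ccont (fun y => complex.Re P.[y]) z.
Proof. by have [l hl] := cdiff_poly P z; exact: ccont_Re hl. Qed.

Lemma ccont_usc K q : (forall z, K z -> ccont q z) -> usc_rel K (fun z => (q z)%:E).
Proof.
move=> h z Kz c; rewrite lte_fin => hc.
have e0 : 0 < c - q z by rewrite subr_gt0.
have [d d0 hd] := h z Kz _ e0; apply/nbhsCE; exists d => // y /hd + _.
by rewrite ltr_norml lte_fin => /andP[_ ?]; lra.
Qed.

(** If [g] exceeded [Re P] by [s > 0] somewhere, then [g - Re P + d |l| ^ 2], with [d r ^ 2 < s],
    would attain its maximum at an interior point [m], where the quadratic term makes the sub-mean
    value inequality fail. *)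
Lemma max_principle g (r : RR) : 0 < r -> (forall l, cabs l <= r -> (g l < +oo)%E) ->
  usc_rel [set l | cabs l <= r] g -> (forall l, cabs l < r -> smv (fun h => g (l + h))) ->
  forall P : {poly CC}, (forall l, Sc r l -> (g l < (complex.Re P.[l])%:E)%E) ->
  forall l, cabs l <= r -> (g l <= (complex.Re P.[l])%:E)%E.
Proof.
move=> r0 gy ug sg P gP l0 hl0; rewrite leNgt; apply/negP => hneg.
pose q l : RR := complex.Re P.[l].
have [s s0 sE] : exists2 s : RR, 0 < s & (g l0 = (q l0 + s)%:E)%E.
  move: hneg (gy l0 hl0); case: (g l0) => [a| |] //.
  by rewrite lte_fin => h _; exists (a - q l0); [rewrite subr_gt0|rewrite addrC subrK].
have [d d0 dr] : exists2 d : RR, 0 < d & d * r ^+ 2 < s.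
  exists (s / (2 * r ^+ 2)); first by rewrite divr_gt0 // mulr_gt0 // exprn_gt0.
  by rewrite (_ : _ * _ = s / 2); [rlra|field; rewrite gt_eqF].
pose b l : RR := d * cabs l ^+ 2 - q l.
have bu : usc_rel [set l | cabs l <= r] (fun l => (b l)%:E).
  apply: ccont_usc => l _; apply: ccontD; last exact/ccontN/ccont_poly.
  apply: ccontM; first exact: ccont_cst.
  by rewrite /ccont; apply: ccontM; exact: ccont_cabs.
have bgy l : cabs l <= r -> (g l + (b l)%:E < +oo)%E.
  by move=> h; apply: lte_add_pinfty; [exact: gy|exact: ltry].
have fu : usc_rel [set l | cabs l <= r] (fun l => g l + (b l)%:E)%E.
  by apply: usc_relD => // l _; rewrite ltry.
have ne : [set l | cabs l <= r] !=set0 by exists l0.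
have cD : compact [set l | cabs l <= r].
  by have := @compact_disc 0 r; congr compact; apply/funext => z /=; rewrite subr0.
have [m mr hm] := usc_rel_max cD ne fu.
have m_low : ((s + d * cabs l0 ^+ 2)%:E <= g m + (b m)%:E)%E.
  apply: le_trans (hm l0 hl0); rewrite sE -EFinD lee_fin /b; lra.
have m_lt : cabs m < r.
  rewrite lt_neqAle mr andbT; apply/negP => /eqP mS.
  have := gP m mS; move: m_low (gy m mr); case: (g m) => [a| |] //.
  rewrite -EFinD lee_fin lte_fin /b mS -/(q m) => h1 _ h2.
  have : 0 <= d * cabs l0 ^+ 2 by rewrite mulr_ge0 ?exprn_ge0 ?cabs_ge0 // ltW.
  by rewrite /= in h1; rlra.
have [a aE] : exists a : RR, g m = a%:E.
  by move: m_low (gy m mr); case: (g m) => [a| |] //; exists a.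
have [rho rho0 hrho] := sg m m_lt.
pose t := Num.min (rho / 2) ((r - cabs m) / 2).
have rm0 : 0 < r - cabs m by rewrite subr_gt0.
have t0 : 0 < t by rewrite lt_min !divr_gt0.
have t1 : t < rho by rewrite gt_min; apply/orP; left; rlra.
have t2 : t < r - cabs m by rewrite gt_min; apply/orP; right; rlra.
(* Maximality of [m] gives [g (m + l) <= Re Q l - d t ^ 2 / 2] for [|l| = t], whereas
   [Re Q 0 = g m - d t ^ 2 / 2]. *)
pose Q : {poly CC} := P \Po (m%:P + 'X) - (d%:C * 2 * m^* )%:P * 'X
   + ((a + b m - d * cabs m ^+ 2 - d * t ^+ 2 / 2)%:C)%:P.
have QE l : complex.Re Q.[l] = q (m + l) - d * complex.Re (2 * (m^* * l))
   + (a + b m - d * cabs m ^+ 2 - d * t ^+ 2 / 2).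
  rewrite /Q hornerD hornerD hornerN hornerM hornerX !hornerC horner_comp hornerD.
  rewrite hornerX hornerC !cReD cReN /q -!mulrA cRe_scale; reflexivity.
have := hrho t t0 t1 Q; rewrite addr0 QE mulr0 addr0 aE => H.
have : (a%:E <= (q m - d * complex.Re (0 : CC) + (a + b m - d * cabs m ^+ 2 - d * t ^+ 2 / 2))%:E)%E.
  move: H; rewrite mulr0; apply => l Sl; rewrite QE.
  have ml : cabs (m + l) <= r by apply: le_trans (cabsD _ _) _; rewrite Sl; rlra.
  have := hm (m + l) ml; rewrite aE; move: (gy _ ml); case: (g (m + l)) => [c| |] //.
    rewrite -!EFinD lee_fin lte_fin /b cabsD_expand Sl => _ h.
    have : 0 < d * t ^+ 2 by rewrite mulr_gt0 // exprn_gt0.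
    by rlra.
  by rewrite ltNyr.
rewrite lee_fin /= /b => h.
have : 0 < d * t ^+ 2 by rewrite mulr_gt0 // exprn_gt0.
by rlra.
Qed.

(** * Subharmonic and plurisubharmonic functions *)

Section GeneralizedPsh.
Context {T : topologicalType} (lines : (CC -> T) -> Prop).
Hypothesis lines_cont : forall L, lines L -> continuous L.
Hypothesis lines_aff : forall L a b, lines L -> lines (fun l => L (a + l * b)).

(* Subharmonic functions for [lines := line1], plurisubharmonic ones for [lines := line2]; see
   [subharmonicP] and [pshP]. *)
Definition gpsh (W : set T) (u : T -> \bar RR) :=
  [/\ open W, (forall p, W p -> (u p < +oo)%E), usc_on W u &
      forall L, lines L -> W (L 0) -> smv (u \o L)].

Lemma line_near L (W : set T) : lines L -> open W -> W (L 0) ->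
  exists2 d : RR, 0 < d & forall l, cabs l < d -> W (L l).
Proof.
move=> /lines_cont /(_ 0) cL oW WL.
have /nbhsCE [d d0 hd] := cL _ (open_nbhs_nbhs (conj oW WL)).
by exists d => // l ld; apply: hd; rewrite subr0.
Qed.

Lemma usc_line W u L (d : RR) : lines L -> usc_on W u -> (forall l, cabs l < d -> W (L l)) ->
  usc_rel [set l | cabs l < d] (u \o L).
Proof.
move=> hL hu hW l ld c uc; have h := hu _ (hW l ld) c uc.
have h2 : \forall y \near l, (u (L y) < c%:E)%E := @lines_cont L hL l _ h.
by apply: filterS h2 => y hy _.
Qed.

Lemma gpsh_local W u : (forall p, W p -> exists B v,
    [/\ B p, B `<=` W, gpsh B v & forall q, B q -> u q = v q]) -> gpsh W u.
Proof.
move=> h.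
have oW : open W.
  rewrite openE => p /h [B [v [Bp BW [oB _ _ _] _]]].
  by apply: (filterS BW); apply: open_nbhs_nbhs.
split => //.
- by move=> p /h [B [v [Bp BW [oB vy _ _] uv]]]; rewrite uv //; exact: vy.
- move=> p /h [B [v [Bp BW [oB vy vu _] uv]]] c; rewrite uv // => vc.
  by apply: filterS2 (open_nbhs_nbhs (conj oB Bp)) (vu _ Bp _ vc) => y By; rewrite uv.
- move=> L hL /h [B [v [Bp BW [oB vy vu vs] uv]]].
  have [d d0 hd] := line_near hL oB Bp.
  by apply: smv_local d0 _ (vs L hL Bp) => l /hd Bl /=; rewrite uv.
Qed.

Lemma gpsh_sub W V u : open V -> V `<=` W -> gpsh W u -> gpsh V u.
Proof.
move=> oV VW [oW uy uu us]; split => //.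
- by move=> p /VW; exact: uy.
- by move=> p /VW; exact: uu.
- by move=> L hL /VW; exact: us.
Qed.

Lemma gpsh_cst W (c : RR) : open W -> gpsh W (fun=> c%:E).
Proof.
move=> oW; split => //; first by move=> p _; rewrite ltry.
- by move=> p _ d hd; apply: filterE => y.
- by move=> L _ _; exists 1 => // r r0 _; exact: ctest_cst.
Qed.

Lemma gpshD W u v : gpsh W u -> gpsh W v -> gpsh W (fun p => u p + v p)%E.
Proof.
move=> [oW uy uu us] [_ vy vu vs]; split => //.
- by move=> p Wp; apply: lte_add_pinfty; [exact: uy|exact: vy].
- apply: usc_on_of_rel => //; apply: usc_relD => //; exact: (usc_on_rel (@subset_refl _ W)).
move=> L hL WL; have [d d0 hd] := line_near hL oW WL.
apply: (smvD d0); [exact: usc_line hL uu hd|exact: usc_line hL vu hd| | |exact: us|exact: vs].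
- by move=> l /hd; exact: uy.
- by move=> l /hd; exact: vy.
Qed.

Lemma gpsh_max W u v : gpsh W u -> gpsh W v -> gpsh W (fun p => maxe (u p) (v p)).
Proof.
move=> [oW uy uu us] [_ vy vu vs]; split => //.
- by move=> p Wp; rewrite gt_max uy ?vy.
- move=> p Wp c; rewrite gt_max => /andP[uc vc].
  by apply: filterS2 (uu p Wp c uc) (vu p Wp c vc) => y h1 h2; rewrite gt_max h1.
- by move=> L hL WL; apply: smv_max; [exact: us|exact: vs].
Qed.

Lemma gpsh_scale W u (c : RR) : 0 < c -> gpsh W u -> gpsh W (fun p => c%:E * u p)%E.
Proof.
move=> c0 [oW uy uu us]; split => //.
- move=> p Wp; have := uy p Wp; case: (u p) => [a| |] // _.
    by rewrite -EFinM ltry.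
  by rewrite gt0_muleNy ?lte_fin // ltNyr.
- move=> p Wp d hd; have h : (u p < (c^-1 * d)%:E)%E by rewrite EFinM lte_pdivlMl.
  by apply: filterS (uu p Wp _ h) => y; rewrite EFinM lte_pdivlMl.
- by move=> L hL WL; apply: smv_scale => //; exact: us.
Qed.

(** [smv] concerns small circles only; the maximum principle along the line extends the test to
    every circle whose closed disc is mapped into [W]. *)
Lemma line_ctest W u L (r : RR) : gpsh W u -> lines L -> 0 < r ->
  (forall l, cabs l <= r -> W (L l)) -> ctest (u \o L) r (u (L 0)).
Proof.
move=> [oW uy uu us] hL r0 hW P hP.
apply: (max_principle r0 _ _ _ hP); rewrite ?cabs0; last exact: ltW.
- by move=> l /hW; exact: uy.
- move=> l lr c uc; have h := uu _ (hW l lr) c uc.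
  have h2 : \forall y \near l, (u (L y) < c%:E)%E := @lines_cont L hL l _ h.
  by apply: filterS h2 => y hy _.
- move=> l lr; have := us _ (lines_aff l 1 hL); rewrite mul0r addr0.
  move=> /(_ (hW l (ltW lr))); apply: (smv_local ltr01) => h _ /=.
  by rewrite mulr1.
Qed.

Lemma ctest_near_circle (r : RR) (P : {poly CC}) (x : CC) (c : RR) :
  c < complex.Re P.[x] -> \forall y \near x, c < complex.Re P.[y].
Proof.
move=> h; have e0 : 0 < complex.Re P.[x] - c by rewrite subr_gt0.
have [d d0 hd] := @ccont_poly P x _ e0; apply/nbhsCE; exists d => // y /hd.
by rewrite ltr_norml => /andP[? _]; rlra.
Qed.

Lemma compact_Sc (r : RR) : compact (Sc r).
Proof. by have := @compact_circle 0 r; congr compact; apply/funext => z /=; rewrite subr0. Qed.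

(** Dini's argument: if [v < Re P] on a circle, compactness and monotonicity give one [u N < Re P]
    on the whole circle, and [u N] passes the test. *)
Lemma gpsh_decr W (u : nat -> T -> \bar RR) v : open W -> (forall n, gpsh W (u n)) ->
  (forall n p, W p -> (u n.+1 p <= u n p)%E) -> (forall n p, W p -> (v p <= u n p)%E) ->
  (forall p (c : RR), W p -> (v p < c%:E)%E -> exists n, (u n p < c%:E)%E) -> gpsh W v.
Proof.
move=> oW hu dec vu uv; split => //.
- by move=> p Wp; have [_ uy _ _] := hu 0%N; apply: le_lt_trans (vu 0%N p Wp) (uy p Wp).
- move=> p Wp c /(uv _ _ Wp) [n unc]; have [_ _ un _] := hu n.
  apply: filterS2 (open_nbhs_nbhs (conj oW Wp)) (un p Wp c unc) => y Wy.
  exact: le_lt_trans (vu n y Wy).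
move=> L hL WL; have [d d0 hd] := line_near hL oW WL.
exists d => // r r0 rd P hP.
have decn m n p : W p -> (m <= n)%N -> (u n p <= u m p)%E.
  move=> Wp /subnK <-; elim: (n - m)%N => // i IH; rewrite addSn; exact: le_trans (dec _ _ Wp) IH.
have WS l : cabs l <= r -> W (L l) by move=> lr; apply: hd; exact: le_lt_trans rd.
have cov : \forall n \near \oo, Sc r `<=` [set l | (u n (L l) < (complex.Re P.[l])%:E)%E].
  have /compact_near_coveringP := @compact_Sc r; apply => // x Sx.
  have [c vc cP] := lt_ereal_between (hP x Sx).
  have Wx : W (L x) by apply: WS; rewrite (Sx : cabs x = r).
  have [n unc] := uv _ _ Wx vc; have [_ _ un _] := hu n.
  have h2 : \forall y \near x, (u n (L y) < c%:E)%E := @lines_cont L hL x _ (un _ Wx _ unc).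
  have h3 : \forall y \near x, W (L y).
    by apply: (@lines_cont L hL x); exact: open_nbhs_nbhs.
  have h4 := ctest_near_circle r cP.
  exists ([set y | [/\ (u n (L y) < c%:E)%E, W (L y) & c < complex.Re P.[y]]], [set k | (n <= k)%N]).
    split; last by exists n.
    by apply: filterS3 h2 h3 h4.
  move=> [y k] /= [[uy Wy cy] nk]; apply: le_lt_trans (decn _ _ _ Wy nk) _.
  by apply: lt_trans uy _; rewrite lte_fin.
have [N _ /(_ N (leqnn N)) hN] := cov.
apply: le_trans (vu N _ WL) _.
exact: (line_ctest (hu N) hL r0 WS hN).
Qed.

(** Outside [O] the glued function equals [v] at the point and is at least [v] nearby, so the
    sub-mean value property is that of [v]. The last hypothesis is the limsup condition that keeps
    semicontinuity across the boundary of [O]. *)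
Lemma gpsh_glue W O v t : open O -> gpsh W v -> gpsh (W `&` O) t ->
  (forall p, W p -> ~ O p -> forall c : RR, (v p < c%:E)%E ->
     \forall y \near p, O y -> (t y < c%:E)%E) ->
  gpsh W (fun p => if pselect (O p) then maxe (v p) (t p) else v p).
Proof.
move=> oO hv ht lim; have [oW vy vu vs] := hv; have [_ ty tu ts] := ht.
set w := fun p => _; split => //.
- move=> p Wp; rewrite /w; case: pselect => [Op|nO]; last exact: vy.
  by rewrite gt_max vy //= ty.
- move=> p Wp c; rewrite {1}/w; case: pselect => [Op|nO].
    rewrite gt_max => /andP[vc tc].
    apply: filterS2 (vu p Wp c vc) (tu p (conj Wp Op) c tc) => y h1 h2.
    by rewrite /w; case: pselect => [Oy|nOy] //; rewrite gt_max h1.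
  move=> vc; apply: filterS2 (vu p Wp c vc) (lim p Wp nO c vc) => y h1 h2.
  by rewrite /w; case: pselect => [Oy|nOy] //; rewrite gt_max h1 h2.
move=> L hL WL; case: (pselect (O (L 0))) => [OL|nO].
  have [d d0 hd] := line_near hL oO OL.
  apply: (smv_local d0 _ (smv_max (vs L hL WL) (ts L hL (conj WL OL)))) => l /hd Ol /=.
  by rewrite /w; case: pselect.
apply: smv_ge (vs L hL WL) => [l|] /=; rewrite /w; case: pselect => //= _.
by rewrite le_max lexx.
Qed.

End GeneralizedPsh.

(** * Complex lines, and agreement with the integral definitions *)

Definition line1 (L : CC -> CC) := exists a b, L = fun l => a + l * b.

Definition line2 (L : CC -> CC * CC) := exists a b : CC * CC,
  L = fun l => (a.1 + l * b.1, a.2 + l * b.2).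

Lemma affine_cont (a b : CC) : forall x e, 0 < e -> exists2 d : RR, 0 < d &
  forall y, cabs (y - x) < d -> cabs (a + y * b - (a + x * b)) < e.
Proof.
move=> x e e0; have b1 : 0 < cabs b + 1 by rewrite ltr_wpDl // cabs_ge0.
exists (e / (cabs b + 1)); first by rewrite divr_gt0.
move=> y; rewrite ltr_pdivlMr // => h.
rewrite (_ : _ - _ = (y - x) * b); last ring.
rewrite cabsM; apply: le_lt_trans h; apply: ler_wpM2l; first exact: cabs_ge0.
by rewrite lerDl.
Qed.

Lemma line1_cont L : line1 L -> continuous L.
Proof.
move=> [a [b ->]] x V /nbhsCE [e e0 he]; have [d d0 hd] := affine_cont a b x e0.
by apply/nbhsCE; exists d => // y /hd; exact: he.
Qed.

Lemma line2_cont L : line2 L -> continuous L.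
Proof.
move=> [a [b ->]] x V /nbhsC2E [e e0 he]; have [d d0 hd] := affine_cont a.1 b.1 x e0.
have [d' d0' hd'] := affine_cont a.2 b.2 x e0.
apply/nbhsCE; exists (Num.min d d'); first by rewrite lt_min d0.
by move=> y; rewrite lt_min => /andP[/hd h1 /hd' h2]; exact: he.
Qed.

Lemma line1_aff L a b : line1 L -> line1 (fun l => L (a + l * b)).
Proof.
by move=> [c [e ->]]; exists (c + a * e), (b * e); apply/funext => l; ring.
Qed.

Lemma line2_aff L a b : line2 L -> line2 (fun l => L (a + l * b)).
Proof.
move=> [c [e ->]]; exists (c.1 + a * e.1, c.2 + a * e.2), (b * e.1, b * e.2).
by apply/funext => l /=; congr pair; ring.
Qed.

Lemma cmean_circ u a (r : RR) : cmean (fun l => u (a + l)) r =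
  (((2 * pi)^-1)%R%:E * \int[lebesgue_measure]_(t in `[0%R, (2 * pi)%R]) u (circ a r t))%E.
Proof.
congr (_ * _)%E; apply: eq_integral => t _; congr u.
by rewrite /circ add0r.
Qed.

Lemma subharmonicP U u : subharmonic_on U u <-> gpsh line1 U u.
Proof.
split=> [[oU uy uu us]|[oU uy uu us]]; split => //.
  move=> L [a [b ->]]; rewrite mul0r addr0 => Ua.
  have [rho [rho0 sub] hr] := us a Ua.
  apply: (@smv_linear (fun l => u (a + l)) b).
  exists rho => // r r0 rr; apply: (cmean_ctest r0).
    move=> l Sl c uc; have Ual : U (a + l).
      by apply: sub; apply/ballCE; rewrite addrC addKr (Sl : cabs l = r).
    have := uu _ Ual c uc => /nbhsCE [d d0 hd]; apply/nbhsCE; exists d => // y yl _.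
    by apply: hd; rewrite (_ : a + y - (a + l) = y - l) //; ring.
  by rewrite addr0 cmean_circ; exact: hr.
move=> a Ua; have [d d0 hd] := (openCE U).1 oU a Ua.
have hl : line1 (fun l => a + l * 1) by exists a, 1.
have [|rho rho0 hr] := us _ hl; first by rewrite mul0r addr0.
exists (Num.min d rho).
  split; first by rewrite lt_min d0.
  by move=> y /ballCE; rewrite lt_min => /andP[/hd].
move=> r r0; rewrite lt_min => /andP[rd rrho]; rewrite -cmean_circ.
have US l : Sc r l -> U (a + l).
  by move=> Sl; apply: hd; rewrite addrC addKr (Sl : cabs l = r).
apply: ctest_cmean => //.
- move=> l Sl c uc; have := uu _ (US l Sl) c uc => /nbhsCE [e e0 he].
  apply/nbhsCE; exists e => // y yl _.
  by apply: he; rewrite (_ : a + y - (a + l) = y - l) //; ring.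
- by move=> l /US; exact: uy.
- have := hr r r0 rrho; rewrite /= mul0r addr0 => h P hP; apply: h => l Sl /=.
  by rewrite mulr1; exact: hP.
Qed.

Lemma pshP W u : psh_on W u <-> gpsh line2 W u.
Proof.
split=> [[oW uy uu us]|hu]; last have [oW uy uu us] := hu; split => //.
  move=> L [a [b ->]] Wa; have /subharmonicP [_ _ _ h] := us a b.
  have hl : line1 (fun l => 0 + l * 1) by exists 0, 1.
  have := h _ hl; rewrite mul0r addr0 => /(_ Wa).
  by apply: (smv_local ltr01) => l _ /=; rewrite add0r mulr1.
move=> a b; set L := fun l : CC => (a.1 + l * b.1, a.2 + l * b.2).
have hL : line2 L by exists a, b.
apply/subharmonicP; split.
- by rewrite (_ : [set l | _] = L @^-1` W) //; apply: open_comp => // x _; exact: line2_cont.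
- by move=> l; exact: uy.
- move=> l Wl c uc; exact: (line2_cont hL (uu _ Wl c uc)).
- move=> K [c [e KE]] WK; apply: (us (L \o K)) => //.
  by rewrite KE; exact: line2_aff.
Qed.

Notation sbh := (gpsh line1).

Lemma hol_max F (r C : RR) : 0 < r -> hol_disc F 0 r ->
  (forall l, Sc r l -> complex.Re (F l) <= C) -> complex.Re (F 0) <= C.
Proof.
move=> r0 hF FC; have P2 := pi2_gt0.
have cF := @hol_disc_ctson F 0 r 0 (2 * pi) r0 hF.
have := le_Iab cF (@ctson_cst 0 (2 * pi) C); rewrite mean_value // Iab_cst; last exact: ltW.
rewrite subr0 (mulrC C) ler_pM2l //; apply => t _; apply: FC; exact: Sc_circ.
Qed.

(** Holomorphic functions are as good as polynomials for testing, by a detour through the mean. The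
    doubling argument tests with an expression that contains [f]. *)
Lemma ctest_hol g F (r : RR) c : 0 < r -> hol_disc F 0 r -> usc_rel (Sc r) g ->
  (forall l, Sc r l -> (g l < +oo)%E) -> ctest g r c ->
  (forall l, Sc r l -> (g l <= (complex.Re (F l))%:E)%E) -> (c <= (complex.Re (F 0))%:E)%E.
Proof.
move=> r0 hF ug gy ct gF; apply: le_trans (ctest_cmean r0 ug gy ct) _.
exact: cmean_le_hol.
Qed.

Definition lnabs (z : CC) : \bar RR := if z == 0 then -oo%E else (ln (cabs z))%:E.

Lemma lnabs_ltE (z : CC) (x : RR) : (lnabs z < x%:E)%E = (cabs z < expR x).
Proof.
rewrite /lnabs; case: eqVneq => [->|z0]; first by rewrite cabs0 expR_gt0 ltNyr.
by rewrite lte_fin -[in RHS](@lnK RR (cabs z)) ?ltr_expR // posrE cabs_gt0.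
Qed.

Lemma lnabs_leE (z : CC) (x : RR) : (lnabs z <= x%:E)%E = (cabs z <= expR x).
Proof.
rewrite /lnabs; case: eqVneq => [->|z0]; first by rewrite cabs0 expR_ge0 leNye.
by rewrite lee_fin -[in RHS](@lnK RR (cabs z)) ?ler_expR // posrE cabs_gt0.
Qed.

Lemma lnabs_geE (z : CC) (x : RR) : (x%:E <= lnabs z)%E = (expR x <= cabs z).
Proof. by rewrite leNgt lnabs_ltE -leNgt. Qed.

Lemma cdiff_cexp_comp F z l : cdiff F z l -> exists m, cdiff (fun y => cexp (F y)) z m.
Proof. by move=> h; eexists; apply: cdiff_comp h (cdiff_cexp _). Qed.

(* If [log |F| < Re P] on the circle, then [F exp (- P)] has modulus at most 1 there. *)
Lemma ctest_lnabs F (r : RR) : 0 < r -> hol_disc F 0 r ->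
  ctest (fun l => lnabs (F l)) r (lnabs (F 0)).
Proof.
move=> r0 hF P hP; rewrite lnabs_leE.
pose G l := F l * cexp (- P.[l]).
have hG : hol_disc G 0 r.
  move=> z zr; have [l hl] := hF z zr; have [m hm] := cdiff_poly P z.
  have [n hn] := cdiff_cexp_comp (cdiffN hm).
  by eexists; exact: cdiffM hl hn.
have G1 l : Sc r l -> cabs (G l) <= 1.
  move=> /hP; rewrite lnabs_ltE => /ltW h; rewrite cabsM cabs_cexp cReN expRN.
  by rewrite ler_pdivrMr ?expR_gt0 // mul1r.
(* The factor conjugate to [G 0] makes the real part at [0] equal to [|G 0| ^ 2], so that a bound on
   real parts bounds the modulus of [G 0]. *)
have hGc : hol_disc (fun l => G l * (G 0)^* ) 0 r.
  move=> z zr; have [l hl] := hG z zr; eexists.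
  by apply: cdiffM hl _; exact: cdiff_cst.
have cJ (z : CC) : cabs z^* = cabs z.
  by apply/eqP; rewrite -(@eqrXn2 _ 2) ?cabs_ge0 // !cabs_sqr; case: z => a b /=; rewrite sqrrN.
have := hol_max r0 hGc => /(_ (cabs (G 0))).
rewrite mulc_conj /= expr2 => H.
have {}H : cabs (G 0) * cabs (G 0) <= cabs (G 0).
  apply: H => l Sl; apply: le_trans (ler_norm _) _; apply: le_trans (Re_le_cabs _) _.
  by rewrite cabsM cJ ler_piMl ?cabs_ge0 // G1.
have : cabs (G 0) <= 1.
  have := cabs_ge0 (G 0); rewrite le_eqVlt => /orP[/eqP <- //|g0].
  by rewrite -(ler_pM2r g0) mul1r.
by rewrite cabsM cabs_cexp cReN expRN ler_pdivrMr ?expR_gt0 // mul1r.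
Qed.

Lemma lnabs_usc {T : topologicalType} (K : set T) (F : T -> CC) :
  (forall z, K z -> forall e : RR, 0 < e -> \forall y \near z, K y -> cabs (F y - F z) < e) ->
  usc_rel K (fun z => lnabs (F z)).
Proof.
move=> hF z Kz c; rewrite lnabs_ltE => h.
have e0 : 0 < expR c - cabs (F z) by rewrite subr_gt0.
apply: filterS (hF z Kz _ e0) => y hy Ky; have {}hy := hy Ky.
by rewrite lnabs_ltE; have := cabsD (F y - F z) (F z); rewrite subrK; rlra.
Qed.

Lemma ereal_eqNy (x : \bar RR) : (forall K : RR, (x <= K%:E)%E) -> x = -oo%E.
Proof.
case: x => [a| |] // h; last by have := h 0; rewrite leNgt ltry.
by have := h (a - 1); rewrite lee_fin => ?; exfalso; lra.
Qed.

Section SubharmonicDiscs.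
Implicit Types (U : set CC) (u p : CC -> \bar RR).

Lemma sbh_usc_shift U u a (K : set CC) : usc_on U u -> (forall l, K l -> U (a + l)) ->
  usc_rel K (fun l => u (a + l)).
Proof.
move=> hu KU l Kl c uc; have /nbhsCE [d d0 hd] := hu _ (KU l Kl) c uc.
apply/nbhsCE; exists d => // y yl _; apply: hd.
by rewrite (_ : a + y - (a + l) = y - l) //; ring.
Qed.

Lemma sbh_smv U u a : sbh U u -> U a -> smv (fun l => u (a + l)).
Proof.
move=> [_ _ _ us] Ua; have hl : line1 (fun l => a + l * 1) by exists a, 1.
have := us _ hl; rewrite mul0r addr0 => /(_ Ua); apply: (smv_local ltr01) => l _ /=.
by rewrite mulr1.
Qed.

Lemma sbh_ctest U u a (r : RR) : sbh U u -> 0 < r -> (forall l, cabs l <= r -> U (a + l)) ->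
  ctest (fun l => u (a + l)) r (u a).
Proof.
move=> hu r0 hU; have hl : line1 (fun l => a + l * 1) by exists a, 1.
have hU' l : cabs l <= r -> U (a + l * 1) by rewrite mulr1; exact: hU.
have := line_ctest line1_cont line1_aff hu hl r0 hU'.
rewrite mul0r addr0 => h P hP; apply: h => l Sl /=.
by rewrite mulr1; exact: hP.
Qed.

Lemma sbh_max_principle U u a (r : RR) (P : {poly CC}) : sbh U u -> 0 < r ->
  (forall l, cabs l <= r -> U (a + l)) ->
  (forall l, Sc r l -> (u (a + l)%R < (complex.Re P.[l])%:E)%E) ->
  forall l, cabs l <= r -> (u (a + l)%R <= (complex.Re P.[l])%:E)%E.
Proof.
move=> hu r0 hU; have [_ uy uu _] := hu; apply: max_principle => //.
- by move=> l /hU; exact: uy.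
- exact: sbh_usc_shift uu hU.
- move=> l lr; have := sbh_smv hu (hU l (ltW lr)).
  by congr smv; apply/funext => h; rewrite addrA.
Qed.

(** A large multiple of a Fejer kernel peaked at [b] may be subtracted from the constant majorant:
    near [b] this costs nothing since [p] is [-oo], on the rest of the circle the kernel is small,
    and on the disc of radius [r / 5] it is bounded below. *)
Lemma sbh_Ny_arc U p a b (r m : RR) : sbh U p -> 0 < m -> 0 < r -> cabs (b - a) = r ->
  (forall l, cabs l <= r -> U (a + l)) -> (forall y, cabs (y - b) < m -> p y = -oo%E) ->
  forall l, cabs l <= r / 5 -> p (a + l) = -oo%E.
Proof.
move=> hp m0 r0 br hU pb; have [_ py pu _] := hp.
have uS : usc_rel (Sc r) (fun l => p (a + l)).
  by apply: sbh_usc_shift pu _ => l Sl; apply: hU; rewrite (Sl : cabs l = r).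
have [|C C0 pC] := usc_circle_bounded r0 uS.
  by move=> l Sl; apply: py; apply: hU; rewrite (Sl : cabs l = r).
have b0 : b - a != 0 by rewrite -cabs_gt0 br.
(* By [fejer_tail] the normalised kernel is at most [4 r ^ 2 / (m ^ 2 n)] off the ball about [b];
   this [n] makes it at most [1 / 8]. *)
pose n := (Num.bound (32 * r ^+ 2 / m ^+ 2)).+1.
have nn0 : 0 < n%:R :> RR by rewrite ltr0n.
have nb : 32 * r ^+ 2 / m ^+ 2 < n%:R.
  have h0 : 0 <= 32 * r ^+ 2 / m ^+ 2 by rewrite divr_ge0 ?mulr_ge0 ?exprn_ge0 // ltW.
  by apply: lt_trans (archi_boundP h0) _; rewrite ltr_nat.
pose B l : RR := complex.Re (fejer n).[l / (b - a)] / n%:R.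
have Boff l : Sc r l -> m <= cabs (a + l - b) -> B l <= 1 / 8.
  move=> Sl ml; have x1 : cabs (l / (b - a)) = 1.
    by rewrite cabsM cabsV br (Sl : cabs l = r) divff // gt_eqF.
  have E : cabs (l / (b - a) - 1) = cabs (a + l - b) / r.
    rewrite -br -cabsV -cabsM; congr cabs.
    by field; apply/eqP => h; move: b0; rewrite h eqxx.
  have := fejer_tail n x1; rewrite E exprMn exprVn => h.
  have m2 : m ^+ 2 <= cabs (a + l - b) ^+ 2 by rewrite ler_pXn2r ?nnegrE ?cabs_ge0 // ltW.
  rewrite /B ler_pdivrMr //.
  have f0 : 0 <= complex.Re (fejer n).[l / (b - a)] by rewrite fejer_re // exprn_ge0 // cabs_ge0.
  set f := complex.Re _ in h f0 *.
  have rr0 : 0 < r ^+ 2 by rewrite exprn_gt0.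
  have mm0 : 0 < m ^+ 2 by rewrite exprn_gt0.
  have h1 : f * m ^+ 2 <= 4 * r ^+ 2.
    rewrite -ler_pdivrMr // -mulrA; apply: le_trans h; apply: ler_wpM2l => //.
    by rewrite ler_pM2r ?invr_gt0.
  have h2 : f <= 4 * r ^+ 2 / m ^+ 2 by rewrite ler_pdivlMr.
  have h3 : 32 * r ^+ 2 / m ^+ 2 = 8 * (4 * r ^+ 2 / m ^+ 2) by rewrite !mulrA -natrM.
  by rewrite h3 in nb; rlra.
have Bin l : cabs l <= r / 5 -> 1 / 2 <= B l.
  move=> lr; have x1 : cabs (l / (b - a)) <= 1 / 5.
    by rewrite cabsM cabsV br ler_pdivrMr // mulrAC mul1r.
  by have := fejer_small n x1; rewrite /B ler_pdivlMr // (mulrC (1 / 2)) mulrA mulr1.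
move=> l lr; apply: ereal_eqNy => K.
(* On the small disc the majorant is at most [C + 1 + k / 8 - k / 2 = C + 1 - 3 k / 8], which is at
   most [K]. *)
pose k := Num.max 0 ((C + 1 - K) * (8 / 3)).
have k0 : 0 <= k by rewrite le_max lexx.
have kK : (C + 1 - K) * (8 / 3) <= k by rewrite le_max lexx orbT.
pose P : {poly CC} := (C + 1 + k / 8)%:C%:P - (k / n%:R)%:C%:P * (fejer n \Po ((b - a)^-1 *: 'X)).
have PE z : complex.Re P.[z] = C + 1 + k / 8 - k * B z.
  rewrite /P hornerD hornerN hornerM !hornerC horner_comp hornerZ hornerX cReD cReN cRe_scale /=.
  rewrite /B (mulrC (b - a)^-1 z); congr (_ - _).
  by rewrite mulrAC mulrA.
have := sbh_max_principle (P := P) hp r0 hU.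
move=> /(_ _ l) H.
apply: le_trans (H _ _) _; last 2 first.
- by apply: le_trans lr _; rewrite ler_pdivrMr //; rlra.
- rewrite lee_fin PE; have := Bin l lr.
  move: (B l) => x x2; have : k * (1 / 2) <= k * x by rewrite ler_wpM2l.
  by move=> ?; rlra.
move=> z Sz; have [zm|mz] := ltP (cabs (a + z - b)) m.
  by rewrite pb // ltNyr.
apply: le_lt_trans (pC z Sz) _; rewrite lte_fin PE.
have := Boff z Sz mz; move: (B z) => x x2.
have : k * x <= k * (1 / 8) by rewrite ler_wpM2l.
by move=> ?; rlra.
Qed.

Lemma sbh_cmean_Ny U p a (r : RR) : sbh U p -> 0 < r -> (forall l, cabs l <= r -> U (a + l)) ->
  cmean (fun l => p (a + l)) r = -oo%E -> forall l, cabs l <= r / 5 -> p (a + l) = -oo%E.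
Proof.
move=> hp r0 hU mNy; have [_ py pu _] := hp.
have uS : usc_rel (Sc r) (fun l => p (a + l)).
  by apply: sbh_usc_shift pu _ => l Sl; apply: hU; rewrite (Sl : cabs l = r).
have [|C C0 pC] := usc_circle_bounded r0 uS.
  by move=> l Sl; apply: py; apply: hU; rewrite (Sl : cabs l = r).
move=> l lr; apply: ereal_eqNy => K.
(* Harnack averages the value at the centre with [C + 1]; starting from [2 K - (C + 1)] the average
   is [K]. *)
have [|P [h1 h2 h3]] := cmean_majorant (c := 2 * K - (C + 1)) r0 C0 uS pC.
  by rewrite mNy ltNyr.
have lr' : cabs l <= r by apply: le_trans lr _; rewrite ler_pdivrMr //; rlra.
apply: le_trans (sbh_max_principle hp r0 hU h1 lr') _.
by rewrite lee_fin; have := h3 l lr; rlra.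
Qed.

Lemma cball_convex (c y z : CC) (R s : RR) : cabs (y - c) < R -> cabs (z - c) < R ->
  0 <= s <= 1 -> cabs (y + s%:C * (z - y) - c) < R.
Proof.
move=> yR zR /andP[s0 s1].
have -> : y + s%:C * (z - y) - c = (1 - s)%:C * (y - c) + s%:C * (z - c).
  by rewrite rmorphB; ring.
apply: le_lt_trans (cabsD _ _) _; rewrite !cabsM !cabs_real.
rewrite !ger0_norm ?subr_ge0 //.
have [->|s'] := eqVneq s 0; first by rewrite subr0 mul1r mul0r addr0.
have s2 : 0 < s by rewrite lt_neqAle eq_sym s'.
have : s * cabs (z - c) < s * R by rewrite ltr_pM2l.
have : (1 - s) * cabs (y - c) <= (1 - s) * R by rewrite ler_wpM2l ?subr_ge0 // ltW.
rewrite !mulrBl; rlra.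
Qed.

(* If the mean over one circle were [-oo], Harnack's inequality would make [p] equal to [-oo]
   near its center, and this spreads along segments. *)
Lemma sbh_cmean_fin c (R : RR) p z1 : sbh [set y | cabs (y - c) < R] p ->
  cabs (z1 - c) < R -> p z1 != -oo%E -> forall y (r : RR), cabs (y - c) < R -> 0 < r ->
  (forall l, cabs l <= r -> cabs (y + l - c) < R) -> cmean (fun l => p (y + l)) r != -oo%E.
Proof.
move=> hp z1R pz1 y r yR r0 hU; apply/eqP => mNy.
pose N x := exists2 m : RR, 0 < m & forall l, cabs l < m -> p (x + l) = -oo%E.
have Ny : N y.
  exists (r / 5) => [|l /ltW]; first by rewrite divr_gt0.
  exact: sbh_cmean_Ny hp r0 hU mNy l.
pose g (s : RR) := y + s%:C * (z1 - y).
have gR s : 0 <= s <= 1 -> cabs (g s - c) < R by exact: cball_convex.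
pose M := cabs (z1 - y) + 1; have M0 : 0 < M by rewrite ltr_wpDl // cabs_ge0.
have gd s t : cabs (g s - g t) <= `|s - t| * M.
  rewrite /g (_ : _ - _ = (s - t)%:C * (z1 - y)); last by rewrite rmorphB; ring.
  by rewrite cabsM cabs_real ler_wpM2l // lerDl.
(* Continuity along the segment from [y] to [z1]. The property [N] is open by definition; it passes
   to the supremum by [sbh_Ny_arc] on the circle about [g s] through a point [g t] with [t] close to
   [s]. *)
pose S := [set s : RR | 0 <= s <= 1 /\ forall t, 0 <= t <= s -> N (g t)].
have S0 : S 0.
  split; first by rewrite lexx ler01.
  by move=> t /le_anti <-; rewrite /g mul0r addr0.
have hS : has_sup S by split; [exists 0|exists 1 => s [/andP[]]].
pose s := sup S.
have s0 : 0 <= s by apply: ub_le_sup; [exact: hS.2|].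
have s1 : s <= 1 by apply: ge_sup; [exact: hS.1|move=> t [/andP[]]].
have s01 : 0 <= s <= 1 by rewrite s0.
have Ns : N (g s).
  have /= [d d0 hd] := (openCE _).1 (@open_cball c R) _ (gR s s01).
  have eta0 : 0 < d / M by rewrite divr_gt0.
  have [t St ht] := sup_adherent eta0 hS.
  have ts : t <= s by apply: ub_le_sup => //; exact: hS.2.
  have [t01 Nt] := St.
  have [m m0 hm] : N (g t) by apply: Nt; rewrite lexx andbT; case/andP: t01.
  have [E|ne] := eqVneq (g t) (g s); first by rewrite -E; exists m.
  pose q := cabs (g t - g s).
  have q0 : 0 < q by rewrite cabs_gt0 subr_eq0.
  have qd : q < d.
    apply: le_lt_trans (gd t s) _; rewrite -ltr_pdivlMr // distrC ger0_norm ?subr_ge0 //.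
    by rewrite -/s in ht; rlra.
  exists (q / 5) => [|l /ltW hl]; first by rewrite divr_gt0.
  apply: (sbh_Ny_arc hp m0 q0 (erefl q) _ _ hl).
    by move=> l' l'q; apply: hd; rewrite addrC addKr; exact: le_lt_trans qd.
  by move=> x xm; have := hm (x - g t) xm; rewrite addrC subrK.
have [m m0 hm] := Ns.
have [E|sn1] := eqVneq s 1.
  have := hm 0; rewrite cabs0 addr0 E /g mul1r addrC subrK => /(_ m0) h.
  by move: pz1; rewrite h eqxx.
have s1' : s < 1 by rewrite lt_neqAle sn1.
pose eta := Num.min (1 - s) (m / (2 * M)).
have eta0 : 0 < eta by rewrite lt_min subr_gt0 s1' divr_gt0 // mulr_gt0.
have eta1 : eta <= 1 - s by rewrite ge_min lexx.
have eta2 : eta * M <= m / 2.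
  rewrite -ler_pdivlMr // ge_min; apply/orP; right.
  by rewrite (_ : m / (2 * M) = m / 2 / M) //; field; rewrite gt_eqF.
have : S (s + eta).
  split; first by rsplit.
  move=> t /andP[t0 ts].
  have [tls|slt] := ltP t s.
    have e0 : 0 < s - t by rewrite subr_gt0.
    have [x [_ Nx] hx] := sup_adherent e0 hS.
    by apply: Nx; rewrite t0 /= ltW //; rewrite -/s in hx; rlra.
  exists (m / 2) => [|l hl]; first by rewrite divr_gt0.
  have -> : g t + l = g s + (g t - g s + l) by ring.
  apply: hm; apply: le_lt_trans (cabsD _ _) _.
  have := gd t s; rewrite ger0_norm ?subr_ge0 // => h.
  have : (t - s) * M <= eta * M by rewrite ler_pM2r //; rlra.
  by rlra.
move=> /(ub_le_sup hS.2); rewrite -/s; rlra.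
Qed.

End SubharmonicDiscs.

(** * Polar sets *)

Definition locally_polar (A : set CC) := forall a, A a -> exists2 r : RR, 0 < r &
  exists p, [/\ sbh [set y | cabs (y - a) < r] p,
    (exists2 z, cabs (z - a) < r & p z != -oo%E) &
    forall z, cabs (z - a) < r -> A z -> p z = -oo%E].

Lemma polar_locally A : polar A -> locally_polar A.
Proof.
move=> pA a Aa; have [r r0 [p [hp [z za pz] pNy]]] := pA a Aa; exists r => //.
exists p; split.
- by rewrite -ball_setE; exact/subharmonicP.
- by exists z => //; exact/ballCE.
- by move=> y ya; apply: pNy; exact/ballCE.
Qed.

(* Removability of closed polar sets: the penalisation [u + k p] with [k -> 0] gives the bound
   [u <= Re P] off [{p = -oo}], and finiteness of the circle means of [p] gives it everywhere. *)
Lemma polar_removable U A u (C : RR) : open U -> locally_polar A -> sbh (U `\` A) u ->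
  (forall z, (U `\` A) z -> (u z <= C%:E)%E) ->
  exists H, [/\ sbh U H, forall z, (U `\` A) z -> H z = u z & forall z, U z -> (H z <= C%:E)%E].
Proof.
move=> oU pA hu uC; have [oUA uy uu us] := hu.
(* [H] is the upper limit of [u] along [U] minus [A], the point itself included when it belongs
   there. *)
pose V z (rho : RR) := [set u y | y in [set y | (U `\` A) y /\ cabs (y - z) < rho]].
pose H z := ereal_inf [set ereal_sup (V z rho) | rho in [set rho : RR | 0 < rho]].
have HC z : U z -> (H z <= C%:E)%E.
  move=> Uz; apply: (@le_trans _ _ (ereal_sup (V z 1))).
    by apply: ereal_inf_lbound; exists 1 => //=.
  by apply: ge_ereal_sup => _ [y [UAy _] <-]; exact: uC.
have Hlt z (c : RR) : (H z < c%:E)%E -> exists2 rho : RR, 0 < rho &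
    forall y, (U `\` A) y -> cabs (y - z) < rho -> (u y < c%:E)%E.
  move=> /ereal_inf_lt [_ [rho rho0 <-] h]; exists rho => // y UAy yz.
  by apply: le_lt_trans h; apply: ereal_sup_ubound; exists y.
have ltH z (c : RR) (rho : RR) : 0 < rho ->
    (forall y, (U `\` A) y -> cabs (y - z) < rho -> (u y <= c%:E)%E) -> (H z <= c%:E)%E.
  move=> rho0 h; apply: (@le_trans _ _ (ereal_sup (V z rho))).
    by apply: ereal_inf_lbound; exists rho.
  by apply: ge_ereal_sup => _ [y [UAy yz] <-]; exact: h.
have Hu z : (U `\` A) z -> H z = u z.
  move=> UAz; apply/eqP; rewrite eq_le; apply/andP; split.
    rewrite leNgt; apply/negP => uH.
    have : exists c d : RR, [/\ (u z < c%:E)%E, c < d & (d%:E <= H z)%E].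
      move: uH (HC z UAz.1); case: (H z) => [h| |] //; last by rewrite ltNge leNye.
      move=> /lt_ereal_between [c uc ch] _; exists c, h; split => //.
    move=> [c [d [uc cd dH]]]; have /nbhsCE [rho rho0 hrho] := uu z UAz c uc.
    have := ltH z c rho rho0; move=> /(_ _) Hc.
    have : (H z <= c%:E)%E by apply: Hc => y UAy yz; apply/ltW/hrho.
    by rewrite leNgt; move=> /negP; apply; apply: lt_le_trans dH; rewrite lte_fin.
  apply: le_ereal_inf_tmp => _ [rho rho0 <-]; apply: ereal_sup_ubound.
  by exists z => //; split => //; rewrite subrr cabs0.
have Husc : usc_on U H.
  move=> z Uz c /lt_ereal_between [c' /Hlt [rho rho0 h] c'c].
  have rho2 : 0 < rho / 2 by rewrite divr_gt0.
  apply/nbhsCE; exists (rho / 2) => // y yz.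
  apply: (@le_lt_trans _ _ c'%:E); last by rewrite lte_fin.
  apply: (ltH y c' (rho / 2) rho2) => x UAx xy; apply/ltW/h => //.
  by have := cabsD (x - y) (y - z); rewrite subrKA; rlra.
exists H; split => //; split => //.
  by move=> z /HC /le_lt_trans; apply; rewrite ltry.
move=> L [a0 [b ->]] Ua; apply: (@smv_linear (fun l => H (a0 + l)) b).
rewrite mul0r addr0 in Ua; move: a0 Ua => a Ua.
have [Aa|nAa] := pselect (A a); last first.
  have UAa : (U `\` A) a by [].
  have [d d0 hd] := (openCE _).1 oUA a UAa.
  apply: (smv_local d0 _ (sbh_smv hu UAa)) => l ld.
  by rewrite Hu //; apply: hd; rewrite addrC addKr.
have [r0 r00 [p [hp [z1 z1r pz1] pNy]]] := pA a Aa; have [_ py pu ps] := hp.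
have [d0 d00 hd0] := (openCE U).1 oU a Ua.
pose d := Num.min d0 r0; have dd0 : 0 < d by rewrite lt_min d00.
exists d => // r rr0; rewrite lt_min => /andP[rd0 rr] P hP; rewrite addr0.
have hU l : cabs l <= r -> U (a + l).
  by move=> lr; apply: hd0; rewrite addrC addKr; exact: le_lt_trans rd0.
have hB l : cabs l <= r -> cabs (a + l - a) < r0.
  by move=> lr; rewrite addrC addKr; exact: le_lt_trans rr.
have cD : compact [set l | cabs l <= r].
  by have := @compact_disc 0 r; congr compact; apply/funext => z /=; rewrite subr0.
have up : usc_rel [set l | cabs l <= r] (fun l => p (a + l)) by exact: sbh_usc_shift pu hB.
have [Cp Cp0 pC] : exists2 Cp : RR, 0 <= Cp & forall l, cabs l <= r -> (p (a + l)%R <= Cp%:E)%E.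
  have ne : [set l | cabs l <= r] !=set0 by exists 0; rewrite /= cabs0 ltW.
  have [x xr hx] := usc_rel_max cD ne up.
  exists (Num.max 0 (fine (p (a + x)))); first by rewrite le_max lexx.
  move=> l lr; apply: le_trans (hx l lr) _; have := py _ (hB x xr).
  case: (p (a + x)) => [t| |] //= _; last by rewrite leNye.
  by rewrite lee_fin le_max lexx orbT.
pose p' z := (p z + (- Cp)%:E)%E.
have oB : open [set y | cabs (y - a) < r0] by exact: open_cball.
have hp' : sbh [set y | cabs (y - a) < r0] p'.
  by apply: (gpshD line1_cont hp); apply: gpsh_cst.
have p'0 l : cabs l <= r -> (p' (a + l)%R <= 0)%E.
  by move=> lr; rewrite /p' EFinN sube_le0; exact: pC.
have p'y z : cabs (z - a) < r0 -> (p' z < +oo)%E by have [_ h _ _] := hp'; exact: h.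
have p'u : usc_rel [set l | cabs l <= r] (fun l => p' (a + l)).
  by have [_ _ h _] := hp'; exact: sbh_usc_shift h hB.
have p'Ny z : (p' z == -oo%E) = (p z == -oo%E) by rewrite /p'; case: (p z).
(* On [A] the penalty is [-oo] and the sub-mean value inequality is trivial; off [A] the sum is
   subharmonic. Hence the maximum principle holds on the whole disc. *)
have key (k : RR) : 0 < k -> forall l, cabs l <= r ->
    (H (a + l)%R + k%:E * p' (a + l)%R <= (complex.Re P.[l])%:E)%E.
  move=> k0.
  have hk := gpsh_scale k0 hp'; have [_ ky ku _] := hk.
  apply: max_principle => //.
  - move=> l lr; apply: lte_add_pinfty; last exact: ky (hB l lr).
    by apply: le_lt_trans (HC _ (hU l lr)) _; rewrite ltry.
  - apply: usc_relD; [| | |exact: sbh_usc_shift ku hB].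
    + by move=> l lr; apply: le_lt_trans (HC _ (hU l lr)) _; rewrite ltry.
    + by move=> l lr; exact: ky (hB l lr).
    + exact: sbh_usc_shift Husc hU.
  - move=> l lr; have [Al|nAl] := pselect (A (a + l)).
      exists 1 => // s s0 _ Q _; rewrite addr0 /p' pNy //; last exact: hB (ltW lr).
      by rewrite addNye gt0_muleNy ?lte_fin // addeNy leNye.
    have UAl : (U `\` A) (a + l) by split => //; exact: hU (ltW lr).
    have hsum := gpshD line1_cont (gpsh_sub (openI oUA oB) (@subIsetl _ _ _) hu)
       (gpsh_sub (openI oUA oB) (@subIsetr _ _ _) hk).
    have UBl : ((U `\` A) `&` [set y | cabs (y - a) < r0]) (a + l).
      by split => //; exact: hB (ltW lr).
    have [e e0 he] := (openCE _).1 (openI oUA oB) _ UBl.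
    apply: (smv_local e0 _ (sbh_smv hsum UBl)) => x xe.
    rewrite -addrA Hu //; rewrite addrA.
    by apply: (he _ _).1; rewrite [X in cabs X]addrC addKr.
  - move=> l Sl; apply: le_lt_trans (hP l Sl); rewrite -[leRHS]adde0.
    apply: leeD => //; rewrite mule_ge0_le0 ?lee_fin ?(ltW k0) //.
    by apply: p'0; rewrite (Sl : cabs l = r).
have offp l : cabs l <= r -> p (a + l) != -oo%E -> (H (a + l)%R <= (complex.Re P.[l])%:E)%E.
  move=> lr pl; have : p' (a + l) != -oo%E by rewrite p'Ny.
  have := p'0 l lr; case E : (p' (a + l)) => [t| |] //; rewrite lee_fin => t0 _.
  apply/lee_addgt0Pr => e e0.
  have k0 : 0 < e / (1 - t) by rewrite divr_gt0 //; rlra.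
  have := key _ k0 l lr; rewrite E -EFinM.
  have h : - e <= e / (1 - t) * t.
    rewrite (_ : e / (1 - t) * t = - e + e / (1 - t)); first by rewrite lerDl ltW.
    by field; rewrite gt_eqF //; rlra.
  case: (H (a + l)) => [x| |] //; last by move=> _; rewrite leNye.
  by rewrite -!EFinD !lee_fin; rlra.
(* [p] may be [-oo] at points outside [A] too. There [u] is bounded by its mean over a small circle,
   and since [p'] has a finite mean, at least [b0], the penalty costs at most [k |b0| <= ee]. *)
have all l : cabs l < r -> ~ A (a + l) -> (u (a + l)%R <= (complex.Re P.[l])%:E)%E.
  move=> lr nAl; have UAl : (U `\` A) (a + l) by split => //; exact: hU (ltW lr).
  rewrite -Hu //.
  have [pl|] := eqVneq (p (a + l)) -oo%E; last by apply: offp; exact: ltW.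
  have [e e0 he] := (openCE _).1 oUA _ UAl.
  pose s := Num.min (e / 2) ((r - cabs l) / 2).
  have rl0 : 0 < r - cabs l by rewrite subr_gt0.
  have s0 : 0 < s by rewrite lt_min !divr_gt0.
  have s1 : s < e by rewrite gt_min; apply/orP; left; rlra.
  have s2 : s < r - cabs l by rewrite gt_min; apply/orP; right; rlra.
  have inU x : cabs x <= s -> (U `\` A) (a + l + x).
    by move=> xs; apply: he; rewrite [X in cabs X]addrC addKr; exact: le_lt_trans s1.
  have inr x : cabs x <= s -> cabs (l + x) <= r.
    by move=> xs; apply: le_trans (cabsD _ _) _; rlra.
  have inB x : cabs x <= s -> cabs (a + l + x - a) < r0.
    by move=> xs; rewrite -(addrA a l x); apply: hB; exact: inr.
  have uS : usc_rel (Sc s) (fun x => u (a + l + x)).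
    by apply: sbh_usc_shift uu _ => x Sx; apply: inU; rewrite (Sx : cabs x = s).
  have pS : usc_rel (Sc s) (fun x => p' (a + l + x)).
    have [_ _ h _] := hp'; apply: sbh_usc_shift h _ => x Sx.
    by apply: inB; rewrite (Sx : cabs x = s).
  have m1 := ctest_cmean s0 uS _ (sbh_ctest hu s0 inU).
  have {}m1 : (u (a + l)%R <= cmean (fun x => u (a + l + x)%R) s)%E.
    by apply: m1 => x Sx; apply: uy; apply: inU; rewrite (Sx : cabs x = s).
  have pz1' : p' z1 != -oo%E by rewrite p'Ny.
  have fin := sbh_cmean_fin hp' z1r pz1' (hB l (ltW lr)) s0 inB.
  have [b0 hb0] : exists b0 : RR, (b0%:E <= cmean (fun x => p' (a + l + x)%R) s)%E.
    move: fin; case: (cmean _ s) => [t| |] // _; first by exists t.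
    by exists 0; rewrite leey.
  have pct := cmean_ctest s0 pS hb0.
  rewrite Hu //; apply/lee_addgt0Pr => ee ee0.
  have k0 : 0 < ee / (`|b0| + 1) by rewrite divr_gt0 // ltr_wpDl.
  set k := ee / (`|b0| + 1) in k0.
  have hk := gpsh_scale k0 hp'; have [_ ky ku _] := hk.
  have kS : usc_rel (Sc s) (fun x => k%:E * p' (a + l + x)%R)%E.
    by apply: sbh_usc_shift ku _ => x Sx; apply: inB; rewrite (Sx : cabs x = s).
  have uyS x : Sc s x -> (u (a + l + x)%R < +oo)%E.
    by move=> Sx; apply: uy; apply: inU; rewrite (Sx : cabs x = s).
  have kyS x : Sc s x -> (k%:E * p' (a + l + x)%R < +oo)%E.
    by move=> Sx; apply: ky; apply: inB; rewrite (Sx : cabs x = s).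
  have m2 := ctest_cmean s0 kS kyS (ctest_pos_scale k0 pct).
  have m3 := le_cmeanD s0 uS kS uyS kyS.
  have hPl : hol_disc (fun x => P.[l + x]) 0 s.
    move=> z _; have [m hm] := cdiff_poly P (l + z); eexists.
    exact: cdiff_comp (cdiffD (cdiff_cst l z) (cdiff_id z)) hm.
  have m4 : (cmean (fun x => u (a + l + x)%R + k%:E * p' (a + l + x)%R) s <= (complex.Re P.[l])%:E)%E.
    have := cmean_le_hol s0 hPl; rewrite addr0; apply; first exact: usc_relD.
    move=> x Sx; have xs : cabs x <= s by rewrite (Sx : cabs x = s).
    by have := key k k0 (l + x) (inr x xs); rewrite addrA Hu //; exact: inU.
  have := le_trans (leeD m1 m2) (le_trans m3 m4).
  have kb : - ee <= k * b0.
    have : k * `|b0| <= ee.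
      rewrite /k mulrAC ler_pdivrMr ?ltr_wpDl // ler_pM2l //; rlra.
    have := ler_norm (- b0); rewrite normrN => h1 h2.
    have : k * - b0 <= k * `|b0| by rewrite ler_pM2l.
    by rewrite mulrN; rlra.
  rewrite -EFinM; case: (u (a + l)) => [x| |] //; last by move=> _; rewrite leNye.
  by rewrite -!EFinD !lee_fin; rlra.
apply/lee_addgt0Pr => e e0.
have [e1 e10 he1] := @ccont_poly P 0 e e0.
have rho0 : 0 < Num.min e1 r by rewrite lt_min e10.
rewrite -EFinD; apply: (ltH a _ _ rho0) => y [Uy nAy]; rewrite lt_min => /andP[ye1 yr].
have := all (y - a) yr; rewrite addrC subrK => /(_ nAy) h; apply: le_trans h _.
rewrite lee_fin; have := he1 (y - a); rewrite subr0 => /(_ ye1).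
by rewrite ltr_norml => /andP[_ ?]; rlra.
Qed.

(** * Perron envelopes and barriers of polar sets *)

Definition lsc_on {T : topologicalType} (U : set T) (u : T -> \bar RR) :=
  forall z, U z -> forall c : RR, (c%:E < u z)%E -> \forall y \near z, (c%:E < u y)%E.

(* Perron's method, in the form adapted to families that are certified by lower semicontinuous
   minorants: the gluing hypothesis replaces Poisson modification. *)
Lemma perron (B : set CC) (M : set (CC -> \bar RR)) : open B ->
  (forall m, M m -> lsc_on B m) ->
  (forall m1 m2, M m1 -> M m2 ->
     exists2 m, M m & forall x, B x -> (maxe (m1 x) (m2 x) <= m x)%E) ->
  (forall x, B x -> exists2 m, M m & (-oo < m x)%E) ->
  (forall m a r (P : {poly CC}), M m -> 0 < r -> (forall l, cabs l <= r -> B (a + l)) ->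
     (forall l, Sc r l -> ((complex.Re P.[l])%:E < m (a + l)%R)%E) ->
     exists2 m', M m' & ((complex.Re P.[0%R])%:E <= m' a)%E) ->
  sbh B (fun x => - ereal_sup [set m x | m in M])%E.
Proof.
move=> oB lM maxM NyM glueM; set g := fun x => ereal_sup [set m x | m in M].
have gP x m : M m -> (m x <= g x)%E by move=> Mm; apply: ereal_sup_ubound; exists m.
have gE x (c : RR) : (c%:E < g x)%E -> exists2 m, M m & (c%:E < m x)%E.
  by move=> /ereal_sup_gt [_ [m Mm <-] h]; exists m.
split => //.
- move=> x Bx; have [m Mm h] := NyM x Bx.
  by rewrite lteNl /=; apply: lt_le_trans h (gP x m Mm).
- move=> x Bx c; rewrite lteNl -EFinN => /gE [m Mm h].
  by apply: filterS (lM m Mm x Bx _ h) => y hy; rewrite lteNl -EFinN; exact: lt_le_trans hy (gP y m Mm).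
move=> L [a [b ->]]; rewrite mul0r addr0 => Ba.
apply: (@smv_linear (fun l => - g (a + l)%R)%E b).
have [d d0 hd] := (openCE B).1 oB a Ba.
exists d => // r r0 rd P hP; rewrite addr0.
have inB l : cabs l <= r -> B (a + l).
  by move=> lr; apply: hd; rewrite addrC addKr; exact: le_lt_trans rd.
have ReN l : complex.Re (- P).[l] = - complex.Re P.[l] by rewrite hornerN cReN.
have [m Mm hm] : exists2 m, M m &
    forall l, Sc r l -> ((complex.Re (- P).[l])%:E < m (a + l)%R)%E.
  (* The filter of upper sections of the directed family [M]: compactness of the circle, run along
     it, produces a single member above [Re (- P)] on the whole circle. *)
  pose F : set_system (CC -> \bar RR) := [set S | exists2 m0, M m0 &
    forall m, M m -> (forall x, B x -> (m0 x <= m x)%E) -> S m].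
  have FF : Filter F.
    split.
    - by have [m Mm _] := NyM a Ba; exists m.
    - move=> S1 S2 [m1 M1 h1] [m2 M2 h2]; have [m Mm mm] := maxM _ _ M1 M2.
      exists m => // m' Mm' h; split; [apply: h1|apply: h2] => // x Bx;
      by apply: le_trans (h x Bx); apply: le_trans (mm x Bx); rewrite le_max lexx ?orbT.
    - by move=> S1 S2 S12 [m1 M1 h1]; exists m1 => // m Mm h; apply: S12; exact: h1.
  have : \forall m \near F, Sc r `<=` [set l | ((complex.Re (- P).[l])%:E < m (a + l)%R)%E
      /\ M m].
    have /compact_near_coveringP := @compact_Sc r; apply => // x Sx.
    have Bx : B (a + x) by apply: inB; rewrite (Sx : cabs x = r).
    have [c gc cP] := lt_ereal_between (hP x Sx).
    move: gc; rewrite lteNl -EFinN => /gE [m Mm h].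
    exists ([set y | [/\ ((- c)%:E < m (a + y)%R)%E, B (a + y) & c < complex.Re P.[y]]],
            [set m' | M m' /\ forall x, B x -> (m x <= m' x)%E]).
      split; last by exists m.
      have h1 := lM m Mm _ Bx _ h; move/nbhsCE: h1 => [d1 d10 h1].
      have /= [d2 d20 h2] := (openCE B).1 oB _ Bx.
      have h3 := ctest_near_circle r cP; move/nbhsCE: h3 => [d3 d30 h3].
      apply/nbhsCE; exists (Num.min d1 (Num.min d2 d3)); first by rewrite !lt_min d10 d20.
      move=> y; rewrite !lt_min => /andP[y1 /andP[y2 y3]].
      have E : a + y - (a + x) = y - x by ring.
      by split; [apply: h1; rewrite E|apply: h2; rewrite E|exact: h3].
    move=> [y m'] /= [[my By cy] [Mm' mm']]; split => //.
    rewrite ReN; apply: lt_le_trans (mm' _ By); apply: le_lt_trans my.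
    by rewrite lee_fin; rlra.
  by move=> [m Mm h]; exists m => // l Sl; have [] := h m Mm (fun x _ => lexx _) l Sl.
have [m' Mm' h] := glueM m a r (- P) Mm r0 inB hm.
rewrite leeNl -EFinN -ReN; exact: le_trans h (gP a m' Mm').
Qed.

Lemma smv_poly (P : {poly CC}) : smv (fun l => (complex.Re P.[l])%:E).
Proof.
exists 1 => // r r0 _ Q hQ; rewrite lee_fin -subr_le0 -cReN -cReD -hornerN -hornerD.
apply: (hol_max r0); first exact: hol_poly.
by move=> l /hQ; rewrite lte_fin hornerD hornerN cReD cReN; rlra.
Qed.

Lemma poly_max_disc (P : {poly CC}) (r c : RR) : 0 < r ->
  (forall l, Sc r l -> complex.Re P.[l] <= c) -> forall l, cabs l <= r -> complex.Re P.[l] <= c.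
Proof.
move=> r0 hP l lr; rewrite -lee_fin; apply/lee_addgt0Pr => e e0; rewrite -EFinD.
have -> : c + e = complex.Re ((c + e)%:C%:P : {poly CC}).[l] by rewrite hornerC.
apply: (@max_principle (fun l => (complex.Re P.[l])%:E) r) => //.
- by move=> l' _; rewrite ltry.
- by apply: ccont_usc => z _; exact: ccont_poly.
- move=> l' _; apply: (smv_local ltr01) (smv_poly (P \Po ('X + l'%:P))) => h _ /=.
  by rewrite horner_comp hornerD hornerX hornerC addrC.
by move=> l' Sl; rewrite hornerC lte_fin /=; have := hP l' Sl; rlra.
Qed.

Section Projection.
Context {T : topologicalType} (lines : (CC -> T) -> Prop) (pr : T -> CC).
Hypothesis lines_cont : forall L, lines L -> continuous L.
Hypothesis pr_cont : continuous pr.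
Hypothesis lines_pr : forall L, lines L -> line1 (pr \o L).

Lemma gpsh_pr U h : sbh U h -> gpsh lines (pr @^-1` U) (h \o pr).
Proof.
move=> [oU hy hu hs]; split.
- by apply: open_comp => // x _; exact: pr_cont.
- by move=> p; exact: hy.
- move=> p Up c hc; exact: (pr_cont (hu _ Up c hc)).
- by move=> L hL; exact: hs (lines_pr hL).
Qed.

(** This takes the place of Poisson modification: the maximum with a polynomial of the base
    coordinate raises [q] over a disc and, as [Re P <= q] over the boundary circle, leaves it
    unchanged outside. *)
Lemma gpsh_glue_disc W q a (r : RR) (P : {poly CC}) : gpsh lines W q ->
  (forall p, W p -> cabs (pr p - a) = r -> ((complex.Re P.[pr p - a])%:E <= q p)%E) ->
  gpsh lines W (fun p => if pselect (cabs (pr p - a) < r)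
    then maxe (q p) (complex.Re P.[pr p - a])%:E else q p).
Proof.
move=> hq hP; have [oW _ _ _] := hq.
have op : open [set p | cabs (pr p - a) < r].
  apply: (@open_comp _ _ pr [set y | cabs (y - a) < r]); last exact: open_cball.
  by move=> x _; exact: pr_cont.
have near_re p (c : RR) : complex.Re P.[pr p - a] < c ->
    \forall y \near p, complex.Re P.[pr y - a] < c.
  move=> h; have e0 : 0 < c - complex.Re P.[pr p - a] by rewrite subr_gt0.
  have [d d0 hd] := @ccont_poly P (pr p - a) _ e0.
  have : \forall y \near p, cabs (pr y - pr p) < d.
    by apply: (@pr_cont p [set y | cabs (y - pr p) < d]); apply/nbhsCE; exists d.
  apply: filterS => y yd; have := hd (pr y - a).
  rewrite (_ : pr y - a - (pr p - a) = pr y - pr p); last ring.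
  by move=> /(_ yd); rewrite ltr_norml => /andP[_ ?]; rlra.
apply: (@gpsh_glue _ _ lines_cont W [set p | cabs (pr p - a) < r] q) => //.
  split.
  - exact: openI.
  - by move=> p _; rewrite ltry.
  - by move=> p _ c; rewrite lte_fin => /near_re; apply: filterS => y; rewrite lte_fin.
  - move=> L hL _; have [b [e E]] := lines_pr hL.
    apply: (smv_local ltr01) (smv_poly (P \Po (e *: 'X + (b - a)%:P))) => l _ /=.
    have -> : pr (L l) = b + l * e by have := congr1 (fun F => F l) E.
    rewrite horner_comp hornerD hornerZ hornerX hornerC; congr (complex.Re _.[_])%:E; ring.
move=> p Wp /negP; rewrite -leNgt => rp c qc.
have [E|ne] := eqVneq (cabs (pr p - a)) r.
  have := le_lt_trans (hP p Wp E) qc; rewrite lte_fin => /near_re.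
  by apply: filterS => y h _; rewrite lte_fin.
have lt : r < cabs (pr p - a) by rewrite lt_neqAle eq_sym ne.
have : \forall y \near p, cabs (pr y - pr p) < cabs (pr p - a) - r.
  apply: (@pr_cont p [set y | cabs (y - pr p) < cabs (pr p - a) - r]).
  by apply/nbhsCE; eexists; [|move=> y; exact]; rewrite subr_gt0.
apply: filterS => y yp /= ya; exfalso.
have := cabsD (pr p - pr y) (pr y - a); rewrite subrKA (cabs_sub (pr p) (pr y)); rlra.
Qed.

End Projection.

Lemma line1_id L : line1 L -> line1 (id \o L). Proof. by []. Qed.

Lemma line2_fst L : line2 L -> line1 (fst \o L).
Proof. by move=> [a [b ->]]; exists a.1, b.1. Qed.

Lemma sbh_ccont U q : open U -> (forall z, U z -> ccont q z) ->
  (forall z, U z -> smv (fun l => (q (z + l))%:E)) -> sbh U (fun z => (q z)%:E).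
Proof.
move=> oU cq sq; split => //; first by move=> z _; rewrite ltry.
  by apply: usc_on_of_rel => //; exact: ccont_usc.
move=> L [a [b ->]]; rewrite mul0r addr0 => Ua.
exact: (@smv_linear (fun l => (q (a + l))%:E) b (sq _ Ua)).
Qed.

Lemma ccont_sqr a (c d : RR) z : ccont (fun y => c * (cabs (y - a) ^+ 2 - d)) z.
Proof.
apply: ccontM; first exact: ccont_cst.
apply: ccontD; last exact: ccont_cst.
have h : ccont (fun y => cabs (y - a)) z.
  by move=> e e0; exists e => // y; apply: le_lt_trans; rewrite (le_trans (cabs_dist _ _)) //
    (_ : y - a - (z - a) = y - z) //; ring.
by rewrite /ccont; apply: ccontM.
Qed.

Lemma sbh_sqr U a (c d : RR) : open U -> 0 <= c ->
  sbh U (fun z => (c * (cabs (z - a) ^+ 2 - d))%:E).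
Proof.
move=> oU c0; apply: sbh_ccont => // [z _|z _]; first exact: ccont_sqr.
pose P : {poly CC} := (c%:C * 2 * (z - a)^* )%:P * 'X + (c * (cabs (z - a) ^+ 2 - d))%:C%:P.
have PE l : complex.Re P.[l] =
    c * complex.Re (2 * ((z - a)^* * l)) + c * (cabs (z - a) ^+ 2 - d).
  by rewrite /P hornerD hornerM hornerX !hornerC cReD -!mulrA cRe_scale.
apply: smv_ge (smv_poly P) => [l|]; rewrite PE.
  rewrite lee_fin (_ : z + l - a = z - a + l); last ring.
  rewrite (cabsD_expand (z - a) l).
  have : 0 <= c * cabs l ^+ 2 by rewrite mulr_ge0 ?exprn_ge0 ?cabs_ge0.
  by rlra.
have -> : 2 * ((z - a)^* * 0) = 0 :> CC by ring.
by rewrite addr0 /= mulr0 add0r.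
Qed.

Lemma compact_cball_lt (K : set CC) a (rho : RR) : compact K ->
  (forall z, K z -> cabs (z - a) < rho) -> 0 < rho ->
  exists2 r : RR, 0 <= r < rho & forall z, K z -> cabs (z - a) <= r.
Proof.
move=> cK hK rho0; have [K0|] := pselect (K !=set0); last first.
  by move=> h; exists 0; [rewrite lexx|move=> z Kz; exfalso; apply: h; exists z].
have hu : usc_rel K (fun z => (cabs (z - a))%:E).
  apply: ccont_usc => z _ e e0; exists e => // y; apply: le_lt_trans.
  by rewrite (le_trans (cabs_dist _ _)) // (_ : y - a - (z - a) = y - z) //; ring.
have [x Kx hx] := usc_rel_max cK K0 hu.
by exists (cabs (x - a)); [rewrite cabs_ge0 hK|move=> z /hx].
Qed.

(* Every competitor is [<= 0] and [<= -2] near [K]; the removable singularity theorem and the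
   maximum principle force the upper envelope to vanish off [K]. *)
Lemma polar_barrier (K : set CC) a (rho eta : RR) x : compact K -> locally_polar K ->
  (forall z, K z -> cabs (z - a) < rho) -> cabs (x - a) < rho -> ~ K x -> 0 < eta ->
  exists q, [/\ sbh [set z | cabs (z - a) < rho] q,
    forall z, cabs (z - a) < rho -> (q z <= 0)%E,
    exists G, [/\ open G, K `<=` G & forall z, G z -> cabs (z - a) < rho -> (q z <= (- 2)%:E)%E] &
    \forall y \near x, ((- eta)%:E <= q y)%E].
Proof.
move=> cK pK Krho xrho nKx eta0.
have rho0 : 0 < rho by apply: le_lt_trans xrho; exact: cabs_ge0.
set Om := [set z | cabs (z - a) < rho].
have oOm : open Om by exact: open_cball.
have oB : open (Om `\` K).
  apply: openI => //; apply: closed_openC; apply: compact_closed cK.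
  exact: (@norm_hausdorff CC CC^o).
pose good q := [/\ sbh Om q, forall z, Om z -> (q z <= 0)%E &
  exists G, [/\ open G, K `<=` G & forall z, G z -> Om z -> (q z <= (- 2)%:E)%E]].
pose M : set (CC -> \bar RR) := [set m | lsc_on (Om `\` K) m /\
  exists2 q, good q & forall z, (Om `\` K) z -> (m z <= q z)%E].
have good2 : good (fun=> (- 2)%:E).
  split; first exact: gpsh_cst.
    by move=> z _; rewrite lee_fin; lra.
  by exists setT; split => //; exact: openT.
have M2 : M (fun=> (- 2)%:E).
  by split; [move=> z _ c h; apply: filterE|exists (fun=> (- 2)%:E)].
pose g x := ereal_sup [set m x | m in M].
have hg : sbh (Om `\` K) (fun x => - g x)%E.
  apply: perron => //.
  - by move=> m [].
  - move=> m1 m2 [l1 [q1 [h1 n1 [G1 [oG1 K1 q1G]]] mq1]] [l2 [q2 [h2 n2 [G2 [oG2 K2 q2G]]] mq2]].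
    exists (fun z => maxe (m1 z) (m2 z)) => //; split.
      move=> z Bz c; rewrite lt_max => /orP[/(l1 z Bz)|/(l2 z Bz)];
      by apply: filterS => y h; rewrite lt_max h ?orbT.
    exists (fun z => maxe (q1 z) (q2 z)).
      split; first exact: gpsh_max.
        by move=> z Oz; rewrite ge_max n1 ?n2.
      exists (G1 `&` G2); split; [exact: openI|by move=> z Kz; split; [exact: K1|exact: K2]|].
      by move=> z [G1z G2z] Oz; rewrite ge_max q1G ?q2G.
    by move=> z Bz; rewrite ge_max !le_max mq1 // mq2 // orbT.
  - by move=> z _; exists (fun=> (- 2)%:E) => //; rewrite ltNyr.
  move=> m b r P [lm [q [hq q0 [G [oG KG qG]]] mq]] r0 inB hm.
  have P0 l : cabs l <= r -> complex.Re P.[l] <= 0.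
    apply: poly_max_disc => // l' Sl.
    have Bl : (Om `\` K) (b + l') by apply: inB; rewrite (Sl : cabs l' = r).
    have := lt_le_trans (hm l' Sl) (le_trans (mq _ Bl) (q0 _ Bl.1)).
    by rewrite lte_fin => /ltW.
  exists (fun z => if pselect (cabs (z - b) < r) then maxe (m z) (complex.Re P.[z - b])%:E
     else m z); last first.
    by case: pselect => /= [_|[]]; rewrite subrr ?cabs0 // le_max lexx orbT.
  split.
    move=> z Bz c; case: pselect => /= [zr|nzr].
      have n1 : \forall y \near z, cabs (y - b) < r.
        by apply: open_nbhs_nbhs; split => //; exact: open_cball.
      rewrite lt_max => /orP[/(lm z Bz)|].
        by apply: filterS2 n1 => y yr my; case: pselect => //= _; rewrite lt_max my.
      rewrite lte_fin => cP; have e0 : 0 < complex.Re P.[z - b] - c by rewrite subr_gt0.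
      have [d d0 hd] := @ccont_poly P (z - b) _ e0.
      have n2 : \forall y \near z, cabs (y - z) < d by apply/nbhsCE; exists d.
      apply: filterS2 n1 n2 => y yr yd; case: pselect => //= _.
      have := hd (y - b); rewrite (_ : y - b - (z - b) = y - z); last ring.
      move=> /(_ yd); rewrite ltr_norml => /andP[? _]; rewrite lt_max lte_fin.
      by apply/orP; right; rlra.
    by move=> /(lm z Bz); apply: filterS => y my; case: pselect => //= _; rewrite lt_max my.
  exists (fun z => if pselect (cabs (z - b) < r) then maxe (q z) (complex.Re P.[z - b])%:E
     else q z); last first.
    by move=> z Bz; case: pselect => //= _; rewrite ?ge_max ?le_max ?mq ?lexx ?orbT.
  split.
  - apply: (gpsh_glue_disc line1_cont (pr := id) (fun z => @cvg_id _ (nbhs z)) line1_id) => //.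
    move=> z Oz zr /=; have Bz : (Om `\` K) z.
      by have := inB (z - b); rewrite subrKC; apply; rewrite zr.
    have := hm (z - b) zr; rewrite subrKC => /ltW h; exact: le_trans h (mq z Bz).
  - move=> z Oz; case: pselect => /= [zr|_]; last exact: q0.
    by rewrite ge_max q0 // lee_fin P0 // ltW.
  (* The closed disc of the modification avoids [K], so removing it from [G] keeps a neighbourhood
     of [K] on which the competitor is still [q]. *)
  exists (G `&` [set z | ~ cabs (z - b) <= r]); split.
  - apply: openI => //; rewrite (_ : [set z | _] = ~` [set z | cabs (z - b) <= r]) //.
    apply: closed_openC; apply: compact_closed; [exact: (@norm_hausdorff CC CC^o)|].
    exact: (@compact_disc b r).
  - move=> z Kz; split; first exact: KG.
    by move=> zr; have := inB (z - b) zr; rewrite subrKC => -[].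
  - move=> z [Gz nz] Oz; case: pselect => /= [zr|_]; last exact: qG.
    by exfalso; apply: nz; exact: ltW.
(* [- g] is subharmonic and bounded by 2 off [K], so it extends across the polar set [K]. One
   explicit competitor shows that it is small near the boundary circle, and the maximum principle
   then gives [- g <= 0]. *)
have g0 z : (Om `\` K) z -> (0 <= g z)%E.
  move=> Bz; rewrite -leeN2 oppe0.
  have gle y : (Om `\` K) y -> (- g y <= 2%:E)%E.
    move=> By; rewrite leeNl -EFinN; apply: ereal_sup_ubound.
    by exists (fun=> (- 2)%:E).
  have [H [hH HE H2]] := polar_removable oOm pK hg gle.
  rewrite -HE //; apply/lee_addgt0Pr => e e0; rewrite add0e.
  have [r1 /andP[r10 r1rho] Kr1] := compact_cball_lt cK Krho rho0.
  (* The quadratic vanishes at radius [rho] and equals [- 2] at radius [r2], beyond [K]; its maximum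
     with [- 2] is thus [- 2] near [K] and tends to [0] at the boundary. *)
  pose r2 := (r1 + rho) / 2; have r12 : r1 < r2 by rewrite /r2; rlra.
  have r2rho : r2 < rho by rewrite /r2; rlra.
  have [c c0 cE] : exists2 c : RR, 0 < c & c * (r2 ^+ 2 - rho ^+ 2) = - 2.
    have d0 : 0 < rho ^+ 2 - r2 ^+ 2.
      by rewrite subr_sqr mulr_gt0 ?subr_gt0 // addr_gt0 //; rlra.
    exists (2 / (rho ^+ 2 - r2 ^+ 2)); first by rewrite divr_gt0.
    by field; rewrite gt_eqF.
  pose s y : \bar RR := (c * (cabs (y - a) ^+ 2 - rho ^+ 2))%:E.
  pose q y := maxe (s y) (- 2)%:E.
  have hq : sbh Om q.
    by apply: gpsh_max; [apply: sbh_sqr => //; exact: ltW|exact: gpsh_cst].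
  have Mq : M q.
    split.
      move=> y _ d; rewrite lt_max => /orP[|h2]; last first.
        by apply: filterE => w; rewrite lt_max h2 orbT.
      rewrite lte_fin => h; have h0 : 0 < c * (cabs (y - a) ^+ 2 - rho ^+ 2) - d by rewrite subr_gt0.
      have [t t0 ht] := @ccont_sqr a c (rho ^+ 2) y _ h0.
      apply/nbhsCE; exists t => // w /ht; rewrite ltr_norml => /andP[? _].
      by rewrite lt_max lte_fin; apply/orP; left; rlra.
    exists q => //; split => //.
      move=> y Oy; rewrite ge_max !lee_fin; apply/andP; split; last lra.
      rewrite pmulr_rle0 // subr_le0 ler_pXn2r ?nnegrE ?cabs_ge0 ?ltW //.
    exists [set y | cabs (y - a) < r2]; split; first exact: open_cball.
      by move=> y /Kr1 h /=; exact: le_lt_trans r12.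
    move=> y /= yr2 _; rewrite ge_max lexx andbT lee_fin -cE ler_pM2l // lerD2r.
    by rewrite ler_pXn2r ?nnegrE ?cabs_ge0 ?ltW //; rlra.
  have gq y : (Om `\` K) y -> (- g y <= (c * (rho ^+ 2 - cabs (y - a) ^+ 2))%:E)%E.
    move=> By; rewrite leeNl; apply: (@le_trans _ _ (q y)); last first.
      by apply: ereal_sup_ubound; exists q.
    by rewrite le_max -EFinN lee_fin; apply/orP; left; rewrite -mulrN opprB.
  have [t t0 ht] : exists2 t : RR, 0 < t & forall y, cabs (y - a) < rho ->
      rho - t < cabs (y - a) -> c * (rho ^+ 2 - cabs (y - a) ^+ 2) < e.
    exists (e / (2 * c * rho)); first by rewrite divr_gt0 // !mulr_gt0.
    move=> y; set b := cabs (y - a) => y1 y2.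
    have b0 : 0 <= b by exact: cabs_ge0.
    have : rho - b < e / (2 * c * rho) by rlra.
    rewrite ltr_pdivlMr ?mulr_gt0 // => h; apply: le_lt_trans h.
    rewrite subr_sqr (_ : (rho - b) * (2 * c * rho) = c * ((rho - b) * (2 * rho))); last ring.
    by rewrite ler_pM2l // ler_wpM2l //; rlra.
  pose m1 := Num.max (cabs (z - a)) (Num.max r1 (rho - t)).
  have m1rho : m1 < rho by rewrite !gt_max Bz.1 r1rho ltrBlDr ltrDl.
  pose r := (m1 + rho) / 2.
  have mr : m1 < r by rewrite /r; rlra.
  have rrho : r < rho by rewrite /r; rlra.
  have [zr r1r tr] : [/\ cabs (z - a) < r, r1 < r & rho - t < r].
    by move: mr; rewrite !gt_max => /andP[? /andP[]].
  have r0 : 0 < r by exact: le_lt_trans r1r.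
  have inOm l : cabs l <= r -> Om (a + l).
    by move=> lr; rewrite /Om /= addrC addKr; exact: le_lt_trans rrho.
  have := sbh_max_principle (P := e%:C%:P) hH r0 inOm; rewrite /=.
  move=> h; have := h _ (z - a) (ltW zr); rewrite subrKC hornerC /=; apply => l Sl.
  have lr : cabs l = r by [].
  have El : a + l - a = l by rewrite addrC addKr.
  have Bl : (Om `\` K) (a + l).
    split; first by apply: inOm; rewrite lr.
    by move=> /Kr1; rewrite El lr leNgt r1r.
  rewrite HE // hornerC /=; apply: le_lt_trans (gq _ Bl) _.
  by rewrite lte_fin; apply: ht; rewrite El lr.
have : ((- eta)%:E < g x)%E.
  by apply: lt_le_trans (g0 x (conj xrho nKx)); rewrite lte_fin oppr_lt0.
move=> /ereal_sup_gt [_ [m [lm [q [hq q0 qG] mq]] <-] hm].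
exists q; split => //.
apply: filterS2 (open_nbhs_nbhs (conj oB (conj xrho nKx))) (lm x (conj xrho nKx) _ hm).
by move=> y By my; apply: ltW; exact: lt_le_trans my (mq y By).
Qed.

(** * Series with locally eventually nonpositive terms *)

Section Series.
Context {T : topologicalType} (lines : (CC -> T) -> Prop).
Hypothesis lines_cont : forall L, lines L -> continuous L.
Hypothesis lines_aff : forall L a b, lines L -> lines (fun l => L (a + l * b)).
Variables (W : set T) (q : nat -> T -> \bar RR).
Hypothesis oW : open W.
Hypothesis hq : forall n, gpsh lines W (q n).

Definition psum n p : \bar RR := (\sum_(k < n) q k p)%E.

Lemma psumS n p : psum n.+1 p = (psum n p + q n p)%E.
Proof. by rewrite /psum big_ord_recr. Qed.

Lemma gpsh_psum n : gpsh lines W (psum n).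
Proof.
elim: n => [|n IH].
  have -> : psum 0 = fun=> 0%:E by apply/funext => p; rewrite /psum big_ord0.
  exact: gpsh_cst.
have -> : psum n.+1 = fun p => (psum n p + q n p)%E by apply/funext => p; exact: psumS.
exact: gpshD.
Qed.

Lemma psum_dec N p : (forall j, (N <= j)%N -> (q j p <= 0)%E) ->
  forall m n, (N <= m)%N -> (m <= n)%N -> (psum n p <= psum m p)%E.
Proof.
move=> h m n Nm /subnK <-; elim: (n - m)%N => [|i IH]; first by rewrite add0n.
rewrite addSn psumS; apply: le_trans IH; rewrite -[leRHS]adde0; apply: leeD => //.
by apply: h; apply: leq_trans Nm _; rewrite leq_addl.
Qed.

Lemma gpsh_series : (forall p, W p -> exists N, \forall y \near p,
    forall j, (N <= j)%N -> (q j y <= 0)%E) ->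
  exists2 v, gpsh lines W v & forall p N, W p -> (forall j, (N <= j)%N -> (q j p <= 0)%E) ->
    (forall n, (N <= n)%N -> (v p <= psum n p)%E) /\
    (forall c, (forall n, (N <= n)%N -> (c <= psum n p)%E) -> (c <= v p)%E).
Proof.
move=> ev.
(* The infimum from [N] on no longer depends on [N] once the later terms are nonpositive, so the
   local definitions agree. *)
pose tail N p := ereal_inf [set psum n p | n in [set n | (N <= n)%N]].
have tailE N M p : (forall j, (N <= j)%N -> (q j p <= 0)%E) -> (N <= M)%N -> tail N p = tail M p.
  move=> h NM; apply/eqP; rewrite eq_le; apply/andP; split.
    by apply: le_ereal_inf => _ [n /= Mn <-]; exists n => //=; exact: leq_trans Mn.
  apply: le_ereal_inf_tmp => _ [n /= Nn <-]; apply: (@le_trans _ _ (psum (maxn n M) p)).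
    by apply: ereal_inf_lbound; exists (maxn n M) => //=; exact: leq_maxr.
  by apply: psum_dec h _ _ Nn _; exact: leq_maxl.
have [Nf hN] : exists Nf, forall p, W p -> \forall y \near p,
    forall j, (Nf p <= j)%N -> (q j y <= 0)%E.
  have /choice [Nf h] : forall p, exists N, W p -> \forall y \near p,
      forall j, (N <= j)%N -> (q j y <= 0)%E.
    by move=> p; have [/ev [N hN]|nW] := pselect (W p); [exists N|exists 0%N].
  by exists Nf.
pose v p := tail (Nf p) p.
have vE p N : W p -> (forall j, (N <= j)%N -> (q j p <= 0)%E) -> v p = tail N p.
  move=> Wp h; rewrite /v (tailE _ (maxn (Nf p) N)) ?leq_maxl //; last first.
    exact: nbhs_singleton (hN p Wp).
  by rewrite -(tailE N) ?leq_maxr.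
exists v; last first.
  move=> p N Wp h; rewrite (vE p N) //; split => [n Nn|c hc].
    by apply: ereal_inf_lbound; exists n.
  by apply: le_ereal_inf_tmp => _ [n Nn <-]; exact: hc.
apply: (gpsh_local lines_cont) => p Wp; pose N := Nf p.
have := open_nbhs_nbhs (conj oW Wp); have := hN p Wp; rewrite -/N => h1 h2.
have [B [oB Bp] Bh] : exists2 B, open_nbhs p B &
    B `<=` (fun y => forall j, (N <= j)%N -> (q j y <= 0)%E) `&` W.
  have := @filterI _ (nbhs p) (nbhs_filter p) _ _ h1 h2; rewrite nbhsE => h.
  exact h.
have BW : B `<=` W by move=> y /Bh [].
exists B, (tail N); split => //; last first.
  by move=> y By; apply: vE; [exact: BW|have [] := Bh y By].
apply: (gpsh_decr lines_cont lines_aff (u := fun n => psum (N + n))) => //.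
- by move=> n; apply: gpsh_sub (gpsh_psum _).
- move=> n y By; have [h _] := Bh y By; apply: psum_dec h _ _ _ _; first by rewrite leq_addr.
  by rewrite leq_add2l.
- by move=> n y By; apply: ereal_inf_lbound; exists (N + n)%N => //=; rewrite leq_addr.
move=> y c By /ereal_inf_lt [_ [n /= Nn <-]] h; exists (n - N)%N; by rewrite subnKC.
Qed.

End Series.

(** A barrier of a set containing [z0] cannot stay above [- eta] at [z0]. So [A] without [z0] is
    exhausted by the compact sets [s / (k + 1) <= |z - z0| <= s], whose barriers are added with
    losses [eta / 2 ^ (k + 1)] at [z0]. *)
Lemma polar_thin A z0 (s eta : RR) : 0 < s -> 0 < eta -> locally_polar A ->
  closed (A `&` [set z | cabs (z - z0) <= s]) ->
  exists phi, [/\ sbh [set z | cabs (z - z0) < 2 * s] phi,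
    forall z, cabs (z - z0) < 2 * s -> (phi z <= 0)%E, ((- eta)%:E <= phi z0)%E &
    forall z, A z -> z != z0 -> cabs (z - z0) <= s -> (phi z <= (- 2)%:E)%E].
Proof.
move=> s0 eta0 pA cA.
have s2 : 0 < 2 * s by rewrite mulr_gt0.
have /choice [q hq] : forall k : nat, exists q,
  [/\ sbh [set z | cabs (z - z0) < 2 * s] q,
    forall z, cabs (z - z0) < 2 * s -> (q z <= 0)%E, ((- (eta / 2 ^+ k.+1))%:E <= q z0)%E &
    forall z, A z -> s / k.+1%:R <= cabs (z - z0) -> cabs (z - z0) <= s -> (q z <= (- 2)%:E)%E].
  move=> k; pose K := A `&` [set z | cabs (z - z0) <= s] `&` [set z | s / k.+1%:R <= cabs (z - z0)].
  have cK : compact K.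
    apply: (@subclosed_compact _ _ [set z | cabs (z - z0) <= s]).
    - apply: closedI => //; rewrite -openC (_ : ~` _ = [set z | cabs (z - z0) < s / k.+1%:R]).
        exact: open_cball.
      by apply/seteqP; split => z /=; rewrite ltNge => /negP.
    - exact: (@compact_disc z0 s).
    - by move=> z [[]].
  have pK : locally_polar K.
    move=> b [[Ab _] _]; have [r r0 [p [h1 h2 h3]]] := pA b Ab; exists r => //; exists p.
    by split => // z zb [[Az _] _]; exact: h3.
  have nK : ~ K z0.
    by move=> [_] /=; rewrite subrr cabs0 leNgt divr_gt0.
  have z02 : cabs (z0 - z0) < 2 * s by rewrite subrr cabs0.
  have K2 z : K z -> cabs (z - z0) < 2 * s by move=> [[_ /= zs] _]; rlra.
  have e0 : 0 < eta / 2 ^+ k.+1 by rewrite divr_gt0 // exprn_gt0.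
  have [q [h1 h2 [G [oG KG h3]] h4]] := polar_barrier cK pK K2 z02 nK e0.
  exists q; split => //; first exact: nbhs_singleton h4.
  by move=> z Az z1 z2; apply: h3; [exact: KG|rlra].
have oB := @open_cball z0 (2 * s).
have hs n : sbh [set z | cabs (z - z0) < 2 * s] (q n) by have [] := hq n.
have q0 n z : cabs (z - z0) < 2 * s -> (q n z <= 0)%E by have [_ h _ _] := hq n; exact: h.
have [|phi hphi phiP] := gpsh_series line1_cont line1_aff oB hs.
  move=> p Bp; exists 0%N; apply: filterS (open_nbhs_nbhs (conj oB Bp)) => y By j _.
  exact: q0.
have B0 : cabs (z0 - z0) < 2 * s by rewrite subrr cabs0.
exists phi; split => //.
- move=> z Bz; have [h _] := phiP z 0%N Bz (fun j _ => q0 j z Bz).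
  by have := h 0%N isT; rewrite /psum big_ord0.
- have [_ h] := phiP z0 0%N B0 (fun j _ => q0 j z0 B0); apply: h => n _.
  apply: (@le_trans _ _ (- (eta * (1 - (2 ^+ n)^-1)))%:E).
    rewrite lee_fin lerN2 ler_piMr ?ltW // lerBlDr lerDl invr_ge0 exprn_ge0 //.
  elim: n => [|n IH]; first by rewrite expr0 invr1 subrr mulr0 oppr0 /psum big_ord0.
  rewrite psumS; have [_ _ h2 _] := hq n; apply: le_trans (leeD IH h2).
  rewrite -EFinD lee_fin le_eqVlt; apply/orP; left; apply/eqP.
  by rewrite exprS; field; rewrite expf_neq0.
move=> z Az zz0 zs; have z1 : 0 < cabs (z - z0) by rewrite cabs_gt0 subr_eq0.
have Bz : cabs (z - z0) < 2 * s by rlra.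
pose k := Num.truncn (s / cabs (z - z0)).
have hk : s / k.+1%:R <= cabs (z - z0).
  rewrite ler_pdivrMr // mulrC -ler_pdivrMr // ltW //.
  by have := truncnS_gt (s / cabs (z - z0)).
have [h _] := phiP z 0%N Bz (fun j _ => q0 j z Bz); apply: le_trans (h k.+1 isT) _.
rewrite psumS -[leRHS]add0e; apply: leeD; last by have [_ _ _ h4] := hq k; exact: h4.
by have := psum_dec (fun j _ => q0 j z Bz) (leqnn 0) (leq0n k); rewrite /psum big_ord0.
Qed.

(** * The case where the sets [{|f| >= R}] are not thin *)

(* [inf] of the empty set is [0]; hence [exh D z = cabs z] when [D] is the whole plane. *)
Definition dst (S : set CC) (z : CC) : RR := inf [set cabs (z - k) | k in S].

Section Distance.
Variable S : set CC.
Implicit Types z y : CC.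

Lemma dst_le z k : S k -> dst S z <= cabs (z - k).
Proof. by move=> Sk; apply: ge_inf; [exists 0 => _ [y _ <-]; exact: cabs_ge0|exists k]. Qed.

Lemma dst_glb z (r : RR) : S !=set0 -> (forall k, S k -> r <= cabs (z - k)) -> r <= dst S z.
Proof. by move=> [k Sk] h; apply: lb_le_inf; [exists (cabs (z - k)), k|move=> _ [y Sy <-]; exact: h]. Qed.

Lemma dst_ge0 z : 0 <= dst S z.
Proof.
have [S0|nS] := pselect (S !=set0); first by apply: dst_glb => // k _; exact: cabs_ge0.
rewrite /dst (_ : [set _ | _ in S] = set0) ?inf0 //.
by rewrite -subset0 => ? [k Sk _]; apply: nS; exists k.
Qed.

Lemma dst_lip z y : dst S z <= dst S y + cabs (y - z).
Proof.
have [S0|nS] := pselect (S !=set0).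
  rewrite -lerBlDr; apply: dst_glb => // k Sk; rewrite lerBlDr.
  apply: le_trans (dst_le _ Sk) _.
  by have := cabsD (z - y) (y - k); rewrite subrKA (cabs_sub z y); rlra.
have E0 x : dst S x = 0.
  rewrite /dst (_ : [set _ | _ in S] = set0) ?inf0 //.
  by rewrite -subset0 => ? [k Sk _]; apply: nS; exists k.
by rewrite !E0 add0r cabs_ge0.
Qed.

Lemma ccont_dst z : ccont (dst S) z.
Proof.
move=> e e0; exists e => // y yz; rewrite ltr_norml.
have h1 := dst_lip y z; have h2 := dst_lip z y; rewrite (cabs_sub z y) in h1.
by rsplit.
Qed.

End Distance.

Lemma compact_dst_lt (K G : set CC) : compact K -> open G -> K `<=` G ->
  exists2 d : RR, 0 < d & forall k z, K k -> cabs (z - k) < d -> G z.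
Proof.
move=> cK oG KG.
have : \forall n \near \oo, K `<=` [set k | forall z, cabs (z - k) < n.+1%:R^-1 -> G z].
  move: cK => /compact_near_coveringP; apply => x Kx.
  have /= [r r0 hr] := (openCE G).1 oG x (KG x Kx).
  have r2 : 0 < r / 2 by rewrite divr_gt0.
  exists ([set y | cabs (y - x) < r / 2], [set n : nat | n.+1%:R^-1 < r / 2 :> RR]).
    split; first by apply/nbhsCE; exists (r / 2).
    by have := near_infty_natSinv_lt (PosNum r2).
  move=> [y n] /= [yx nr] z zy; apply: hr.
  have h1 := lt_trans zy nr.
  by have := cabsD (z - y) (y - x); rewrite subrKA; rlra.
move=> [N _ /(_ N (leqnn N)) h].
by exists N.+1%:R^-1 => [|k z /h]; [rewrite invr_gt0|exact].
Qed.

Lemma ccont_inv q z : ccont q z -> 0 < q z -> ccont (fun y => (q y)^-1) z.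
Proof.
move=> cq q0 e e0.
have e1 : 0 < Num.min (q z / 2) (e * q z ^+ 2 / 2).
  by rewrite lt_min !divr_gt0 // mulr_gt0 // exprn_gt0.
have [d d0 hd] := cq _ e1; exists d => // y /hd; rewrite lt_min => /andP[y1 y2].
have qy : q z / 2 < q y by move: y1; rewrite ltr_norml => /andP[? _]; rlra.
have qy0 : 0 < q y by apply: lt_trans qy; rewrite divr_gt0.
rewrite (_ : _ - _ = (q z - q y) / (q y * q z)); last by field; rewrite !gt_eqF.
rewrite normrM normfV distrC (gtr0_norm (mulr_gt0 qy0 q0)) ltr_pdivrMr ?mulr_gt0 //.
apply: lt_le_trans y2 _.
rewrite (_ : e * q z ^+ 2 / 2 = e * (q z / 2 * q z)); last by field.
by rewrite ler_pM2l // ler_pM2r // ltW.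
Qed.

(** A subharmonic exhaustion function of [D]: the inverse of the distance to the complement is the
    supremum of [|1 / (z - k)|] over [k] outside [D]. *)
Definition exh (D : set CC) (z : CC) : RR := cabs z + (dst (~` D) z)^-1.

Section Exhaustion.
Variable D : set CC.
Hypothesis oD : open D.

Lemma dst_gt0 z : D z -> ~` D !=set0 -> 0 < dst (~` D) z.
Proof.
move=> Dz ne; have /= [r r0 hr] := (openCE D).1 oD z Dz.
apply: lt_le_trans r0 _; apply: dst_glb => // k nDk; rewrite leNgt; apply/negP => h.
by apply: nDk; apply: hr; rewrite cabs_sub.
Qed.

Lemma dst_set0 z : ~ (~` D !=set0) -> dst (~` D) z = 0.
Proof.
move=> ne; rewrite /dst (_ : [set _ | _ in ~` D] = set0) ?inf0 //.
by rewrite -subset0 => ? [k Sk _]; apply: ne; exists k.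
Qed.

Lemma ccont_exh z : D z -> ccont (exh D) z.
Proof.
move=> Dz; apply: ccontD; first exact: ccont_cabs.
have [ne|ne] := pselect (~` D !=set0); last first.
  have -> : (fun y => (dst (~` D) y)^-1) = fun=> 0.
    by apply/funext => y; rewrite dst_set0 // invr0.
  exact: ccont_cst.
by apply: ccont_inv; [exact: ccont_dst|exact: dst_gt0].
Qed.

Lemma smv_cabs F (d : RR) : 0 < d -> (forall z, cabs z < d -> exists l, cdiff F z l) ->
  forall r, 0 < r -> r < d -> ctest (fun l => (cabs (F l))%:E) r (cabs (F 0))%:E.
Proof.
move=> d0 hF r r0 rd P hP.
have cF0 := cabs_ge0 (F 0).
have [F0|F0] := eqVneq (F 0) 0.
  rewrite F0 cabs0 lee_fin.
  have : complex.Re (- P).[0] <= 0.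
    apply: (hol_max r0); first exact: hol_poly.
    move=> l /hP; rewrite lte_fin hornerN cReN; have := cabs_ge0 (F l); rlra.
  by rewrite hornerN cReN; rlra.
have c0 : 0 < cabs (F 0) by rewrite cabs_gt0.
(* A unimodular factor with [c * F 0 = |F 0|]; it reduces the claim to the real part of a
   holomorphic function. *)
pose c := (F 0)^* / (cabs (F 0))%:C.
have c1 : cabs c = 1.
  rewrite /c cabsM cabsV cabs_real ger0_norm //.
  have -> : cabs (F 0)^* = cabs (F 0).
    apply/eqP; rewrite -(@eqrXn2 _ 2) ?cabs_ge0 // !cabs_sqr.
    by case: (F 0) => a b /=; rewrite sqrrN.
  by rewrite divff // gt_eqF.
have cF : c * F 0 = (cabs (F 0))%:C.
  rewrite /c mulrAC (mulrC _^* ) mulc_conj -[_ ^+ 2]/(_ * _) rmorphM mulfK //.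
  by rewrite (inj_eq (@complexI RR)) gt_eqF.
have : complex.Re (c * F 0 - P.[0]) <= 0.
  apply: (hol_max (F := fun l => c * F l - P.[l]) r0).
    move=> z zr; have zd : cabs z < d by rewrite subr0 in zr; exact: le_lt_trans rd.
    have [l hl] := hF z zd; have [m hm] := cdiff_poly P z; eexists.
    exact: cdiffB (cdiffM (cdiff_cst c z) hl) hm.
  move=> l /hP; rewrite lte_fin cReD cReN => h.
  have := le_trans (ler_norm _) (Re_le_cabs (c * F l)); rewrite cabsM c1 mul1r; rlra.
by rewrite cReD cReN cF lee_fin /=; rlra.
Qed.

Lemma sbh_exh : sbh D (fun z => (exh D z)%:E).
Proof.
apply: sbh_ccont => // [z Dz|a Da]; first exact: ccont_exh.
have -> : (fun l => (exh D (a + l))%:E) =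
    fun l => ((cabs (a + l))%:E + ((dst (~` D) (a + l))^-1)%:E)%E by [].
have hA : smv (fun l => (cabs (a + l))%:E).
  exists 1 => // r r0 r1; rewrite addr0.
  have := @smv_cabs (fun l => a + l) 1 ltr01; rewrite addr0; apply => // z _.
  by eexists; apply: cdiffD; [exact: cdiff_cst|exact: cdiff_id].
have [ne|ne] := pselect (~` D !=set0); last first.
  apply: (smv_local ltr01) hA => l _.
  by rewrite dst_set0 // invr0 adde0.
have /= [d d0 hd] := (openCE D).1 oD a Da.
have inD l : cabs l < d -> D (a + l) by move=> ld; apply: hd; rewrite addrC addKr.
have cd l : cabs l < d -> ccont (fun y => (dst (~` D) (a + y))^-1) l.
  move=> ld; apply: ccont_inv; last exact: dst_gt0 (inD _ ld) ne.
  move=> e e0; have [t t0 ht] := @ccont_dst (~` D) (a + l) e e0; exists t => // y yl.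
  by apply: ht; rewrite (_ : a + y - (a + l) = y - l) //; ring.
have ca l : ccont (fun y => cabs (a + y)) l.
  move=> e e0; exists e => // y; apply: le_lt_trans; apply: le_trans (cabs_dist _ _) _.
  by rewrite (_ : a + y - (a + l) = y - l) //; ring.
apply: (smvD d0) => //.
- by apply: ccont_usc => z _; exact: ca.
- by apply: ccont_usc => z; exact: cd.
- by move=> l _; rewrite ltry.
- by move=> l _; rewrite ltry.
exists d => // r r0 rd P hP; rewrite addr0 lee_fin.
have key k : (~` D) k -> (cabs (a - k))^-1 <= complex.Re P.[0].
  move=> nDk; have nz l : cabs l < d -> a + l != k.
    by move=> /inD Dl; apply/eqP => E; apply: nDk; rewrite -E.
  have := @smv_cabs (fun l => (a + l - k)^-1) d d0; rewrite addr0 cabsV.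
  move=> H; have {}H := H _ r r0 rd P; rewrite -lee_fin; apply: H.
    move=> z /nz zk; have [l hl] := cdiff_inv zk; eexists.
    exact: cdiff_comp (cdiffD (cdiff_cst a z) (cdiff_id z)) hl.
  move=> l Sl; apply: le_lt_trans (hP l Sl); have lr : cabs l < d by rewrite (Sl : cabs l = r).
  have pl : 0 < dst (~` D) (a + l) := dst_gt0 (inD _ lr) ne.
  rewrite lee_fin cabsV lef_pV2 ?posrE //; first exact: dst_le.
  by rewrite cabs_gt0 subr_eq0 nz.
have [k0 nk0] := ne; have ak k : (~` D) k -> 0 < cabs (a - k).
  by move=> nDk; rewrite cabs_gt0 subr_eq0; apply/eqP => E; apply: nDk; rewrite -E.
have P0 : 0 < complex.Re P.[0].
  by apply: lt_le_trans (key k0 nk0); rewrite invr_gt0 ak.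
have da := dst_gt0 Da ne.
rewrite invf_ple ?posrE //; apply: dst_glb => // k nDk.
by rewrite invf_ple ?posrE ?ak //; exact: key.
Qed.

Lemma exh_compact (c : RR) : compact [set z | D z /\ exh D z <= c].
Proof.
apply: (@compact_bounded_closed _ c); last first.
  move=> z [_]; apply: le_trans; rewrite lerDl invr_ge0; exact: dst_ge0.
rewrite -openC; apply/openCE => z /= nz.
have [Dz|nDz] := pselect (D z).
  have cz : 0 < exh D z - c.
    by rewrite subr_gt0 ltNge; apply/negP => h; apply: nz.
  have [d d0 hd] := ccont_exh Dz cz; exists d => // y /hd + [Dy].
  by rewrite ltr_norml => /andP[? _]; rlra.
have t0 : 0 < (`|c| + 1)^-1 by rewrite invr_gt0 ltr_wpDl.
exists (`|c| + 1)^-1 => // y yz [Dy]; apply/negP; rewrite -ltNge.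
have dy : 0 < dst (~` D) y by apply: dst_gt0 => //; exists z.
have : dst (~` D) y < (`|c| + 1)^-1 by apply: le_lt_trans yz; exact: dst_le.
have c1 : 0 < `|c| + 1 by rewrite ltr_wpDl.
rewrite invf_pgt ?posrE // => h.
by have := cabs_ge0 y; have := ler_norm c; rewrite /exh; rlra.
Qed.

End Exhaustion.

Lemma cont_fst : continuous (fst : CC * CC -> CC).
Proof. by move=> p V /nbhsCE [r r0 h]; apply/nbhsC2E; exists r => // y y1 _; exact: h. Qed.

Lemma cont_snd : continuous (snd : CC * CC -> CC).
Proof. by move=> p V /nbhsCE [r r0 h]; apply/nbhsC2E; exists r => // y _ y2; exact: h. Qed.

Lemma near_fst (p : CC * CC) (P : CC -> Prop) :
  (\forall z \near p.1, P z) -> \forall y \near p, P y.1.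
Proof. by move=> h; exact: (@cont_fst p P h). Qed.

Lemma gpsh_lnabs {T : topologicalType} (lines : (CC -> T) -> Prop) W (g : T -> CC) :
  open W ->
  (forall p, W p -> forall e : RR, 0 < e -> \forall y \near p, cabs (g y - g p) < e) ->
  (forall L, lines L -> W (L 0) -> exists2 rho : RR, 0 < rho &
     forall l, cabs l < rho -> exists m, cdiff (g \o L) l m) ->
  gpsh lines W (fun p => lnabs (g p)).
Proof.
move=> oW cg hg; split => //.
- by move=> p _; rewrite /lnabs; case: ifP => _; rewrite ?ltNyr ?ltry.
- apply: usc_on_of_rel => //; apply: lnabs_usc => p Wp e e0.
  by apply: filterS (cg p Wp e e0).
move=> L hL WL; have [rho rho0 h] := hg L hL WL; exists rho => // r r0 rr.
apply: ctest_lnabs => // z; rewrite subr0 => zr; apply: h; exact: le_lt_trans rr.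
Qed.

Lemma maxr_ge (T : realDomainType) (a b : T) : (a <= Num.max a b) * (b <= Num.max a b).
Proof. by rewrite !le_max !lexx orbT. Qed.

Section LogPlus.
Variable M : RR.
Hypothesis M1 : 1 <= M.
Let M0 : 0 < M. Proof. exact: lt_le_trans M1. Qed.

(* [log^+ (|w| / M)]. *)
Definition lp (w : CC) : RR := ln (Num.max 1 (cabs w / M)).

Lemma lp_max w : 1 <= Num.max 1 (cabs w / M). Proof. exact: (maxr_ge _ _).1. Qed.

Lemma lp_ge0 w : 0 <= lp w. Proof. by rewrite ln_ge0 // lp_max. Qed.

Lemma lp_eq0 w : cabs w <= M -> lp w = 0.
Proof. by move=> wM; rewrite /lp max_l ?ln1 // ler_pdivrMr // mul1r. Qed.

Lemma lp_ge1 w : expR 1 * M < cabs w -> 1 <= lp w.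
Proof.
move=> h; rewrite /lp -[leLHS](@expRK RR) ler_ln ?posrE ?expR_gt0 //.
  by rewrite le_max; apply/orP; right; rewrite ler_pdivlMr // ltW.
exact: lt_le_trans (lp_max w).
Qed.

Lemma lpE w : (lp w)%:E = maxe (lnabs (M^-1%:C * w)) 0%:E.
Proof.
have cE : cabs (M^-1%:C * w) = cabs w / M.
  by rewrite cabsM cabs_real ger0_norm ?invr_ge0 ?ltW // mulrC.
rewrite /lnabs; case: eqVneq => [E|ne].
  have : cabs w / M = 0 by rewrite -cE E cabs0.
  by rewrite /lp => ->; rewrite max_l // ln1 max_r // leNye.
have c0 : 0 < cabs w / M by rewrite -cE cabs_gt0.
rewrite cE /lp -EFin_max; congr _%:E.
have [h|h] := leP 1 (cabs w / M).
  by rewrite max_l // ln_ge0.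
by rewrite ln1 max_r // -ln1 ler_ln ?posrE // ltW.
Qed.

Lemma psh_lp W : open W -> gpsh line2 W (fun p : CC * CC => (lp p.2)%:E).
Proof.
move=> oW.
have -> : (fun p : CC * CC => (lp p.2)%:E) = fun p => maxe (lnabs (M^-1%:C * p.2)) 0%:E.
  by apply/funext => p; exact: lpE.
apply: gpsh_max; last exact: gpsh_cst.
have d (w : CC) : cdiff (fun y => M^-1%:C * y) w (0 * w + M^-1%:C * 1).
  by apply: cdiffM; [exact: cdiff_cst|exact: cdiff_id].
apply: gpsh_lnabs => // [p _ e e0|L [a [b ->]] _].
  have [t t0 ht] := cdiff_cont (d p.2) e0.
  by apply/nbhsC2E; exists t => // y _; exact: ht.
exists 1 => // l _; eexists; apply: cdiff_comp (d _).
by apply: cdiffD; [exact: cdiff_cst|apply: cdiffM; [exact: cdiff_id|exact: cdiff_cst]].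
Qed.

(** With [x = max 1 (|w| / M)], [|w - y| <= M x + C <= (M + C) x]. For [k <= 1] the growth in [w] of
    [k log |w - f z|] is therefore absorbed by the [lp] term of the floor. *)
Lemma lnabs_sub_le (C : RR) (w y : CC) : 0 <= C -> cabs y <= C ->
  (lnabs (w - y)%R <= (ln (M + C) + lp w)%R%:E)%E.
Proof.
move=> C0 yC; have mx := lp_max w; rewrite /lp; set x := Num.max _ _ in mx *.
have x0 : 0 < x by exact: lt_le_trans mx.
have MC : 0 < M + C by rewrite ltr_wpDr.
rewrite lnabs_leE expRD !lnK ?posrE //.
have h : cabs w <= M * x by rewrite mulrC -ler_pdivrMr // (maxr_ge _ _).2.
have : C <= C * x by rewrite ler_peMr.
by have := cabsD w (- y); rewrite cabsN mulrDl; rlra.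
Qed.

End LogPlus.

Lemma cdiff_bounded U f (K : set CC) : (forall z, U z -> exists l, cdiff f z l) ->
  compact K -> K `<=` U -> exists2 C : RR, 0 <= C & forall z, K z -> cabs (f z) <= C.
Proof.
move=> hf cK KU; have [K0|nK] := pselect (K !=set0); last first.
  by exists 0 => // z Kz; exfalso; apply: nK; exists z.
have [x Kx hx] : exists2 x, K x & forall y, K y -> ((cabs (f y))%:E <= (cabs (f x))%:E)%E.
  apply: (@usc_rel_max _ K (fun z => (cabs (f z))%:E)) => //.
  apply: ccont_usc => z /KU /hf [l hl] e e0; have [d d0 hd] := cdiff_cont hl e0.
  by exists d => // y /hd; apply: le_lt_trans; exact: cabs_dist.
by exists (cabs (f x)); [exact: cabs_ge0|move=> z /hx].
Qed.

Lemma ccont_near (q : CC -> RR) z (c : RR) : ccont q z -> q z < c -> \forall y \near z, q y < c.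
Proof.
move=> cq h; have e0 : 0 < c - q z by rewrite subr_gt0.
have [d d0 hd] := cq _ e0; apply/nbhsCE; exists d => // y /hd.
by rewrite ltr_norml => /andP[_ ?]; rlra.
Qed.

Lemma ccont_near_gt (q : CC -> RR) z (c : RR) : ccont q z -> c < q z -> \forall y \near z, c < q y.
Proof.
move=> cq h; have e0 : 0 < q z - c by rewrite subr_gt0.
have [d d0 hd] := cq _ e0; apply/nbhsCE; exists d => // y /hd.
by rewrite ltr_norml => /andP[? _]; rlra.
Qed.

(** * A competitor that is large over one point *)

Section Step.
Variables (D A : set CC) (f : CC -> CC) (z0 : CC).
Hypotheses (oD : open D) (AD : A `<=` D) (clA : D `&` closure A `<=` A) (pA : locally_polar A).
Hypothesis hf : forall z, (D `\` A) z -> exists l, cdiff f z l.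
Hypothesis Az0 : A z0.

Let W : set (CC * CC) := [set p | D p.1].

Lemma open_cylinder : open W.
Proof. by apply: (@open_comp _ _ fst D) => // x _; exact: cont_fst. Qed.
Let oW := open_cylinder.

Lemma compact_polar_part (c : RR) : compact [set z | A z /\ exh D z <= c].
Proof.
have -> : [set z | A z /\ exh D z <= c] = closure A `&` [set z | D z /\ exh D z <= c].
  apply/seteqP; split => [z [Az zc]|z [cz [Dz zc]]]; last by split => //; apply: clA.
  by split; [exact: subset_closure|split => //; exact: AD].
by rewrite setIC; apply: compact_closedI; [exact: exh_compact|exact: closed_closure].
Qed.

Variables (m M : RR).
Hypothesis M1 : 1 <= M.

Definition floorf (p : CC * CC) : RR := - 1 + lp M p.2 + 2 * Num.max 0 (exh D p.1 - m).

Lemma psh_floor : gpsh line2 W (fun p => (floorf p)%:E).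
Proof.
have -> : (fun p => (floorf p)%:E) = fun p : CC * CC => ((- 1)%:E + (lp M p.2)%:E +
    2%:E * maxe 0%:E ((exh D p.1)%:E + (- m)%:E))%E.
  by apply/funext => p; rewrite /floorf -EFinD -EFin_max -EFinM -!EFinD.
have l2 := line2_cont.
apply: (gpshD l2); first by apply: (gpshD l2); [exact: gpsh_cst|exact: psh_lp].
apply: gpsh_scale => //; apply: gpsh_max; first exact: gpsh_cst.
apply: (gpshD l2); last exact: gpsh_cst.
exact: (gpsh_pr cont_fst line2_fst (sbh_exh oD)).
Qed.

Lemma floorf_ge p : - 1 + lp M p.2 <= floorf p.
Proof. by rewrite /floorf lerDl mulr_ge0 // (maxr_ge _ _).1. Qed.

Lemma floorf_ge1 p : - 1 <= floorf p.
Proof. by apply: le_trans (floorf_ge p); rewrite lerDl lp_ge0. Qed.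

Lemma floorf_eq p : exh D p.1 <= m -> cabs p.2 <= M -> floorf p = - 1.
Proof. by move=> pm pM; rewrite /floorf lp_eq0 // max_l ?subr_le0 // mulr0 !addr0. Qed.

(* Near [A] the barrier [q <= - 2], and near [{E = m + 2}] the last term of the floor, keep
   [k log |w - f z| + q z] below the floor, so that the two can be glued. *)
Lemma psh_candidate x (eta : RR) : (D `\` A) x -> exh D x < m -> exh D z0 < m ->
  2 * expR 1 * M < cabs (f x) -> 0 < eta <= 1 ->
  exists v, [/\ gpsh line2 W v,
    forall p, W p -> ((floorf p)%:E <= v p)%E,
    forall p, W p -> exh D p.1 <= m -> cabs p.2 <= M -> (v p <= eta%:E)%E,
    forall z, (D `\` A) z -> (v (z, f z) <= (floorf (z, f z))%:E)%E &
    \forall z \near x, forall w, ((- eta)%:E <= v (z, w))%E].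
Proof.
move=> [Dx nAx] xm z0m fx /andP[eta0 eta1].
have M0 : 0 < M by exact: lt_le_trans M1.
(* The level [m + 3] leaves a margin beyond [m + 2], where the gluing ends, so that all points of
   [A] met below lie in [K]. *)
pose K := [set z | A z /\ exh D z <= m + 3].
have cK : compact K by exact: compact_polar_part.
have Kz0 : K z0 by split => //; rlra.
have pK : locally_polar K.
  move=> b [Ab _]; have [r r0 [p [h1 h2 h3]]] := pA Ab; exists r => //; exists p.
  by split => // z zb [Az _]; exact: h3.
have exle z : cabs z <= exh D z by rewrite lerDl invr_ge0 dst_ge0.
have Om z : exh D z <= m + 3 -> cabs (z - 0) < m + 4.
  by have := exle z; rewrite subr0; rlra.
have [q [hq q0 [G [oG KG qG]] qx]] := polar_barrier cK pK (fun z Kz => Om z Kz.2)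
  (Om x (ltac:(rlra))) (fun Kx => nAx Kx.1) eta0.
have [d d0 hd] := compact_dst_lt cK oG KG.
have d20 : 0 < d / 2 by rewrite divr_gt0.
have qd z : exh D z <= m + 3 -> dst K z < d -> (q z <= (- 2)%:E)%E.
  move=> zm zd; apply: qG; last exact: Om.
  have [_ [k Kk <-] kd] := inf_lt (ex_intro _ (cabs (z - z0)) (ex_intro2 _ _ z0 Kz0 erefl)) zd.
  exact: hd Kk kd.
pose O1 := [set z | [/\ D z, exh D z < m + 2 & d / 2 < dst K z]].
have oO1 : open O1.
  rewrite openE => z [Dz zm zd]; rewrite /interior.
  apply: filterS3 (open_nbhs_nbhs (conj oD Dz)) (ccont_near (ccont_exh oD Dz) zm)
    (ccont_near_gt (ccont_dst K z) zd) => y h1 h2 h3; by split.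
have O1A z : O1 z -> (D `\` A) z.
  move=> [Dz zm zd]; split => // Az.
  have Kz : K z by split => //; rlra.
  by have := dst_le z Kz; rewrite subrr cabs0; rlra.
pose Z := [set z | D z /\ exh D z <= m + 2] `&` [set z | d / 2 <= dst K z].
have cZ : compact Z.
  apply: compact_closedI; first exact: exh_compact.
  rewrite -openC openE => z /negP; rewrite -ltNge => zd.
  by apply: filterS (ccont_near (ccont_dst K z) zd) => y h /=; apply/negP; rewrite -ltNge.
have ZA : Z `<=` D `\` A.
  move=> z [[Dz zm] zd]; split => // Az; have Kz : K z by split => //; rlra.
  by move: zd (dst_le z Kz); rewrite subrr cabs0 /=; rlra.
have [C C0 fC] := cdiff_bounded hf cZ ZA.
pose c := ln (M + C); have c0 : 0 <= c by rewrite ln_ge0 // ler_wpDr.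
(* [k <= 1] lets the floor absorb the logarithmic growth, and [k c <= eta / 2] makes the remaining
   constant harmless. *)
have [k k0 [k1 kc]] : exists2 k : RR, 0 < k & k <= 1 /\ k * c <= eta / 2.
  exists (eta / (2 * (c + 1))); first by rewrite divr_gt0 // mulr_gt0 // ltr_wpDl.
  have c1 : 0 < 2 * (c + 1) by rewrite mulr_gt0 // ltr_wpDl.
  split; first by rewrite ler_pdivrMr //; rlra.
  by rewrite mulrAC ler_pdivrMr //; rnra.
pose t (p : CC * CC) := (k%:E * lnabs (p.2 - f p.1)%R + q p.1)%E.
have tle p : O1 p.1 -> (t p <= (eta / 2 + lp M p.2)%R%:E + q p.1)%E.
  move=> Op; apply: leeD => //.
  have Zp : Z p.1 by move: Op => [Dp pm pd]; do !split => //=; exact: ltW.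
  apply: (@le_trans _ _ (k%:E * (c + lp M p.2)%R%:E)%E).
    by rewrite lee_pmul2l ?lte_fin //; apply: lnabs_sub_le => //; exact: fC.
  rewrite -EFinM lee_fin mulrDr; apply: lerD => //.
  by rewrite ler_piMl // lp_ge0.
have O1Om z : O1 z -> cabs (z - 0) < m + 4 by move=> [_ h _]; apply: Om; rlra.
have hF := psh_floor.
have oO : open [set p : CC * CC | O1 p.1].
  by apply: (@open_comp _ _ fst O1) => // y _; exact: cont_fst.
have ht : gpsh line2 (W `&` [set p | O1 p.1]) t.
  have oWO := openI oW oO.
  apply: (gpshD line2_cont); last first.
    apply: gpsh_sub (gpsh_pr cont_fst line2_fst hq) => //.
    by move=> p [_ Op]; exact: O1Om.
  apply: gpsh_scale => //; apply: gpsh_lnabs => //.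
    move=> p [Wp Op] e e0; have [l hl] := hf (O1A _ Op).
    have e2 : 0 < e / 2 by rewrite divr_gt0.
    have [r r0 hr] := cdiff_cont hl e2.
    apply/nbhsC2E; exists (Num.min r (e / 2)); first by rewrite lt_min r0.
    move=> y; rewrite !lt_min => /andP[/hr y1 _] /andP[_ y2].
    rewrite (_ : _ - _ = (y.2 - p.2) + - (f y.1 - f p.1)); last ring.
    by apply: le_lt_trans (cabsD _ _) _; rewrite cabsN; rlra.
  move=> L hL WL; have [r r0 hr] := line_near line2_cont hL oWO WL.
  exists r => // l /hr [_]; have [a [b ->]] := hL; rewrite /= => /O1A /hf [n hn].
  have aff (u v : CC) : cdiff (fun y => u + y * v) l (0 + (1 * v + l * 0)).
    by apply: cdiffD; [exact: cdiff_cst|apply: cdiffM; [exact: cdiff_id|exact: cdiff_cst]].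
  by eexists; apply: cdiffB (aff _ _) _; exact: cdiff_comp (aff _ _) hn.
have q0' z : O1 z -> (q z <= 0)%E by move=> Oz; apply: q0; exact: O1Om.
have lim p : W p -> ~ [set p | O1 p.1] p -> forall b : RR, ((floorf p)%:E < b%:E)%E ->
    \forall y \near p, [set p | O1 p.1] y -> (t y < b%:E)%E.
  move=> Wp nO b Fb; have [_ _ uF _] := hF; have nF := uF p Wp b Fb.
  suff : \forall z \near p.1, O1 z -> forall w, (t (z, w) <= (floorf (z, w))%:E)%E.
    move=> /near_fst h; apply: filterS2 h nF => -[z w] /= h1 h2 Oz.
    exact: le_lt_trans (h1 Oz w) h2.
  (* Near [K] the barrier gives [eta / 2 - 2 <= - 1]. Beyond [exh D z = m + 1] the last term of the
     floor exceeds 2, and [- 1 + 2 >= eta / 2]. *)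
  have [pm|mp] := ltP (exh D p.1) (m + 2).
    have pd : dst K p.1 < d.
      rewrite ltNge; apply/negP => h; apply: nO; split => //; rlra.
    apply: filterS (ccont_near (ccont_dst K p.1) pd) => z zd Oz w.
    apply: le_trans (tle (z, w) Oz) _.
    have zm : exh D z <= m + 3 by case: Oz => _ h _; rlra.
    apply: le_trans (leeD (lexx _) (qd z zm zd)) _.
    by rewrite -EFinD lee_fin; have := floorf_ge (z, w); rewrite /=; rlra.
  have mp1 : m + 1 < exh D p.1 by rlra.
  apply: filterS (ccont_near_gt (ccont_exh oD Wp) mp1) => z zm Oz w.
  apply: le_trans (tle (z, w) Oz) _; apply: le_trans (leeD (lexx _) (q0' z Oz)) _.
  rewrite adde0 lee_fin /floorf /=.
  have : exh D z - m <= Num.max 0 (exh D z - m) := (maxr_ge _ _).2.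
  by rlra.
have hv := gpsh_glue line2_cont oO hF ht lim.
set v := (fun p => _) in hv; exists v; split => //.
- by move=> p _; rewrite /v; case: pselect => //= _; rewrite le_max lexx.
- move=> p Wp pm pM; rewrite /v (floorf_eq pm pM); case: pselect => //= [Op|_]; last first.
    by rewrite lee_fin; rlra.
  rewrite ge_max lee_fin; apply/andP; split; first by rlra.
  apply: le_trans (tle p Op) _; apply: le_trans (leeD (lexx _) (q0' _ Op)) _.
  by rewrite adde0 lee_fin lp_eq0 //; rlra.
- move=> z _; rewrite /v; case: pselect => //= Oz; rewrite ge_max lexx /= /t /=.
  rewrite subrr /lnabs eqxx gt0_muleNy ?lte_fin //.
  by have := q0' z Oz; case: (q z) => [b| |] //= _; rewrite leNye.
have Ox : O1 x.
  split => //; first by rlra.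
  rewrite ltNge; apply/negP => h.
  have := le_trans (nbhs_singleton qx) (qd x (ltac:(rlra)) (ltac:(rlra))).
  by rewrite lee_fin; rlra.
have [l hl] := hf (conj Dx nAx).
have cfx : ccont (fun z => cabs (f z)) x.
  move=> e e0; have [r r0 hr] := cdiff_cont hl e0; exists r => // y /hr.
  by apply: le_lt_trans; exact: cabs_dist.
have n1 := ccont_near_gt cfx fx.
apply: filterS3 (open_nbhs_nbhs (conj oO1 Ox)) n1 qx => z Oz fz qz w.
rewrite /v; case: pselect => //= _; rewrite le_max.
(* Origin of the threshold [2 e M]: if [|w| <= e M] then [|w - f z| >= e M >= 1] and the logarithm
   is nonnegative; otherwise [lp M w >= 1] and the floor is nonnegative. *)
have [wM|wM] := leP (cabs w) (expR 1 * M).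
  apply/orP; right; rewrite /t /= -[leLHS]add0e; apply: leeD => //.
  apply: mule_ge0; first by rewrite lee_fin ltW.
  rewrite -[0%E]/(0%:E) lnabs_geE expR0.
  have e1 : 1 <= expR 1 * M by rewrite mulr_ege1 //; have := @expR_ge1Dx RR 1; rlra.
  by have := cabs_dist w (f z); have := cabsD (f z - w) w; rewrite subrK (cabs_sub (f z) w); rlra.
apply/orP; left; rewrite lee_fin; have := floorf_ge (z, w); have := lp_ge1 M1 wM.
by rewrite /=; rlra.
Qed.

End Step.

Lemma compactN (K : set CC) z : compact K -> ~ K z ->
  exists2 r : RR, 0 < r & forall y, cabs (y - z) < r -> ~ K y.
Proof.
move=> cK nK; have cl : closed K by apply: compact_closed cK; exact: (@norm_hausdorff CC CC^o).
by have /= := (openCE _).1 (closed_openC cl) z nK.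
Qed.

(** * The envelope at [z0] and the series *)

Section NonThin.
Variables (D A : set CC) (f : CC -> CC) (z0 : CC).
Hypotheses (oD : open D) (AD : A `<=` D) (clA : D `&` closure A `<=` A) (pA : locally_polar A).
Hypothesis hf : forall z, (D `\` A) z -> exists l, cdiff f z l.
Hypothesis Az0 : A z0.
Hypothesis nonthin : forall R : RR, 0 < R -> ~ thin [set z | (D `\` A) z /\ R%:C <= `|f z|] z0.

Let W : set (CC * CC) := [set p | D p.1].
Let Dz0 : D z0 := AD Az0.

(* Perron's method on the functions [z |-> inf_w v (z, w)]. *)
Lemma psh_step (m M eps : RR) (L : set CC) : exh D z0 < m -> 0 < eps <= 1 -> compact L ->
  L `<=` D `\` A -> (forall z, L z -> exh D z <= m) ->
  exists v, [/\ gpsh line2 W v,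
    forall p, W p -> exh D p.1 <= m -> cabs p.2 <= M -> (v p <= eps%:E)%E,
    forall z, L z -> (v (z, f z) <= (- 1)%:E)%E & forall w, ((- eps)%:E <= v (z0, w))%E].
Proof.
move=> z0m /andP[eps0 eps1] cL LA Lm.
have [C C0 fC] := cdiff_bounded hf cL LA.
(* [M'] also dominates [f] on [L], so the part of the graph above [L] lies where the floor is
   [- 1]. *)
have [M' [M1 MM CM]] : exists M' : RR, [/\ 1 <= M', M <= M' & C <= M'].
  by exists (Num.max 1 (Num.max M C)); rewrite !le_max !lexx !orbT.
have [s s0 hs] : exists2 s : RR, 0 < s &
    forall z, cabs (z - z0) < s -> [/\ D z, exh D z < m & ~ L z].
  have [s1 s10 h1] := compactN cL (fun Lz => (LA _ Lz).2 Az0).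
  have /nbhsCE [s2 s20 h2] := ccont_near (ccont_exh oD Dz0) z0m.
  have /= [s3 s30 h3] := (openCE D).1 oD z0 Dz0.
  exists (Num.min s1 (Num.min s2 s3)); first by rewrite !lt_min s10 s20.
  by move=> z; rewrite !lt_min => /andP[? /andP[? ?]]; split; [exact: h3|exact: h2|exact: h1].
pose B := [set z | cabs (z - z0) < s].
have oB : open B by exact: open_cball.
pose good v := [/\ gpsh line2 W v,
    forall p, W p -> exh D p.1 <= m -> cabs p.2 <= M' -> (v p <= eps%:E)%E &
    forall z, L z -> (v (z, f z) <= (- 1)%:E)%E].
pose Fam : set (CC -> \bar RR) := [set mf | lsc_on B mf /\
  exists2 v, good v & forall z w, B z -> (mf z <= v (z, w))%E].
have goodF : good (fun p => (floorf D m M' p)%:E).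
  split; first exact: psh_floor.
    by move=> p _ pm pM; rewrite floorf_eq // lee_fin; rlra.
  move=> z Lz; rewrite floorf_eq //=; first exact: Lm.
  exact: le_trans (fC z Lz) CM.
have Fam1 : Fam (fun=> (- 1)%:E).
  split; first by move=> z _ c h; apply: filterE.
  by exists (fun p => (floorf D m M' p)%:E) => // z w _; rewrite lee_fin; exact: floorf_ge1.
pose g x := ereal_sup [set mf x | mf in Fam].
have hg : sbh B (fun x => - g x)%E.
  apply: perron => //.
  - by move=> mf [].
  - move=> m1 m2 [l1 [v1 [h1 b1 L1] mv1]] [l2 [v2 [h2 b2 L2] mv2]].
    exists (fun z => maxe (m1 z) (m2 z)) => //; split.
      move=> z Bz c; rewrite lt_max => /orP[/(l1 z Bz)|/(l2 z Bz)];
      by apply: filterS => y h; rewrite lt_max h ?orbT.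
    exists (fun p => maxe (v1 p) (v2 p)).
      split; first exact: gpsh_max.
        by move=> p Wp pm pM; rewrite ge_max b1 ?b2.
      by move=> z Lz; rewrite ge_max L1 ?L2.
    by move=> z w Bz; rewrite ge_max !le_max mv1 // mv2 // orbT.
  - by move=> z _; exists (fun=> (- 1)%:E) => //; rewrite ltNyr.
  move=> mf b r P [lm [v [hv bv Lv] mv]] r0 inB hm.
  (* A minorant bounds all values over its fibre, in particular at [w = 0], where competitors are at
     most [eps]. Hence gluing [P] in does not break that bound. *)
  have P0 l : cabs l <= r -> complex.Re P.[l] <= eps.
    apply: poly_max_disc => // l' Sl.
    have Bl : B (b + l') by apply: inB; rewrite (Sl : cabs l' = r).
    have [Dl lm' _] := hs _ Bl.
    have v0 : (v ((b + l')%R, 0%R) <= eps%:E)%E.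
      by apply: bv => //=; [exact: ltW|rewrite cabs0; exact: le_trans M1].
    have := lt_le_trans (hm l' Sl) (le_trans (mv _ 0 Bl) v0).
    by rewrite lte_fin => /ltW.
  exists (fun z => if pselect (cabs (z - b) < r) then maxe (mf z) (complex.Re P.[z - b])%:E
     else mf z); last first.
    by case: pselect => /= [_|[]]; rewrite subrr ?cabs0 // le_max lexx orbT.
  split.
    move=> z Bz c; case: pselect => /= [zr|nzr].
      have n1 : \forall y \near z, cabs (y - b) < r.
        by apply: open_nbhs_nbhs; split => //; exact: open_cball.
      rewrite lt_max => /orP[/(lm z Bz)|].
        by apply: filterS2 n1 => y yr my; case: pselect => //= _; rewrite lt_max my.
      rewrite lte_fin => cP.
      have cc : ccont (fun y => complex.Re P.[y - b]) z.
        move=> e e0; have [d d0 hd] := @ccont_poly P (z - b) e e0; exists d => // y yd.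
        by apply: hd; rewrite (_ : y - b - (z - b) = y - z) //; ring.
      apply: filterS2 n1 (ccont_near_gt cc cP) => y yr yc; case: pselect => //= _.
      by rewrite lt_max lte_fin yc orbT.
    by move=> /(lm z Bz); apply: filterS => y my; case: pselect => //= _; rewrite lt_max my.
  exists (fun p : CC * CC => if pselect (cabs (p.1 - b) < r)
     then maxe (v p) (complex.Re P.[p.1 - b])%:E else v p); last first.
    by move=> z w Bz; case: pselect => //= _; rewrite ?ge_max ?le_max ?mv ?lexx ?orbT.
  split.
  - apply: (gpsh_glue_disc line2_cont cont_fst line2_fst) => //.
    move=> [z w] Wz /= zr; have Bz : B z.
      by have := inB (z - b); rewrite subrKC; apply; rewrite zr.
    have := hm (z - b) zr; rewrite subrKC => /ltW h; exact: le_trans h (mv z w Bz).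
  - move=> p Wp pm pM; case: pselect => /= [zr|_]; last exact: bv.
    by rewrite ge_max bv // lee_fin P0 // ltW.
  - move=> z Lz; case: pselect => /= [zr|_]; last exact: Lv.
    exfalso; have := inB (z - b) (ltW zr); rewrite subrKC => /hs [_ _]; exact.
have Bz0 : B z0 by rewrite /B /= subrr cabs0.
(* The competitor of [psh_candidate] is certified by a lower semicontinuous step function:
   [- eps / 2] near [x], and the lower bound [- 1] of the floor elsewhere. *)
have cand x : B x -> (D `\` A) x -> 2 * expR 1 * M' < cabs (f x) ->
    (- g x <= (eps / 2)%:E)%E.
  move=> Bx DAx fx; have [Dx xm _] := hs x Bx.
  have e2 : 0 < eps / 2 <= 1 by rsplit.
  have [v [hv Fv bv Lv xv]] := psh_candidate oD AD clA pA hf Az0 M1 DAx xm z0m fx e2.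
  have M'0 : 0 < M' by exact: lt_le_trans M1.
  have gv : good v.
    split => //.
      move=> p Wp pm pM; apply: le_trans (bv p Wp pm pM) _.
      by rewrite lee_fin; rlra.
    move=> z Lz; apply: le_trans (Lv z (LA z Lz)) _.
    by rewrite floorf_eq //=; [exact: Lm|exact: le_trans (fC z Lz) CM].
  move/nbhsCE: xv => [r r0 hr].
  pose mf z : \bar RR := if pselect (cabs (z - x) < r) then (- (eps / 2))%:E else (- 1)%:E.
  rewrite leeNl -EFinN; apply: (@le_trans _ _ (mf x)).
    by rewrite /mf; case: pselect => //=; rewrite subrr cabs0.
  apply: ereal_sup_ubound; exists mf => //; split.
    move=> z Bz c; rewrite {1}/mf; case: pselect => /= [zr|_] h.
      have n1 : \forall y \near z, cabs (y - x) < r.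
        by apply: open_nbhs_nbhs; split => //; exact: open_cball.
      by apply: filterS n1 => y yr; rewrite /mf; case: pselect.
    apply: filterE => y; apply: lt_le_trans h _; rewrite /mf; case: pselect => //= _.
    by rewrite lee_fin; rlra.
  exists v => // z w Bz; have [Dz _ _] := hs z Bz; rewrite /mf; case: pselect => /= [zr|_].
    exact: hr.
  apply: le_trans (Fv (z, w) Dz); rewrite lee_fin; exact: floorf_ge1.
(* Were [- g z0] larger than [eps / 2], the subharmonic function [- g], at most [eps / 2] where
   [|f|] is large, would show that set to be thin at [z0]. *)
have gz0 : (- g z0 <= (eps / 2)%:E)%E.
  rewrite leNgt; apply/negP => lt.
  pose R := 2 * expR 1 * M' + 1.
  have R0 : 0 < R by rewrite ltr_wpDl // !mulr_ge0 ?expR_ge0 //; exact: le_trans M1.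
  apply: (nonthin R0); right; exists B, (fun x => - g x)%E; split => //.
    exact/subharmonicP.
  apply: le_lt_trans lt; apply: (@le_trans _ _ (ereal_sup
     ((fun x => - g x)%E @` [set z | B z /\ (D `\` A) z /\ R%:C <= `|f z|]))).
    apply: ereal_inf_lbound; eexists; last by [].
    rewrite /= /within /=; apply: filterS (open_nbhs_nbhs (conj oB Bz0)) => z Bz [Sz _].
    by [].
  apply: ge_ereal_sup => _ [z [Bz [DAz Rz]] <-]; apply: cand => //.
  by move: Rz; rewrite cabsE lecR /R; rlra.
have : ((- eps)%:E < g z0)%E.
  rewrite -lteN2; apply: le_lt_trans gz0 _; rewrite -EFinN opprK lte_fin; rlra.
move=> /ereal_sup_gt [_ [mf [lm [v [hv bv Lv] mv]] <-] hm].
exists v; split => //.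
  by move=> p Wp pm pM; apply: bv => //; exact: le_trans MM.
by move=> w; apply: ltW; exact: lt_le_trans hm (mv _ w Bz0).
Qed.

(** The terms are [v j - 2 ^ (- j)]. Each point of the cylinder eventually enters the sets where
    they are nonpositive; on the graph they are eventually at most [- 1], so the sum is [-oo]; above
    [z0] they are at least [- 2 * 2 ^ (- j)], so the sum is at least [- 4]. *)
Lemma hull_fibre_empty w0 : ~ pluripolar_hull (graph D A f) [set p | D p.1] (z0, w0).
Proof.
move=> [_ hull].
pose mm (j : nat) : RR := exh D z0 + j.+1%:R.
pose L (j : nat) := [set z | D z /\ exh D z <= mm j] `&` [set z | j.+1%:R^-1 <= dst A z].
have cL j : compact (L j).
  apply: compact_closedI; first exact: exh_compact.
  rewrite -openC openE => z /negP; rewrite -ltNge => zd.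
  by apply: filterS (ccont_near (ccont_dst A z) zd) => y h /=; apply/negP; rewrite -ltNge.
have LA j : L j `<=` D `\` A.
  move=> z [[Dz _] /= zd]; split => // Az; have := dst_le z Az.
  by rewrite subrr cabs0 leNgt => /negP; apply; apply: lt_le_trans zd; rewrite invr_gt0.
pose eps (j : nat) : RR := (2 ^+ j)^-1.
have eps0 j : 0 < eps j by rewrite invr_gt0 exprn_gt0.
have /choice [v hv] : forall j : nat, exists v, [/\ gpsh line2 W v,
    forall p, W p -> exh D p.1 <= mm j -> cabs p.2 <= j%:R -> (v p <= (eps j)%:E)%E,
    forall z, L j z -> (v (z, f z) <= (- 1)%:E)%E & forall w, ((- eps j)%:E <= v (z0, w))%E].
  move=> j; apply: psh_step => //.
  - by rewrite ltrDl.
  - by rewrite eps0 /eps invf_le1 ?exprn_gt0 // exprn_ege1 // ler1n.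
  - by move=> z [[]].
pose q j p := (v j p + (- eps j)%:E)%E.
have oW : open W := open_cylinder oD.
have hq j : gpsh line2 W (q j).
  by have [h _ _ _] := hv j; apply: (gpshD line2_cont h); exact: gpsh_cst.
have q0 p N : W p -> exh D p.1 <= mm N -> cabs p.2 <= N%:R ->
    forall j, (N <= j)%N -> (q j p <= 0)%E.
  move=> Wp pm pN j Nj; have [_ h _ _] := hv j.
  rewrite /q EFinN sube_le0; apply: h => //.
    by apply: le_trans pm _; rewrite /mm lerD2l ler_nat.
  by apply: le_trans pN _; rewrite ler_nat.
have exN (x y : RR) : exists N : nat, x < exh D z0 + N.+1%:R /\ y < N%:R.
  pose z := Num.max (x - exh D z0) y.
  exists (Num.truncn z).+1; have := truncnS_gt z; rewrite gt_max => /andP[h1 h2].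
  have : (Num.truncn z).+1%:R <= (Num.truncn z).+2%:R :> RR by rewrite ler_nat.
  by split; lra.
have [|u hu uP] := gpsh_series line2_cont line2_aff oW hq.
  move=> p Wp; have [N [N1 N2]] := exN (exh D p.1) (cabs p.2); exists N.
  have n1 := near_fst (ccont_near (ccont_exh oD Wp) N1).
  have n2 : \forall y \near p, cabs y.2 < N%:R.
    have := ccont_near (@ccont_cabs p.2) N2; exact: (@cont_snd p).
  apply: filterS3 n1 n2 (open_nbhs_nbhs (conj oW Wp)) => y y1 y2 Wy.
  by apply: q0 => //; exact: ltW.
have hpsh : psh_on [set p | D p.1] u by exact/pshP.
have uNy p : graph D A f p -> u p = -oo%E.
  case: p => z w [/= DAz ->]; have [Dz nAz] := DAz.
  have dz : 0 < dst A z.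
    have nc : (~` closure A) z by move=> cz; apply: nAz; apply: clA.
    have /= [r r0 hr] := (openCE _).1 (closed_openC (@closed_closure _ A)) z nc.
    apply: lt_le_trans r0 _; apply: dst_glb; first by exists z0.
    move=> k Ak; rewrite leNgt; apply/negP => h; apply: (hr k).
      by rewrite cabs_sub.
    exact: subset_closure.
  have [N [N1 N2]] := exN (exh D z) (Num.max (cabs (f z)) (dst A z)^-1).
  move: N2; rewrite gt_max => /andP[N2 N3].
  have LN j : (N <= j)%N -> L j z.
    move=> Nj; split; first by split => //; apply: (le_trans (ltW N1)); rewrite lerD2l ler_nat.
    rewrite /= invf_ple ?posrE //; apply: le_trans (ltW N3) _; rewrite ler_nat; exact: leq_trans Nj _.
  have qN := q0 (z, f z) N Dz (ltW N1) (ltW N2).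
  have q1 j : (N <= j)%N -> (q j (z, f z) <= (- 1)%:E)%E.
    move=> Nj; have [_ _ h _] := hv j.
    rewrite /q -[leRHS]adde0; apply: leeD; first by apply: h; exact: LN.
    by rewrite lee_fin oppr_le0 ltW.
  have [h _] := uP (z, f z) N Dz qN.
  have sN i : (psum q (N + i) (z, f z) <= psum q N (z, f z) + (- i%:R)%:E)%E.
    elim: i => [|i IH]; first by rewrite addn0 oppr0 adde0.
    rewrite addnS psumS -natr1 opprD EFinD [leRHS]addeA; apply: leeD => //.
    by apply: q1; rewrite leq_addr.
  have fin : (psum q N (z, f z) < +oo)%E.
    by have [_ h' _ _] := gpsh_psum line2_cont oW hq N; exact: h'.
  apply: ereal_eqNy => K.
  have [a Sa] : exists a : RR, (psum q N (z, f z) <= a%:E)%E.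
    by move: fin; case: psum => [a| |] // _; [exists a|exists 0; rewrite leNye].
  pose i := (Num.truncn `|a - K|).+1.
  apply: le_trans (h (N + i)%N (leq_addr _ _)) _; apply: le_trans (sN i) _.
  apply: le_trans (leeD Sa (lexx _)) _; rewrite -EFinD lee_fin.
  have := truncnS_gt `|a - K|; have := ler_norm (a - K); rewrite -/i; lra.
have uz0 := hull u hpsh uNy.
have [N [N1 N2]] := exN (exh D z0) (cabs w0).
have [_ h] := uP (z0, w0) N Dz0 (q0 (z0, w0) N Dz0 (ltW N1) (ltW N2)).
have : ((- 4)%:E <= u (z0, w0))%E.
  apply: h => n _; apply: (@le_trans _ _ (- (4 * (1 - (2 ^+ n)^-1)))%:E).
    have : 0 <= (2 ^+ n)^-1 :> RR by rewrite invr_ge0 exprn_ge0.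
    by rewrite lee_fin; lra.
  elim: n => [|n IH]; first by rewrite expr0 invr1 subrr mulr0 oppr0 /psum big_ord0.
  rewrite psumS; have [_ _ _ h2] := hv n.
  have h3 : ((- (2 * eps n))%:E <= q n (z0, w0))%E.
    rewrite /q (_ : - (2 * eps n) = - eps n + - eps n); last ring.
    by rewrite EFinD; apply: leeD.
  apply: le_trans (leeD IH h3); rewrite -EFinD lee_fin /eps exprS invfM.
  by lra.
by rewrite uz0 leNgt ltNyr.
Qed.

End NonThin.

Lemma usc_near_lt U u z (c : RR) : usc_on U u -> U z -> (u z < c%:E)%E ->
  exists2 d : RR, 0 < d & forall y, cabs (y - z) < d -> (u y < c%:E)%E.
Proof. by move=> hu Uz h; apply/nbhsCE; exact: hu. Qed.

(** * The case where some set [{|f| >= R}] is thin *)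

Section FineTopology.
Variables (z0 : CC) (s : RR) (phi : CC -> \bar RR).
Hypotheses (s0 : 0 < s) (hphi : sbh [set z | cabs (z - z0) < s] phi) (phi0 : phi z0 = 0%E).
Let B := [set z | cabs (z - z0) < s].

Lemma fine_centre : B z0. Proof. by rewrite /B /= subrr cabs0. Qed.
Let Bz0 := fine_centre.

Lemma phi_small (e : RR) : 0 < e -> exists2 d : RR, 0 < d <= s &
  forall y, cabs (y - z0) < d -> (phi y < e%:E)%E.
Proof.
move=> e0; have [_ _ hu _] := hphi.
have [|d d0 hd] := usc_near_lt (c := e) hu Bz0; first by rewrite phi0 lte_fin.
exists (Num.min d s); first by rewrite lt_min d0 s0 ge_min lexx orbT.
by move=> y; rewrite lt_min => /andP[/hd].
Qed.

(* The complement of a fine neighbourhood [{phi > - th}] is too thin to affect the value of a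
   subharmonic function at [z0]: penalise [G] by a large multiple of [phi]. *)
Lemma fine_ub G (b : RR) : sbh B G -> (exists2 th : RR, 0 < th & exists2 d : RR, 0 < d &
    forall z, z != z0 -> cabs (z - z0) < d -> ((- th)%:E < phi z)%E -> (G z <= b%:E)%E) ->
  (G z0 <= b%:E)%E.
Proof.
move=> hG [th th0 [d d0 hd]]; have [oB Gy Gu _] := hG.
have [C [bC GC]] : exists C : RR, b < C /\ (G z0 < C%:E)%E.
  have := Gy z0 Bz0; case: (G z0) => [a| |] // _; last first.
    by exists (b + 1); rewrite ltNyr; split => //; rlra.
  exists (Num.max a b + 1); rewrite lte_fin.
  by have [h1 h2] := maxr_ge a b; split; rlra.
have [d1 d10 h1] := usc_near_lt Gu Bz0 GC.
(* Where [phi <= - th], [G + N phi <= C - N th = b]; elsewhere on a small circle [N phi] is less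
   than [e / 2]. *)
have [N N0 NE] : exists2 N : RR, 0 < N & N * th = C - b.
  by exists ((C - b) / th); [rewrite divr_gt0 // subr_gt0|rewrite divfK // gt_eqF].
apply/lee_addgt0Pr => e e0; have e2 : 0 < e / (2 * N) by rewrite divr_gt0 // mulr_gt0.
have [d2 /andP[d20 d2s] h2] := phi_small e2.
have [r r0 [rd rd1 rd2]] : exists2 r : RR, 0 < r & [/\ r < d, r < d1 & r < d2].
  exists (Num.min d (Num.min d1 d2) / 2).
    by rewrite divr_gt0 // !lt_min d0 d10.
  have m1 : Num.min d (Num.min d1 d2) <= d by rewrite ge_min lexx.
  have m2 : Num.min d (Num.min d1 d2) <= d1 by rewrite !ge_min lexx !orbT.
  have m3 : Num.min d (Num.min d1 d2) <= d2 by rewrite !ge_min lexx !orbT.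
  have m0 : 0 < Num.min d (Num.min d1 d2) by rewrite !lt_min d0 d10.
  by split; rlra.
have hH := gpshD line1_cont hG (gpsh_scale N0 hphi).
have inB l : cabs l <= r -> B (z0 + l).
  by move=> lr; rewrite /B /= addrC addKr; apply: le_lt_trans lr _; rlra.
have ct := sbh_ctest hH r0 inB; have {ct} := ct (b + e)%:C%:P; rewrite phi0 mule0 adde0 hornerC /= -EFinD; apply => l Sl.
have lr : cabs l = r by [].
have El : z0 + l - z0 = l by rewrite addrC addKr.
have lz : z0 + l != z0 by rewrite -subr_eq0 El -cabs_gt0 lr.
rewrite hornerC /=.
have g1 := h1 (z0 + l); rewrite El lr in g1; have {}g1 := g1 rd1.
have g2 := h2 (z0 + l); rewrite El lr in g2; have {}g2 := g2 rd2.
have [big|small] := ltP (- th)%:E (phi (z0 + l)).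
  have := hd (z0 + l) lz; rewrite El lr => /(_ rd big).
  move: g2 big; case: (phi (z0 + l)) => [x| |] //; rewrite lte_fin => xe _ Gb.
  apply: le_lt_trans (leeD Gb (lexx _)) _; rewrite -EFinM -EFinD lte_fin.
  have : N * x < e / 2.
    by move: xe; rewrite ltr_pdivlMr ?mulr_gt0 //; rlra.
  by rlra.
have sm : (N%:E * phi (z0 + l)%R <= (b - C)%:E)%E.
  rewrite (_ : (b - C)%:E = N%:E * (- th)%:E)%E; first by rewrite lee_pmul2l ?lte_fin.
  by rewrite -EFinM mulrN NE opprB.
apply: le_lt_trans (leeD (ltW g1) sm) _.
by rewrite -EFinD lte_fin; rlra.
Qed.

End FineTopology.

(** If [limsup u < b < a = u z0] along [S], take [2 (u - a) / (a - b)]; if [S] does not accumulate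
    at [z0], the zero function on a small disc will do. *)
Lemma thin_witness S z0 : thin S z0 -> exists2 s : RR, 0 < s & exists phi,
  [/\ sbh [set z | cabs (z - z0) < s] phi, phi z0 = 0%E &
      forall z, S z -> z != z0 -> cabs (z - z0) < s -> (phi z <= (- 2)%:E)%E].
Proof.
case=> [nacc|[V [u [oV Vz0 /subharmonicP hu lim]]]].
  have [V [/nbhsCE [s s0 sV] hV]] : exists V, nbhs z0 V /\ forall y, y != z0 -> S y -> ~ V y.
    apply: contrapT => h; apply: nacc => V nV; apply: contrapT => h2; apply: h.
    by exists V; split => // y yz Sy Vy; apply: h2; exists y.
  exists s => //; exists (fun=> 0%:E); split => //; first by apply: gpsh_cst; exact: open_cball.
  by move=> z Sz zz0 /sV Vz; exfalso; exact: hV z zz0 Sz Vz.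
have [_ uy _ _] := hu.
have [a ua] : exists a : RR, u z0 = a%:E.
  move: lim (uy z0 Vz0); case: (u z0) => [a| |] //; first by exists a.
  by rewrite ltNge leNye.
move: lim; rewrite ua => /ereal_inf_lt [_ [Q nQ <-] /lt_ereal_between [b Qb ba]].
have /nbhsCE [s1 s10 h1] : nbhs z0 (fun z => (S `\ z0) z -> Q z) := nQ.
have /= [s2 s20 h2] := (openCE V).1 oV z0 Vz0.
have k0 : 0 < 2 / (a - b) by rewrite divr_gt0 // subr_gt0.
exists (Num.min s1 s2); first by rewrite lt_min s10.
exists (fun z => (2 / (a - b))%:E * (u z + (- a)%:E))%E; split.
- apply: gpsh_scale => //; have oB := @open_cball z0 (Num.min s1 s2).
  apply: (gpshD line1_cont); last exact: gpsh_cst.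
  by apply: gpsh_sub hu => // z /=; rewrite lt_min => /andP[_ /h2].
- by rewrite ua -EFinD subrr mule0.
move=> z Sz zz0; rewrite lt_min => /andP[/h1 zQ _].
have {zQ} Qz : Q z by apply: zQ; split => //= E; rewrite E eqxx in zz0.
have ub : (u z <= b%:E)%E.
  by apply/ltW; apply: le_lt_trans Qb; apply: ereal_sup_ubound; exists z.
apply: (@le_trans _ _ ((2 / (a - b))%:E * (b%:E + (- a)%:E))%E).
  by rewrite lee_pmul2l ?lte_fin //; apply: leeD.
rewrite -EFinD -EFinM lee_fin -(opprB a b) mulrN divfK // gt_eqF // subr_gt0 //.
Qed.

(** The witness [p1] for [S] is added to the function [p2] of [polar_thin], and [v = p2 z0], between
    [- 1 / 4] and [0], is subtracted. With [p1 < 1 / 2] and [p2 <= 0] the sum is below 1, and the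
    bounds [- 2] leave at most [- 1] on both sets. *)
Lemma thin_union A S z0 (t : RR) : 0 < t -> locally_polar A ->
  closed (A `&` [set z | cabs (z - z0) <= t]) -> thin S z0 ->
  exists2 s : RR, 0 < s <= t & exists phi,
  [/\ sbh [set z | cabs (z - z0) < s] phi, phi z0 = 0%E,
      forall z, cabs (z - z0) < s -> (phi z <= 1%:E)%E &
      forall z, A z \/ S z -> z != z0 -> cabs (z - z0) < s -> (phi z <= (- 1)%:E)%E].
Proof.
move=> t0 pA cA /thin_witness [s1 s10 [p1 [hp1 p10 p1S]]].
have q0 : 0 < 1 / 4 :> RR by rewrite divr_gt0.
have [p2 [hp2 p2y p20 p2A]] := polar_thin t0 q0 pA cA.
have [s2 /andP[s20 s21] p1small] := phi_small s10 hp1 p10 (ltr01 : 0 < 1 :> RR).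
have e2 : 0 < 1 / 2 :> RR by rewrite divr_gt0.
have [s3 /andP[s30 s31] p1h] := phi_small s10 hp1 p10 e2.
have z02 : cabs (z0 - z0) < 2 * t by rewrite subrr cabs0 mulr_gt0.
have [v vE] : exists v : RR, p2 z0 = v%:E.
  by move: p20 (p2y z0 z02); case: (p2 z0) => [v| |] //; exists v.
rewrite vE lee_fin in p20; have := p2y z0 z02; rewrite vE lee_fin => v0.
exists (Num.min s3 t); first by rewrite lt_min s30 t0 ge_min lexx orbT.
have oB := @open_cball z0 (Num.min s3 t).
have sub1 z : cabs (z - z0) < Num.min s3 t -> cabs (z - z0) < s1.
  by rewrite lt_min => /andP[h _]; exact: lt_le_trans s31.
have sub2 z : cabs (z - z0) < Num.min s3 t -> cabs (z - z0) < 2 * t.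
  by rewrite lt_min => /andP[_ h]; rlra.
exists (fun z => p1 z + p2 z + (- v)%:E)%E; split.
- apply: (gpshD line1_cont); last exact: gpsh_cst.
  by apply: (gpshD line1_cont); [exact: gpsh_sub hp1|exact: gpsh_sub hp2].
- by rewrite p10 vE add0e -EFinD subrr.
- move=> z zs; have h1 : (p1 z <= (1 / 2)%:E)%E.
    by apply: ltW; apply: p1h; move: zs; rewrite lt_min => /andP[].
  apply: le_trans (leeD (leeD h1 (p2y z (sub2 z zs))) (lexx _)) _.
  by rewrite adde0 -EFinD lee_fin; rlra.
move=> z ASz zz0 zs; case: ASz => [Az|Sz].
  have h1 : (p1 z <= (1 / 2)%:E)%E.
    by apply: ltW; apply: p1h; move: zs; rewrite lt_min => /andP[].
  have h2 : (p2 z <= (- 2)%:E)%E.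
    by apply: p2A => //; apply: ltW; move: zs; rewrite lt_min => /andP[].
  apply: le_trans (leeD (leeD h1 h2) (lexx _)) _.
  by rewrite -!EFinD lee_fin; rlra.
apply: le_trans (leeD (leeD (p1S z Sz zz0 (sub1 z zs)) (p2y z (sub2 z zs))) (lexx _)) _.
by rewrite adde0 -EFinD lee_fin; rlra.
Qed.

Lemma sbh_Re U f : open U -> (forall z, U z -> exists l, cdiff f z l) ->
  sbh U (fun z => (complex.Re (f z))%:E).
Proof.
move=> oU hf; apply: sbh_ccont => // z Uz; first by have [l hl] := hf z Uz; exact: ccont_Re hl.
have /= [d d0 hd] := (openCE U).1 oU z Uz; exists d => // r r0 rd Q hQ.
have := @hol_max (fun l => f (z + l) - Q.[l]) r 0 r0; rewrite addr0 cReD cReN lee_fin subr_le0.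
apply.
  move=> y; rewrite subr0 => yr.
  have [|l hl] := hf (z + y); first by apply: hd; rewrite addrC addKr; exact: le_lt_trans rd.
  have [m hm] := cdiff_poly Q y; eexists; apply: cdiffB hm.
  exact: cdiff_comp (cdiffD (cdiff_cst z y) (cdiff_id y)) hl.
by move=> l /hQ; rewrite lte_fin cReD cReN; rlra.
Qed.

Lemma sbh_lnabs U z0 : open U -> sbh U (fun z => lnabs (z - z0)).
Proof.
move=> oU.
have d z : cdiff (fun y => y - z0) z (1 - 0) by apply: cdiffB; [exact: cdiff_id|exact: cdiff_cst].
apply: gpsh_lnabs => //.
  move=> p _ e e0; have [t t0 ht] := cdiff_cont (d p) e0.
  by apply/nbhsCE; exists t.
move=> L [a [b ->]] _; exists 1 => // l _; eexists; apply: cdiff_comp (d _).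
by apply: cdiffD; [exact: cdiff_cst|apply: cdiffM; [exact: cdiff_id|exact: cdiff_cst]].
Qed.

Lemma locally_polar1 z0 : locally_polar [set z0].
Proof.
move=> _ ->; exists 1 => //; exists (fun z => lnabs (z - z0)); split.
- by apply: sbh_lnabs; exact: open_cball.
- have E : z0 + (1 / 2)%:C - z0 = (1 / 2)%:C by rewrite addrC addKr.
  have c2 : cabs (1 / 2)%:C = 1 / 2 by rewrite cabs_real ger0_norm //; lra.
  exists (z0 + (1 / 2)%:C); rewrite E ?c2; first by lra.
  by rewrite /lnabs ifN // -cabs_gt0 c2; lra.
- by move=> z _ ->; rewrite subrr /lnabs eqxx.
Qed.

Section FineLimit.
Variables (U : set CC) (f : CC -> CC) (z0 : CC) (s R : RR) (phi : CC -> \bar RR).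
Hypotheses (oU : open U) (hf : forall z, U z -> exists l, cdiff f z l).
Hypotheses (s0 : 0 < s) (R0 : 0 < R) (hphi : sbh [set z | cabs (z - z0) < s] phi).
Hypotheses (phi0 : phi z0 = 0%E) (phi1 : forall z, cabs (z - z0) < s -> (phi z <= 1%:E)%E).
Hypothesis phiN : forall z, cabs (z - z0) < s -> z != z0 -> ~ (U z /\ cabs (f z) < R) ->
  (phi z <= (- 1)%:E)%E.
Let B := [set z | cabs (z - z0) < s].
Let Bz0 : B z0. Proof. exact: fine_centre. Qed.
Variables K T : RR.
Hypotheses (KE : K = 8 * R + 1) (TE : T = R + K / 2).

(* [Re (c f) + K phi] is glued to the constant [- T], which dominates it where [phi <= - 1]; this
   is what the values of [K] and [T] are for. *)
Lemma fine_ext (c : CC) : cabs c <= 1 -> exists H, [/\ sbh B H,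
  forall z, B z -> z != z0 -> ((- (1 / 2))%:E < phi z)%E ->
    H z = ((complex.Re (c * f z))%:E + K%:E * phi z)%E &
  forall z, B z -> z != z0 -> ((- T)%:E <= H z)%E].
Proof.
move=> c1; have K0 : 0 < K by have := R0; rewrite KE; lra.
have [R0' KE' TE'] : [/\ 0 < R, K = 8 * R + 1 & T = R + K / 2] by [].
have oB : open B by exact: open_cball.
pose O1 := [set z | U z /\ cabs (f z) < R].
have cf z : U z -> ccont (fun y => cabs (f y)) z.
  move=> /hf [l hl] e e0; have [r r0 hr] := cdiff_cont hl e0; exists r => // y /hr.
  by apply: le_lt_trans; exact: cabs_dist.
have oO : open O1.
  rewrite openE => z [Uz fz]; rewrite /interior.
  by apply: filterS2 (open_nbhs_nbhs (conj oU Uz)) (ccont_near (cf z Uz) fz) => y; split.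
have oW : open (B `\` [set z0]).
  apply: openI => //; apply: closed_openC; apply: compact_closed (@compact_set1 _ z0).
  exact: (@norm_hausdorff CC CC^o).
pose t z := ((complex.Re (c * f z))%:E + K%:E * phi z)%E.
have ht : sbh ((B `\` [set z0]) `&` O1) t.
  have oWO := openI oW oO; apply: (gpshD line1_cont).
    apply: sbh_Re => // z [_ [Uz _]]; have [l hl] := hf Uz; eexists.
    exact: cdiffM (cdiff_cst c z) hl.
  by apply: gpsh_scale => //; apply: gpsh_sub hphi => // z [[]].
have hT : sbh (B `\` [set z0]) (fun=> (- T)%:E) by exact: gpsh_cst.
have Ref y : O1 y -> `|complex.Re (c * f y)| <= R.
  move=> [_ fy]; apply: le_trans (Re_le_cabs _) _; rewrite cabsM.
  apply: le_trans (ltW fy); apply: ler_piMl => //; exact: cabs_ge0.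
have lim p : (B `\` [set z0]) p -> ~ O1 p -> forall b : RR, ((- T)%:E < b%:E)%E ->
    \forall y \near p, O1 y -> (t y < b%:E)%E.
  move=> [Bp pz0] nO b; rewrite lte_fin => Tb; have [_ _ hu _] := hphi.
  have pz : p != z0 by apply/eqP.
  (* With [K > 8 R], [phi < - 3 / 4] gives [R + K phi < - R - K / 2 = - T], as gluing requires.
     Where [phi > - 1 / 2], conversely, [- R + K phi > - T], so that [t] wins the maximum. *)
  have : (phi p < (- (3 / 4))%:E)%E.
    by apply: le_lt_trans (phiN Bp pz nO) _; rewrite lte_fin; lra.
  move=> /(hu p Bp); apply: filterS => y py Oy.
  have h := ler_normlW (Ref y Oy).
  rewrite /t; move: py; case: (phi y) => [x| |] // py; last first.
    by rewrite gt0_muleNy ?lte_fin // addeNy ltNyr.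
  rewrite -EFinM -EFinD lte_fin; rewrite lte_fin in py.
  have : K * x < K * - (3 / 4) by rewrite ltr_pM2l.
  by lra.
have hv := gpsh_glue line1_cont oO hT ht lim; set v := (fun p => _) in hv.
have v1 z : (B `\` [set z0]) z -> (v z <= (R + K)%:E)%E.
  move=> [Bz _]; rewrite /v; case: pselect => /= [Oz|_]; last by rewrite lee_fin; lra.
  rewrite ge_max; apply/andP; split; first by rewrite lee_fin; lra.
  rewrite EFinD; apply: leeD; first by rewrite lee_fin; exact: ler_normlW (Ref z Oz).
  by rewrite -[leRHS]mule1 lee_pmul2l ?lte_fin //; exact: phi1.
have [H [hH HE _]] := polar_removable oB (@locally_polar1 z0) hv v1.
exists H; split => //.
  move=> z Bz zz0 pz; rewrite HE; last by split => //; apply/eqP.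
  rewrite /v; case: pselect => /= [Oz|nO]; last first.
    by exfalso; have := lt_le_trans pz (phiN Bz zz0 nO); rewrite lte_fin; lra.
  rewrite max_r //; apply: (@le_trans _ _ ((- R)%:E + K%:E * (- (1 / 2))%:E)%E).
    by rewrite -EFinM -EFinD lee_fin; lra.
  apply: leeD; first by rewrite lee_fin; have := Ref z Oz; rewrite ler_norml => /andP[].
  by rewrite lee_pmul2l ?lte_fin // ltW.
move=> z Bz zz0; rewrite HE; last by split => //; apply/eqP.
by rewrite /v; case: pselect => //= _; rewrite le_max lexx.
Qed.

(** By upper semicontinuity, the value [-oo] at [z0] would force values below [- T - 1] at nearby
    points, where [H >= - T]. *)
Lemma fine_ext_val H : sbh B H -> (forall z, B z -> z != z0 -> ((- T)%:E <= H z)%E) ->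
  exists a : RR, H z0 = a%:E.
Proof.
move=> [_ Hy Hu _] HT; case E : (H z0) => [a| |].
- by exists a.
- by have := Hy z0 Bz0; rewrite E.
have [|d d0 hd] := usc_near_lt (c := - T - 1) Hu Bz0; first by rewrite E ltNyr.
pose r := Num.min d s / 2.
have m0 : 0 < Num.min d s by rewrite lt_min d0.
have m1 : Num.min d s <= d by rewrite ge_min lexx.
have m2 : Num.min d s <= s by rewrite ge_min lexx orbT.
have r0 : 0 < r by rewrite /r; lra.
have cr : cabs (z0 + r%:C - z0) = r by rewrite addrC addKr cabs_real gtr0_norm.
have h1 : cabs (z0 + r%:C - z0) < d by rewrite cr /r; lra.
have h2 : B (z0 + r%:C) by rewrite /B /= cr /r; lra.
have h3 : z0 + r%:C != z0 by rewrite -subr_eq0 -cabs_gt0 cr.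
by have := le_lt_trans (HT _ h2 h3) (hd _ h1); rewrite lte_fin; lra.
Qed.

(** [H] and [H'] extend [K phi + Re (c f)] and [K phi - Re (c f)] across [z0]. Their sum is
    [2 K phi] in a fine neighbourhood, so [H z0 + H' z0 <= 0] by [fine_ub]; semicontinuity of both
    at [z0] then squeezes [Re (c f)] around [a = H z0]. *)
Lemma fine_lim_Re (c : CC) : cabs c <= 1 -> exists a : RR, forall e : RR, 0 < e ->
  exists2 th : RR, 0 < th & exists2 d : RR, 0 < d & forall z, z != z0 -> cabs (z - z0) < d ->
    ((- th)%:E < phi z)%E -> `|complex.Re (c * f z) - a| < e.
Proof.
move=> c1; have K0 : 0 < K by have := R0; rewrite KE; lra.
have [R0' KE' TE'] : [/\ 0 < R, K = 8 * R + 1 & T = R + K / 2] by [].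
have [H [hH HE HT]] := fine_ext c1.
have cN1 : cabs (- c) <= 1 by rewrite cabsN.
have [H' [hH' HE' HT']] := fine_ext cN1.
have [a Ha] := fine_ext_val hH HT; have [a' Ha'] := fine_ext_val hH' HT'.
have phiR z x : ((- x)%:E < phi z)%E -> B z -> exists2 y, phi z = y%:E & - x < y.
  move=> h /phi1; move: h; case: (phi z) => [y| |] //; first by rewrite lte_fin; exists y.
have aa' : a + a' <= 0.
  rewrite -lee_fin; apply/lee_addgt0Pr => e e0; rewrite add0e EFinD -Ha -Ha'.
  apply: (fine_ub s0 hphi phi0 (G := fun z => (H z + H' z)%E)); first exact: (gpshD line1_cont).
  exists (1 / 2); first by lra.
  have e2 : 0 < e / (2 * K) by rewrite divr_gt0 // mulr_gt0.
  have [d /andP[d0 ds] hd] := phi_small s0 hphi phi0 e2.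
  exists d => // z zz0 zd ph; have Bz : B z by exact: lt_le_trans ds.
  rewrite HE // HE' //; have [y yE _] := phiR z _ ph Bz.
  have := hd z zd; rewrite yE lte_fin ltr_pdivlMr ?mulr_gt0 // => h.
  by rewrite -!EFinM -!EFinD lee_fin mulNr cReN; lra.
exists a => e e0; have [_ _ Hu _] := hH; have [_ _ Hu' _] := hH'.
have [|d1 d10 h1] := usc_near_lt (c := a + e / 2) Hu Bz0; first by rewrite Ha lte_fin; lra.
have [|d2 d20 h2] := usc_near_lt (c := a' + e / 2) Hu' Bz0; first by rewrite Ha' lte_fin; lra.
have eK : 0 < e / (2 * K) by rewrite divr_gt0 // mulr_gt0.
exists (Num.min (1 / 2) (e / (2 * K))); first by rewrite lt_min eK andbT; lra.
exists (Num.min s (Num.min d1 d2)); first by rewrite !lt_min s0 d10.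
move=> z zz0; rewrite !lt_min => /andP[Bz /andP[zd1 zd2]] ph.
have [y yE yl] := phiR z _ ph Bz.
have y1 : - (1 / 2) < y by apply: le_lt_trans yl; rewrite lerN2 ge_min lexx.
have y2 : - (e / (2 * K)) < y by apply: le_lt_trans yl; rewrite lerN2 ge_min lexx orbT.
have ph2 : ((- (1 / 2))%:E < phi z)%E by rewrite yE lte_fin.
have := h1 z zd1; have := h2 z zd2; rewrite HE // HE' // yE -!EFinM -!EFinD !lte_fin.
have : - (e / 2) < K * y.
  rewrite (mulrC K) -ltr_pdivrMr //; apply: le_lt_trans y2; rewrite mulNr lerN2.
  by rewrite (_ : e / (2 * K) = e / 2 / K) //; field; rewrite gt_eqF.
by rewrite mulNr cReN ltr_norml => ? ? ?; apply/andP; split; lra.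
Qed.

Lemma fine_limit : exists2 w0 : CC, cabs w0 <= R & forall e : RR, 0 < e ->
  exists2 th : RR, 0 < th & exists2 d : RR, 0 < d & forall z, z != z0 -> cabs (z - z0) < d ->
    ((- th)%:E < phi z)%E -> U z /\ cabs (f z - w0) < e.
Proof.
have c1 : cabs 1 <= 1 by rewrite cabs1.
(* The factor [- i] turns the real part into the imaginary part of [f]. *)
have ci : cabs (Complex 0 (- 1)) <= 1.
  by rewrite -(@ler_pXn2r _ 2) ?nnegrE ?cabs_ge0 // cabs_sqr /=; lra.
have [a ha] := fine_lim_Re c1; have [b hb] := fine_lim_Re ci.
have main (e : RR) : 0 < e -> exists2 th : RR, 0 < th & exists2 d : RR, 0 < d &
    forall z, z != z0 -> cabs (z - z0) < d -> ((- th)%:E < phi z)%E ->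
    [/\ U z, cabs (f z) < R & cabs (f z - Complex a b) < e].
  move=> e0; have e2 : 0 < e / 2 by lra.
  have [t1 t10 [d1 d10 h1]] := ha _ e2; have [t2 t20 [d2 d20 h2]] := hb _ e2.
  exists (Num.min 1 (Num.min t1 t2)); first by rewrite !lt_min t10 ltr01.
  exists (Num.min s (Num.min d1 d2)); first by rewrite !lt_min s0 d10.
  move=> z zz0; rewrite !lt_min => /andP[zs /andP[zd1 zd2]] ph.
  have ph' x : Num.min 1 (Num.min t1 t2) <= x -> ((- x)%:E < phi z)%E.
    by move=> h; apply: le_lt_trans ph; rewrite lee_fin lerN2.
  have p0 : ((- 1)%:E < phi z)%E by apply: ph'; rewrite ge_min lexx.
  have p1 : ((- t1)%:E < phi z)%E by apply: ph'; rewrite !ge_min lexx !orbT.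
  have p2 : ((- t2)%:E < phi z)%E by apply: ph'; rewrite !ge_min lexx !orbT.
  have [Uz fz] : U z /\ cabs (f z) < R.
    apply: contrapT => h; have := lt_le_trans p0 (phiN zs zz0 h).
    by rewrite ltxx.
  split => //; apply: le_lt_trans (cabs_le_ReIm _) _.
  have := h1 z zz0 zd1 p1; have := h2 z zz0 zd2 p2; rewrite mul1r cReD cImD cReN cImN /=.
  rewrite (_ : complex.Re (Complex 0 (- 1) * f z) = complex.Im (f z)); last first.
    by rewrite cReM /=; lra.
  by lra.
exists (Complex a b); last first.
  move=> e /main [t t0 [d d0 h]]; exists t => //; exists d => // z zz0 zd pz.
  by have [] := h z zz0 zd pz.
(* If [|w0| > R], the bounds [|f z| < R] and [|f z - w0| < |w0| - R] leave no points in a fine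
   neighbourhood of [z0]; [fine_ub], vacuously satisfied by [0 <= - 1], excludes this. *)
rewrite leNgt; apply/negP => lt.
have [t t0 [d d0 h]] := main _ (etrans (subr_gt0 _ _) lt).
have oB := @open_cball z0 s.
have : (0%:E <= (- 1)%:E :> \bar RR)%E.
  apply: (fine_ub s0 hphi phi0 (G := fun=> 0%:E)); first exact: gpsh_cst.
  exists t => //; exists d => // z zz0 zd pz; have [_ h1 h2] := h z zz0 zd pz.
  exfalso; have := cabsD (f z) (- (f z - Complex a b)).
  by rewrite cabsN opprB addrC subrK; lra.
by rewrite lee_fin; lra.
Qed.

End FineLimit.

Lemma usc_ccont_comp {T : topologicalType} (K : set T) (g : T -> CC) q :
  (forall p, K p -> forall e : RR, 0 < e -> \forall y \near p, cabs (g y - g p) < e) ->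
  (forall p, K p -> ccont q (g p)) -> usc_rel K (fun p => (q (g p))%:E).
Proof.
move=> cg cq p Kp c; rewrite lte_fin => /(ccont_near (cq p Kp)) /nbhsCE [r r0 hr].
by apply: filterS (cg p Kp r r0) => y yr _; rewrite lte_fin; exact: hr.
Qed.

(* Doubling of variables: at an interior maximum of
   [u (z, w) + psi z - M |w - f z|^2 + delta |z - z0|^2], move along the complex line tangent to the
   graph of [f].  The penalty changes by the real part of a holomorphic function up to [o(|l|^2)],
   which the term in [delta] beats. *)
Section Doubling.
Variables (V : set (CC * CC)) (u : CC * CC -> \bar RR) (psi : CC -> \bar RR).
Variables (U : set CC) (f : CC -> CC) (z0 w0 : CC) (s s1 d c C eps T M : RR).
Hypotheses (hu : gpsh line2 V u) (oU : open U) (hf : forall z, U z -> exists l, cdiff f z l).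
Hypothesis hpsi : sbh [set z | cabs (z - z0) < s1] psi.
Hypotheses (s0 : 0 < s) (ss1 : s < s1) (d0 : 0 < d) (eps0 : 0 < eps) (M0 : 0 <= M).
Hypothesis VP : forall z w, cabs (z - z0) <= s -> cabs (w - w0) <= d -> V (z, w).
Hypothesis psie : forall z, cabs (z - z0) <= s -> (psi z <= eps%:E)%E.
Hypothesis hU : forall z, cabs (z - z0) <= s -> ((- T)%:E <= psi z)%E ->
  U z /\ cabs (f z - w0) < d / 2.
Hypothesis uC : forall z w, cabs (z - z0) <= s -> cabs (w - w0) <= d -> (u (z, w) <= C%:E)%E.
Hypothesis CT : C <= c + T.
Hypothesis circle : forall z w, cabs (z - z0) = s -> ((- T)%:E <= psi z)%E -> cabs (w - w0) <= d ->
  (u (z, w) <= (c + eps + M * cabs (w - f z) ^+ 2)%:E)%E.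
Hypothesis hM : C - c <= M * (d / 2) ^+ 2.

Let B1 := [set z | cabs (z - z0) < s1].
Let Kz := [set z | cabs (z - z0) <= s /\ ((- T)%:E <= psi z)%E].
Let Kw := [set w | cabs (w - w0) <= d].

Lemma compact_Kz : compact Kz.
Proof.
apply: (@subclosed_compact _ _ [set z | cabs (z - z0) <= s]); last by move=> z [].
  rewrite -openC; apply/openCE => z nK; have [zs|sz] := leP (cabs (z - z0)) s; last first.
    exists (cabs (z - z0) - s); first by rewrite subr_gt0.
    move=> y yz [ys _]; have := cabsD (z - y) (y - z0).
    by rewrite subrKA (cabs_sub z y); lra.
  have [_ _ us _] := hpsi; have pz : (psi z < (- T)%:E)%E.
    by rewrite ltNge; apply/negP => h; apply: nK.
  have [|r r0 hr] := usc_near_lt us _ pz; first exact: le_lt_trans ss1.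
  by exists r => // y /hr h [_]; rewrite leNgt h.
exact: (@compact_disc z0 s).
Qed.

Let u2 (p : CC * CC) : \bar RR := (u p + psi p.1)%E.

Lemma psh_u2 : gpsh line2 (V `&` (fst @^-1` B1)) u2.
Proof.
have [oV _ _ _] := hu; have oB : open (fst @^-1` B1 : set (CC * CC)).
  by apply: open_comp => [x _|]; [exact: cont_fst|exact: open_cball].
apply: (gpshD line2_cont); first by apply: gpsh_sub hu => [|x []]; [exact: openI|].
by apply: gpsh_sub (gpsh_pr cont_fst line2_fst hpsi) => [|x []]; [exact: openI|].
Qed.

Variable delta : RR.
Hypotheses (delta0 : 0 < delta) (deltas : delta * s ^+ 2 <= eps).
(** Minus the penalty plus the [delta] term. The subtractions of [0] give both summands the shape of
    [ccont_sqr]. *)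
Let b (p : CC * CC) : RR := - M * (cabs (p.2 - f p.1 - 0) ^+ 2 - 0)
  + delta * (cabs (p.1 - z0) ^+ 2 - 0).

Lemma bE p : b p = delta * cabs (p.1 - z0) ^+ 2 - M * cabs (p.2 - f p.1) ^+ 2.
Proof. by rewrite /b !subr0 mulNr addrC. Qed.

Lemma b_le p : cabs (p.1 - z0) <= s -> b p <= eps.
Proof.
move=> ps; rewrite bE; apply: le_trans deltas.
apply: (@le_trans _ _ (delta * cabs (p.1 - z0) ^+ 2)).
  by rewrite gerBl mulr_ge0 // exprn_ge0 // cabs_ge0.
by rewrite ler_pM2l // ler_pXn2r ?nnegrE ?cabs_ge0 // ltW.
Qed.

Lemma no_interior_max zs ws x y : cabs (zs - z0) < s -> cabs (ws - w0) < d ->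
  ((- T)%:E <= psi zs)%E -> u (zs, ws) = x%:E -> psi zs = y%:E ->
  ~ (forall z w, cabs (z - z0) <= s -> cabs (w - w0) <= d ->
     (u2 (z, w) + (b (z, w))%:E <= (x + y + b (zs, ws))%:E)%E).
Proof.
move=> zss wsd psz ux psy hmax.
have [Uz _] := hU (ltW zss) psz; have [l0 hl0] := hf Uz.
have c0 : 0 <= cabs l0 by exact: cabs_ge0.
(* [tau] is the slope of the Taylor remainder of [f]; [M tau ^ 2 <= M tau <= delta / 2] bounds the
   squared remainder by half of the [delta] term. *)
have [tau tau0 [tau1 tauM]] : exists2 tau : RR, 0 < tau & tau <= 1 /\ M * tau <= delta / 2.
  have M1 : 0 < M + 1 by rewrite ltr_wpDl.
  exists (Num.min 1 (delta / (2 * (M + 1)))); first by rewrite lt_min ltr01 divr_gt0 // mulr_gt0.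
  split; first by rewrite ge_min lexx.
  apply: (@le_trans _ _ ((M + 1) * (delta / (2 * (M + 1))))).
    have q0 : 0 < delta / (2 * (M + 1)) by rewrite divr_gt0 // mulr_gt0.
    by apply: ler_pM; rewrite ?ge_min ?lexx ?orbT ?lerDl // le_min ler01 ltW.
  by rewrite le_eqVlt; apply/orP; left; apply/eqP; field; rewrite gt_eqF.
have [r1 r10 hr1] := hl0 tau tau0.
have /= [r2 r20 hr2] := (openCE U).1 oU zs Uz.
have [rho rho0 [p1 p2 p3 p4]] : exists2 rho : RR, 0 < rho &
    [/\ rho <= r1, rho <= r2, rho <= s - cabs (zs - z0) &
        rho * (cabs l0 + 1) <= d - cabs (ws - w0)].
  have l1 : 0 < cabs l0 + 1 by rewrite ltr_wpDl.
  exists (Num.min r1 (Num.min r2 (Num.min (s - cabs (zs - z0)) ((d - cabs (ws - w0)) / (cabs l0 + 1))))).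
    by rewrite !lt_min r10 r20 subr_gt0 zss divr_gt0 // subr_gt0.
  split; rewrite ?ge_min ?lexx ?orbT //.
  by rewrite -ler_pdivlMr // !ge_min lexx !orbT.
pose L (l : CC) := (zs + l * 1, ws + l * l0).
have hL : line2 L by exists (zs, ws), (1, l0).
have Lz l : cabs l < rho -> cabs (zs + l * 1 - z0) < s.
  move=> lr; rewrite (_ : _ - z0 = (zs - z0) + l); last ring.
  by apply: le_lt_trans (cabsD _ _) _; lra.
have Lw l : cabs l < rho -> cabs (ws + l * l0 - w0) < d.
  move=> lr; rewrite (_ : _ - w0 = (ws - w0) + l * l0); last ring.
  apply: le_lt_trans (cabsD _ _) _; rewrite cabsM.
  have : cabs l * cabs l0 <= rho * cabs l0 by rewrite ler_wpM2r // ltW.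
  by lra.
have LW l : cabs l < rho -> (V `&` (fst @^-1` B1)) (L l).
  move=> lr; split; first by apply: VP; apply: ltW; [exact: Lz|exact: Lw].
  by apply: lt_trans ss1; exact: Lz.
pose r := rho / 2; have r0 : 0 < r by rewrite /r divr_gt0.
have rrho : r < rho by rewrite /r; lra.
have [_ u2y u2u _] := psh_u2.
pose err (l : CC) := f (zs + l) - f zs - l * l0.
pose al := ws - f zs; pose ze := zs - z0.
(* On [|l| = r], expanding both squares and using maximality gives [u2 <= Re F + M |err| ^ 2 - delta
   r ^ 2 / 2 <= Re F], while [Re (F 0) = x + y - delta r ^ 2 / 2] is below the value [x + y] of [u2]
   at the centre. *)
pose F (l : CC) := (x + y - delta * r ^+ 2 / 2)%:C + M%:C * (2 * (al^* * (- err l)))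
   - delta%:C * (2 * (ze^* * l)).
have hF : hol_disc F 0 r.
  move=> l; rewrite subr0 => lr.
  have Ul : U (zs + l) by apply: hr2; rewrite addrC addKr; apply: le_lt_trans lr _; lra.
  have [k hk] := hf Ul.
  have e1 := cdiff_comp (cdiffD (cdiff_cst zs l) (cdiff_id l)) hk.
  have e2 := cdiffB (cdiffB e1 (cdiff_cst (f zs) l)) (cdiffM (cdiff_id l) (cdiff_cst l0 l)).
  eexists; apply: cdiffB.
    apply: cdiffD; first exact: cdiff_cst.
    apply: cdiffM (cdiff_cst _ _) _; apply: cdiffM (cdiff_cst _ _) _.
    by apply: cdiffM (cdiff_cst _ _) _; exact: cdiffN e2.
  apply: cdiffM (cdiff_cst _ _) _; apply: cdiffM (cdiff_cst _ _) _.
  by apply: cdiffM (cdiff_cst _ _) _; exact: cdiff_id.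
have ReF l : complex.Re (F l) = x + y - delta * r ^+ 2 / 2
    + M * complex.Re (2 * (al^* * (- err l))) - delta * complex.Re (2 * (ze^* * l)).
  by rewrite /F !cReD cReN !cRe_scale.
have ct := line_ctest line2_cont line2_aff psh_u2 hL r0
  (fun l lr => LW l (le_lt_trans lr rrho)).
have Sl_lt l : Sc r l -> cabs l < rho by move=> ->.
have us : usc_rel (Sc r) (u2 \o L).
  move=> l Sl b0 h; have := usc_line line2_cont hL u2u LW (Sl_lt l Sl) h.
  by apply: filterS => y' hy' /Sl_lt /hy'.
have uy l : Sc r l -> ((u2 \o L) l < +oo)%E by move=> /Sl_lt /LW; exact: u2y.
have leF l : Sc r l -> ((u2 \o L) l <= (complex.Re (F l))%:E)%E.
  move=> Sl; have lr := Sl_lt l Sl.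
  have := hmax _ _ (ltW (Lz l lr)) (ltW (Lw l lr)); move: (uy l Sl); rewrite /= -/(L l).
  case: (u2 (L l)) => [v| |] //; last by move=> _ _; rewrite leNye.
  rewrite -EFinD !lee_fin !bE /= ReF => _.
  rewrite (_ : zs + l * 1 - z0 = ze + l); last by rewrite /ze; ring.
  rewrite (_ : ws + l * l0 - f (zs + l * 1) = al + - err l); last first.
    by rewrite /al /err mulr1; ring.
  rewrite (cabsD_expand al) (cabsD_expand ze) cabsN (Sl : cabs l = r) -/al -/ze.
  have : M * cabs (err l) ^+ 2 <= delta / 2 * r ^+ 2.
    have h1 : cabs (err l) <= tau * r.
      have := hr1 (zs + l); rewrite addrC addKr (mulrC l0) (Sl : cabs l = r) => h.
      by have := h (lt_le_trans rrho p1); rewrite /err (addrC zs).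
    have h2 : cabs (err l) ^+ 2 <= (tau * r) ^+ 2.
      by rewrite ler_pXn2r ?nnegrE ?cabs_ge0 ?mulr_ge0 // ltW.
    apply: le_trans (ler_wpM2l M0 h2) _; rewrite exprMn mulrA ler_pM2r ?exprn_gt0 //.
    apply: le_trans tauM; rewrite expr2 mulrA ler_piMr // mulr_ge0 // ltW //.
  set X := complex.Re (2 * (al^* * _)); set Y := complex.Re (2 * (ze^* * _)).
  by lra.
have := ctest_hol r0 hF us uy ct leF.
rewrite /L /u2 /= !mul0r !addr0 ux psy ReF /err addr0 mul0r subr0 subrr oppr0 !mulr0 /=.
rewrite -EFinD lee_fin.
have : 0 < delta * r ^+ 2 by rewrite mulr_gt0 // exprn_gt0.
by lra.
Qed.

Lemma doubling z : cabs (z - z0) <= s -> ((- T)%:E <= psi z)%E ->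
  (u (z, w0) + psi z <= (c + 3 * eps + M * cabs (w0 - f z) ^+ 2)%R%:E)%E.
Proof.
move=> zs pz; rewrite leNgt; apply/negP => lt.
pose K1 := Kz `*` Kw.
have cK : compact K1 by apply: compact_setX; [exact: compact_Kz|exact: (@compact_disc w0 d)].
have K1z : K1 (z, w0) by split; [split|rewrite /Kw /= subrr cabs0 ltW].
have K1V : K1 `<=` V `&` (fst @^-1` B1).
  move=> [z' w'] [[/= z's _] w'd]; split; first exact: VP.
  exact: le_lt_trans ss1.
have [_ u2y u2u _] := psh_u2.
pose Th p := (u2 p + (b p)%:E)%E.
have uTh : usc_rel K1 Th.
  apply: usc_relD.
  - by move=> p /K1V; exact: u2y.
  - by move=> p _; rewrite ltry.
  - exact: usc_on_rel u2u.
  have -> : (fun p => (b p)%:E) = fun p : CC * CC =>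
      ((- M * (cabs (p.2 - f p.1 - 0) ^+ 2 - 0))%:E + (delta * (cabs (p.1 - z0) ^+ 2 - 0))%:E)%E.
    by apply/funext => p; rewrite -EFinD.
  apply: usc_relD; [by move=> p _; rewrite ltry|by move=> p _; rewrite ltry| |].
    apply: (@usc_ccont_comp _ K1 (fun p : CC * CC => p.2 - f p.1)
      (fun x : CC => - M * (cabs (x - 0) ^+ 2 - 0))) => [p [[ps pp] pw] e e0|p _].
      have [Up _] := hU ps pp; have [l hl] := hf Up.
      have e2 : 0 < e / 2 by rewrite divr_gt0.
      have [r r0 hr] := cdiff_cont hl e2.
      apply/nbhsC2E; exists (Num.min r (e / 2)); first by rewrite lt_min r0.
      move=> y; rewrite !lt_min => /andP[/hr y1 _] /andP[_ y2].
      rewrite (_ : _ - _ = (y.2 - p.2) + - (f y.1 - f p.1)); last ring.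
      by apply: le_lt_trans (cabsD _ _) _; rewrite cabsN; lra.
    exact: ccont_sqr.
  apply: (@usc_ccont_comp _ K1 fst
      (fun x : CC => delta * (cabs (x - z0) ^+ 2 - 0))) => [p _ e e0|p _].
    by apply: (@cont_fst p [set y | cabs (y - p.1) < e]); apply/nbhsCE; exists e.
  exact: ccont_sqr.
have [[zm wm] [[zms pzm] wmd] hm] := usc_rel_max cK (ex_intro _ (z, w0) K1z) uTh.
have big : ((c + 3 * eps)%:E < Th (zm, wm))%E.
  apply: lt_le_trans (hm _ K1z); rewrite /Th bE /=.
  move: lt; rewrite /u2 /=; case: (_ + _)%E => [t| |] //; last by move=> _; rewrite ltry.
  rewrite -EFinD !lte_fin.
  have : 0 <= delta * cabs (z - z0) ^+ 2 by rewrite mulr_ge0 ?exprn_ge0 ?cabs_ge0 // ltW.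
  by lra.
have [x ux] : exists x : RR, u (zm, wm) = x%:E.
  move: (uC zms wmd) big; rewrite /Th /u2; case: (u _) => [t| |] //; first by exists t.
have [y py] : exists y : RR, psi zm = y%:E.
  move: (psie zms) big; rewrite /Th /u2 /=; case: (psi _) => [t| |] //; first by exists t.
  by move=> _; rewrite addeNy.
have ThE : Th (zm, wm) = (x + y + b (zm, wm))%:E by rewrite /Th /u2 /= ux py.
have bm := @b_le (zm, wm) zms.
have xC : x <= C by have := uC zms wmd; rewrite ux.
have ye : y <= eps by have := psie zms; rewrite py.
rewrite ThE lte_fin in big.
(* On the circle, [circle], [psie] and the [delta] bound add up to at most [c + 3 eps]. On
   [|w - w0| = d] the penalty is at least [C - c], leaving at most [c + 2 eps]. Both contradict
   [big]. *)
have zlt : cabs (zm - z0) < s.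
  rewrite lt_neqAle zms andbT; apply/eqP => E.
  have := circle E pzm wmd; rewrite ux lee_fin => h.
  have : delta * cabs (zm - z0) ^+ 2 <= eps by rewrite E.
  by move: big; rewrite bE /=; lra.
have wlt : cabs (wm - w0) < d.
  rewrite lt_neqAle wmd andbT; apply/eqP => E.
  have [_ fz] := hU zms pzm.
  have h : d / 2 <= cabs (wm - f zm).
    have := cabsD (wm - f zm) (f zm - w0); rewrite subrKA E; lra.
  have h2 : M * (d / 2) ^+ 2 <= M * cabs (wm - f zm) ^+ 2.
    by apply: ler_wpM2l => //; rewrite ler_pXn2r ?nnegrE ?cabs_ge0 ?divr_ge0 ?(ltW d0).
  have h3 : delta * cabs (zm - z0) ^+ 2 <= eps.
    apply: le_trans deltas; rewrite ler_pM2l // ler_pXn2r ?nnegrE ?cabs_ge0 //; exact: ltW.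
  by have := eps0; have := hM; move: big; rewrite bE /=; lra.
apply: (no_interior_max zlt wlt pzm ux py) => z' w' z's w'd.
(* Where [psi < - T] the value is at most [C - T + eps <= c + eps], so the maximum over [K1] is the
   maximum over the whole bidisc. *)
have [big'|small] := leP (- T)%:E (psi z').
  by rewrite -ThE; apply: (hm (z', w')); split.
have h1 : (u2 (z', w') <= (C - T)%:E)%E.
  rewrite EFinD; apply: leeD; first exact: uC.
  exact: ltW.
apply: le_trans (leeD h1 (_ : _ <= eps%:E)%E) _; first by rewrite lee_fin; exact: b_le.
by rewrite -EFinD lee_fin; have := eps0; have := CT; lra.
Qed.

End Doubling.

Lemma cdiff_holomorphic U f : holomorphic_on U f -> forall z, U z -> exists l, cdiff f z l.
Proof.
move=> [_ hf] z Uz; have [l cv] := hf z Uz; exists l => e e0.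
have nl : nbhs l [set y | cabs (y - l) < e] by apply/nbhsCE; exists e.
have : nbhs (0 : CC) (fun h => h != 0 -> cabs ((f (z + h) - f z) / h - l) < e) := cv _ nl.
move=> /nbhsCE [d d0 hd]; exists d => // y yd.
have [->|yz] := eqVneq y z; first by rewrite !subrr mulr0 subr0 cabs0 mulr0.
have yz0 : y - z != 0 by rewrite subr_eq0.
have := hd (y - z); rewrite subr0 subrKC => /(_ yd yz0) /ltW h.
rewrite (_ : f y - f z - l * (y - z) = ((f y - f z) / (y - z) - l) * (y - z)).
  by rewrite cabsM ler_wpM2r // cabs_ge0.
by field.
Qed.

Lemma sbh_slice V u (U : set CC) w0 : gpsh line2 V u -> open U -> (forall z, U z -> V (z, w0)) ->
  sbh U (fun z => u (z, w0)).
Proof.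
move=> [_ uy uu us] oU UV; split => //.
- by move=> z /UV; exact: uy.
- move=> z Uz c h; have /nbhsC2E [r r0 hr] := uu _ (UV z Uz) c h.
  by apply/nbhsCE; exists r => // y yz; apply: hr => //=; rewrite subrr cabs0.
move=> L [a [b ->]] Ua.
have hL : line2 (fun l => (a + l * b, w0)).
  by exists (a, w0), (b, 0); apply/funext => l /=; rewrite mulr0 addr0.
by apply: (us _ hL); exact: UV.
Qed.

(** * From doubling to the value at [(z0, w0)] *)

Section GraphLimit.
Variables (U : set CC) (f : CC -> CC) (z0 w0 : CC) (s : RR) (phi : CC -> \bar RR).
Hypotheses (oU : open U) (hf : forall z, U z -> exists l, cdiff f z l).
Hypotheses (s_gt0 : 0 < s) (hphi : sbh [set z | cabs (z - z0) < s] phi) (phi0 : phi z0 = 0%E).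
Hypothesis fine : forall e : RR, 0 < e ->
  exists2 th : RR, 0 < th & exists2 d : RR, 0 < d & forall z, z != z0 -> cabs (z - z0) < d ->
    ((- th)%:E < phi z)%E -> U z /\ cabs (f z - w0) < e.

(** Where [u < c + eps] any penalty will do, and this persists nearby. At other points [w] differs
    from [f z], and a large multiple of the squared distance exceeds [C] nearby. Compactness makes
    the multiple uniform. *)
Lemma circle_penalty V u (s1 d c C eps th : RR) : gpsh line2 V u -> 0 < s1 -> s1 < s -> 0 < eps ->
  (forall z w, cabs (z - z0) <= s1 -> cabs (w - w0) <= d -> V (z, w)) ->
  (forall z w, cabs (z - z0) <= s1 -> cabs (w - w0) <= d -> (u (z, w) <= C%:E)%E) ->
  (forall z, cabs (z - z0) = s1 -> ((- th)%:E <= phi z)%E -> U z /\ (u (z, f z) <= c%:E)%E) ->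
  exists2 M : RR, 0 <= M & forall M', M <= M' -> forall z w, cabs (z - z0) = s1 ->
    ((- th)%:E <= phi z)%E -> cabs (w - w0) <= d ->
    (u (z, w) <= (c + eps + M' * cabs (w - f z) ^+ 2)%R%:E)%E.
Proof.
move=> hu s10 s1s eps0 VP uC hU.
pose Kc := [set z | cabs (z - z0) <= s1 /\ ((- th)%:E <= phi z)%E] `&` [set z | cabs (z - z0) = s1].
have cKc : compact Kc.
  apply: compact_closedI; first exact: (compact_Kz hphi s1s).
  by apply: compact_closed; [exact: (@norm_hausdorff CC CC^o)|exact: (@compact_circle z0 s1)].
have cK : compact (Kc `*` [set w | cabs (w - w0) <= d]).
  by apply: compact_setX cKc _; exact: (@compact_disc w0 d).
have [_ _ uu _] := hu.
have : \forall n \near \oo, Kc `*` [set w | cabs (w - w0) <= d] `<=`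
    [set p : CC * CC | cabs (p.1 - z0) <= s1 -> cabs (p.2 - w0) <= d ->
      (u p <= (c + eps + n%:R * cabs (p.2 - f p.1) ^+ 2)%R%:E)%E].
  move: cK => /compact_near_coveringP; apply => -[z w] [[[/= zs pz] zs1] wd].
  have [Uz uz] := hU z zs1 pz; have Vp := VP z w zs wd.
  have [lt|ge] := ltP (u (z, w)) (c + eps)%:E.
    exists ([set p | (u p < (c + eps)%:E)%E], setT); first by split; [exact: uu|exact: filterT].
    move=> [p n] /= [up _] _ _; apply: le_trans (ltW up) _.
    by rewrite lee_fin lerDl mulr_ge0 // exprn_ge0 // cabs_ge0.
  have a0 : 0 < cabs (w - f z).
    rewrite cabs_gt0 subr_eq0; apply/eqP => E; move: ge; rewrite E => /le_trans /(_ uz).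
    by rewrite lee_fin; lra.
  set a := cabs (w - f z) in a0.
  have [l hl] := hf Uz; have a4 : 0 < a / 4 by rewrite divr_gt0.
  have [r r0 hr] := cdiff_cont hl a4.
  have c0 : 0 < a ^+ 2 / 4 by rewrite divr_gt0 // exprn_gt0.
  pose n0 := (Num.truncn ((C - c - eps) / (a ^+ 2 / 4))).+1.
  exists ([set p | cabs (w - f z) / 2 <= cabs (p.2 - f p.1)], [set n | (n0 <= n)%N]).
    split; last by exists n0.
    apply/nbhsC2E; exists (Num.min r (a / 4)); first by rewrite lt_min r0.
    move=> y; rewrite !lt_min => /andP[/hr y1 _] /andP[_ y2] /=; rewrite -/a.
    have := cabsD (w - y.2 + (y.2 - f y.1)) (f y.1 - f z).
    have := cabsD (w - y.2) (y.2 - f y.1).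
    rewrite !subrKA -/a (cabs_sub w y.2) /= in y1 y2 *; rlra.
  move=> [[z' w'] n] /= [pa n0n] ps pd; apply: le_trans (uC z' w' ps pd) _.
  rewrite lee_fin; rewrite -/a in pa.
  have h1 : C - c - eps <= n%:R * (a ^+ 2 / 4).
    rewrite -ler_pdivrMr // ltW //; apply: lt_le_trans (truncnS_gt _) _.
    by rewrite ler_nat.
  have h2 : a ^+ 2 / 4 <= cabs (w' - f z') ^+ 2.
    rewrite (_ : a ^+ 2 / 4 = (a / 2) ^+ 2); last by field.
    by rewrite ler_pXn2r ?nnegrE ?cabs_ge0 ?divr_ge0 ?(ltW a0).
  have h3 : n%:R * (a ^+ 2 / 4) <= n%:R * cabs (w' - f z') ^+ 2 by rewrite ler_wpM2l.
  by lra.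
move=> [N _ /(_ N (leqnn N)) h]; exists N%:R => // M' NM z w zs1 pz wd.
have zs : cabs (z - z0) <= s1 by rewrite zs1.
have Kp : (Kc `*` [set w | cabs (w - w0) <= d]) (z, w) by do !split.
apply: le_trans (h (z, w) Kp zs wd) _; rewrite lee_fin lerD2l ler_wpM2r //.
by rewrite exprn_ge0 // cabs_ge0.
Qed.

(* The term [kappa log |z - z0|] keeps the maximum in [doubling] away from [z0], where [f] is not
   controlled; [kappa] is sent to [0] first. *)
Lemma psh_graph_le V u (c d0 : RR) : gpsh line2 V u -> V (z0, w0) -> 0 < d0 ->
  (forall z, U z -> cabs (z - z0) < d0 -> cabs (f z - w0) < d0 -> (u (z, f z) <= c%:E)%E) ->
  (u (z0, w0) <= c%:E)%E.
Proof.
move=> hu V0 d00 gc; have [oV uy uu _] := hu.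
have /nbhsC2E [r r0 hr] := open_nbhs_nbhs (conj oV V0).
have [d [d_gt0 dr dd0]] : exists d : RR, [/\ 0 < d, d < r & d < d0].
  have m0 : 0 < Num.min r d0 by rewrite lt_min r0.
  have m1 : Num.min r d0 <= r by rewrite ge_min lexx.
  have m2 : Num.min r d0 <= d0 by rewrite ge_min lexx orbT.
  by exists (Num.min r d0 / 2); split; lra.
have d2 : 0 < d / 2 by rewrite divr_gt0.
have [th0 th00 [d1 d10 h1]] := fine d2.
have [sA [sA0 [sAr sAd0 sAd1 sAs sA1]]] : exists sA : RR, 0 < sA /\
    [/\ sA < r, sA < d0, sA < d1, sA < s & sA < 1].
  have m0 : 0 < Num.min r (Num.min d0 (Num.min d1 (Num.min s 1))).
    by rewrite !lt_min r0 d00 d10 s_gt0 ltr01.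
  have m1 : Num.min r (Num.min d0 (Num.min d1 (Num.min s 1))) <= r by rewrite ge_min lexx.
  have m2 : Num.min r (Num.min d0 (Num.min d1 (Num.min s 1))) <= d0.
    by rewrite !ge_min lexx !orbT.
  have m3 : Num.min r (Num.min d0 (Num.min d1 (Num.min s 1))) <= d1.
    by rewrite !ge_min lexx !orbT.
  have m4 : Num.min r (Num.min d0 (Num.min d1 (Num.min s 1))) <= s.
    by rewrite !ge_min lexx !orbT.
  have m5 : Num.min r (Num.min d0 (Num.min d1 (Num.min s 1))) <= 1.
    by rewrite !ge_min lexx !orbT.
  by exists (Num.min r (Num.min d0 (Num.min d1 (Num.min s 1))) / 2); do !split; lra.
have VA z w : cabs (z - z0) <= sA -> cabs (w - w0) <= d -> V (z, w).
  by move=> zs wd; apply: hr => /=; [exact: le_lt_trans sAr|exact: le_lt_trans dr].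
have [C cC uC] : exists2 C : RR, c <= C & forall z w, cabs (z - z0) <= sA -> cabs (w - w0) <= d ->
    (u (z, w) <= C%:E)%E.
  pose K := [set z | cabs (z - z0) <= sA] `*` [set w | cabs (w - w0) <= d].
  have cK : compact K by apply: compact_setX; exact: compact_disc.
  have KV : K `<=` V by move=> [z w] [/= zs wd]; exact: VA.
  have K0 : K !=set0 by exists (z0, w0); split => /=; rewrite subrr cabs0 ltW.
  have [p Kp hp] := usc_rel_max cK K0 (usc_on_rel KV uu).
  have [C uC] : exists C : RR, (u p <= C%:E)%E.
    by have := uy p (KV p Kp); case: (u p) => [t| |] // _; [exists t|exists 0; rewrite leNye].
  have [m1 m2] := maxr_ge c C; exists (Num.max c C) => // z w zs wd.
  apply: le_trans (hp (z, w) (conj zs wd)) _; apply: le_trans uC _.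
  by rewrite lee_fin.
pose th := th0 / 2; have th_gt0 : 0 < th by rewrite divr_gt0.
have th_lt : th < th0 by rewrite /th; lra.
clearbody th.
(* [N th] is the [T] of [doubling]: where [phi < - th], the weight [N phi] pushes the bound [C]
   below [c]. *)
have [N N0 NC] : exists2 N : RR, 0 < N & C <= c + N * th.
  exists ((C - c) / th + 1); first by rewrite ltr_wpDl // divr_ge0 ?subr_ge0 // ltW.
  by rewrite mulrDl divfK ?gt_eqF // mul1r; lra.
(* Six shares: three from [doubling], one from the term [k log |z - z0|], one from [N phi] and one
   from the penalty at [w0]. *)
apply/lee_addgt0Pr => e e0; pose eps := e / 6; have eps0 : 0 < eps by rewrite divr_gt0.
have epsE : e = 6 * eps by rewrite /eps; field.
clearbody eps.
have eN : 0 < eps / N by rewrite divr_gt0.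
have [ds /andP[ds0 dss] hds] := phi_small s_gt0 hphi phi0 eN.
have [s1 [s10 s1A s1d]] : exists s1 : RR, [/\ 0 < s1, s1 < sA & s1 < ds].
  have m0 : 0 < Num.min sA ds by rewrite lt_min sA0.
  have m1 : Num.min sA ds <= sA by rewrite ge_min lexx.
  have m2 : Num.min sA ds <= ds by rewrite ge_min lexx orbT.
  by exists (Num.min sA ds / 2); split; lra.
have hgood z : cabs (z - z0) <= s1 -> z != z0 -> ((- th)%:E <= phi z)%E ->
    [/\ U z, cabs (f z - w0) < d / 2 & (u (z, f z) <= c%:E)%E].
  move=> zs zz0 pz; have zd1 : cabs (z - z0) < d1 by lra.
  have pz' : ((- th0)%:E < phi z)%E by apply: lt_le_trans pz; rewrite lte_fin; lra.
  have [Uz fz] := h1 z zz0 zd1 pz'.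
  by split => //; apply: gc => //; lra.
have [M2 M20 hM2] : exists2 M : RR, 0 <= M & forall M', M <= M' -> forall z w,
    cabs (z - z0) = s1 -> ((- th)%:E <= phi z)%E -> cabs (w - w0) <= d ->
    (u (z, w) <= (c + eps + M' * cabs (w - f z) ^+ 2)%R%:E)%E.
  apply: (circle_penalty hu s10 (lt_trans s1A sAs) eps0) => [z w zs wd|z w zs wd|z zs pz].
  - by apply: VA => //; lra.
  - by apply: uC => //; lra.
  have zz0 : z != z0 by rewrite -subr_eq0 -cabs_gt0 zs.
  have zs' : cabs (z - z0) <= s1 by rewrite zs.
  by have [] := hgood z zs' zz0 pz.
have [M [M0 MM2 hM]] : exists M : RR, [/\ 0 <= M, M2 <= M & C - c <= M * (d / 2) ^+ 2].
  have q0 : 0 < (d / 2) ^+ 2 by rewrite exprn_gt0.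
  have [m1 m2] := maxr_ge M2 ((C - c) / (d / 2) ^+ 2).
  exists (Num.max M2 ((C - c) / (d / 2) ^+ 2)); split => //; first exact: le_trans m1.
  by rewrite -ler_pdivrMr.
have key z : z != z0 -> cabs (z - z0) <= s1 -> ((- th)%:E < phi z)%E ->
    exists2 y : RR, phi z = y%:E &
      (u (z, w0) <= (c + 4 * eps - N * y + M * cabs (w0 - f z) ^+ 2)%R%:E)%E.
  move=> zz0 zs pz.
  have [y yE] : exists y : RR, phi z = y%:E.
    move: pz (hds z (le_lt_trans zs s1d)); case: (phi z) => [y| |] //; first by exists y.
  exists y => //; move: pz; rewrite yE lte_fin => pz.
  have z1 : 0 < cabs (z - z0) by rewrite cabs_gt0 subr_eq0.
  pose lz := ln (cabs (z - z0)).
  have lzE : lnabs (z - z0) = lz%:E by rewrite /lnabs subr_eq0 (negbTE zz0).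
  have q1 : 0 < `|lz| + 1 by rewrite ltr_wpDl.
  (* [k] depends on [z]: it makes the logarithm at [z] cost at most [eps] and keeps
     [psi z >= - N th], so that [doubling] applies at [z]. The constants [N] and [M] do not depend
     on [k]. *)
  have [k k0 [k1 k2]] : exists2 k : RR, 0 < k & k * (`|lz| + 1) <= eps /\
      k * (`|lz| + 1) <= N * (y + th).
    have w1 : 0 < N * (y + th) by rewrite mulr_gt0 //; lra.
    exists (Num.min eps (N * (y + th)) / (`|lz| + 1)).
      by rewrite divr_gt0 // lt_min eps0.
    by rewrite divfK ?gt_eqF // !ge_min !lexx orbT.
  pose psi x := (N%:E * phi x + k%:E * lnabs (x - z0)%R)%E.
  have oA := @open_cball z0 sA.
  have hpsi : sbh [set x | cabs (x - z0) < sA] psi.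
    apply: (gpshD line1_cont).
      apply: gpsh_scale => //; apply: gpsh_sub hphi => // x /= xs; exact: lt_trans sAs.
    by apply: gpsh_scale => //; exact: sbh_lnabs.
  have ln0 x : cabs (x - z0) <= s1 -> (k%:E * lnabs (x - z0)%R <= 0)%E.
    move=> xs; apply: mule_ge0_le0; first by rewrite lee_fin ltW.
    by rewrite -[0%E]/(0%:E) lnabs_leE expR0; lra.
  have psiN x : cabs (x - z0) <= s1 -> (psi x <= N%:E * phi x)%E.
    by move=> xs; rewrite -[leRHS]adde0; apply: leeD => //; exact: ln0.
  have psie x : cabs (x - z0) <= s1 -> (psi x <= eps%:E)%E.
    move=> xs; apply: le_trans (psiN x xs) _.
    rewrite -lee_pdivlMl // -EFinM mulrC; apply: ltW; apply: hds; exact: le_lt_trans s1d.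
  have psig x : cabs (x - z0) <= s1 -> ((- (N * th))%:E <= psi x)%E ->
      x != z0 /\ ((- th)%:E <= phi x)%E.
    move=> xs px; split.
      apply/eqP => E; move: px; rewrite /psi E subrr /lnabs eqxx gt0_muleNy ?lte_fin //.
      by rewrite phi0 mule0 add0e leNgt ltNyr.
    have := le_trans px (psiN x xs); rewrite -mulrN EFinM lee_pmul2l ?lte_fin //.
  have dl0 : 0 < eps / s1 ^+ 2 by rewrite divr_gt0 // exprn_gt0.
  have dls : eps / s1 ^+ 2 * s1 ^+ 2 <= eps by rewrite divfK // gt_eqF // exprn_gt0.
  have pz' : ((- (N * th))%:E <= psi z)%E.
    rewrite /psi yE lzE -!EFinM -EFinD lee_fin.
    have : k * - lz <= k * `|lz| by rewrite ler_pM2l // -normrN ler_norm.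
    by lra.
  have := @doubling V u psi U f z0 w0 s1 sA d c C eps (N * th) M hu oU hf hpsi s10 s1A d_gt0 eps0 M0.
  move=> H; have {}H := H _ psie _ _ NC _ hM _ dl0 dls z zs pz'.
  have : (u (z, w0) + psi z <= (c + 3 * eps + M * cabs (w0 - f z) ^+ 2)%R%:E)%E.
    apply: H.
    - by move=> x w xs wd; apply: VA => //; lra.
    - move=> x xs px; have [xz0 px'] := psig x xs px.
      by have [] := hgood x xs xz0 px'.
    - by move=> x w xs wd; apply: uC => //; lra.
    - move=> x w xs px wd; have xs' : cabs (x - z0) <= s1 by rewrite xs.
      have [xz0 px'] := psig x xs' px; exact: hM2.
  rewrite /psi yE lzE -!EFinM -EFinD; case: (u _) => [t| |] //; last by move=> _; rewrite leNye.
  rewrite -EFinD !lee_fin.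
  have : k * - lz <= k * `|lz| by rewrite ler_pM2l // -normrN ler_norm.
  by lra.
have oB := @open_cball z0 s1.
have hphi1 : sbh [set z | cabs (z - z0) < s1] phi.
  by apply: gpsh_sub hphi => // z /= zs; lra.
have hG : sbh [set z | cabs (z - z0) < s1] (fun z => u (z, w0)).
  apply: (sbh_slice hu) => // z /= zs; apply: VA; first lra.
  by rewrite subrr cabs0 ltW.
(* The bound of [key] holds in a fine neighbourhood of [z0], where [f z] is near [w0] and [phi] is
   near [0]; [fine_ub] carries it to [z0] along the slice [w = w0]. *)
rewrite -EFinD; apply: (@fine_ub z0 s1 phi s10 hphi1 phi0 (fun z => u (z, w0)) (c + e)%R hG).
have M1 : 0 < M + 1 by rewrite ltr_wpDl.
have [e1 [e10 e11 Me1]] : exists e1 : RR, [/\ 0 < e1, e1 <= 1 & M * e1 <= eps].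
  exists (Num.min 1 (eps / (M + 1))); split.
  - by rewrite lt_min ltr01 divr_gt0.
  - by rewrite ge_min lexx.
  apply: (@le_trans _ _ (M * (eps / (M + 1)))).
    by apply: ler_wpM2l => //; rewrite ge_min lexx orbT.
  by rewrite mulrA ler_pdivrMr //; nra.
have [th1 th10 [d3 d30 h3]] := fine e10.
exists (Num.min th (Num.min th1 (eps / N))); first by rewrite !lt_min th_gt0 th10.
exists (Num.min s1 d3); first by rewrite lt_min s10.
move=> z zz0; rewrite lt_min => /andP[zs zd] pz.
have pth x : Num.min th (Num.min th1 (eps / N)) <= x -> ((- x)%:E < phi z)%E.
  by move=> h; apply: le_lt_trans pz; rewrite lee_fin lerN2.
have pz1 : ((- th)%:E < phi z)%E by apply: pth; rewrite ge_min lexx.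
have pz2 : ((- th1)%:E < phi z)%E by apply: pth; rewrite !ge_min lexx !orbT.
have pz3 : ((- (eps / N))%:E < phi z)%E by apply: pth; rewrite !ge_min lexx !orbT.
have [y yE uz] := key z zz0 (ltW zs) pz1.
have [_ fz] := h3 z zz0 zd pz2.
apply: le_trans uz _; rewrite lee_fin epsE.
have h4 : - eps < N * y.
  by move: pz3; rewrite yE lte_fin -mulNr ltr_pdivrMr // mulrC.
have h5 : M * cabs (w0 - f z) ^+ 2 <= eps.
  apply: le_trans Me1; apply: ler_wpM2l => //; rewrite cabs_sub.
  have := cabs_ge0 (f z - w0); set q := cabs (f z - w0) in fz * => q0.
  by apply: le_trans (ltW fz); rewrite expr2 ler_piMl //; lra.
by lra.
Qed.

End GraphLimit.

(** * Both cases combined *)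

Theorem theorem1p3 (D A : set CC) (f : CC -> CC) (z0 : CC) :
  domain D ->
  A `<=` D -> D `&` closure A `<=` A -> polar A ->
  holomorphic_on (D `\` A) f ->
  A z0 ->
  ( [set p : (CC * CC)%type | p.1 = z0]
      `&` pluripolar_hull (graph D A f) [set p | D p.1] = set0
    <-> (forall R : RR, 0 < R ->
          ~ thin [set z | (D `\` A) z /\ R%:C <= `|f z|] z0) )
  /\
  (forall R : RR, 0 < R ->
     thin [set z | (D `\` A) z /\ R%:C <= `|f z|] z0 ->
     exists w0 : CC, `|w0| <= R%:C /\
       ~ pluri_thin (graph D A f) (z0, w0) /\
       pluripolar_hull (graph D A f) [set p | D p.1] (z0, w0)).
Proof.
move=> [_ oD _] AD clA /polar_locally pA holf Az0.
have hf := cdiff_holomorphic holf; have [oU _] := holf.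
have Dz0 := AD z0 Az0.
have main (R : RR) : 0 < R -> thin [set z | (D `\` A) z /\ R%:C <= `|f z|] z0 ->
    exists w0 : CC, `|w0| <= R%:C /\ ~ pluri_thin (graph D A f) (z0, w0) /\
       pluripolar_hull (graph D A f) [set p | D p.1] (z0, w0).
  move=> R0 hthin; have /= [t0 t00 ht0] := (openCE D).1 oD z0 Dz0.
  have t20 : 0 < t0 / 2 by rewrite divr_gt0.
  have cA : closed (A `&` [set z | cabs (z - z0) <= t0 / 2]).
    have -> : A `&` [set z | cabs (z - z0) <= t0 / 2] =
        closure A `&` [set z | cabs (z - z0) <= t0 / 2].
      apply/seteqP; split => z [h zt]; split => //; first exact: subset_closure.
      by apply: clA; split => //; apply: ht0; rewrite /= in zt; lra.
    apply: closedI; first exact: closed_closure.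
    by apply: compact_closed; [exact: (@norm_hausdorff CC CC^o)|exact: (@compact_disc z0 (t0 / 2))].
  have [s /andP[s0 st] [phi [hphi phi0 phi1 phiN]]] := thin_union t20 pA cA hthin.
  have phiN' z : cabs (z - z0) < s -> z != z0 -> ~ ((D `\` A) z /\ cabs (f z) < R) ->
      (phi z <= (- 1)%:E)%E.
    move=> zs zz0 nz; apply: phiN => //; have [Az|nAz] := pselect (A z); [by left|right].
    have DAz : (D `\` A) z by split => //; apply: ht0; lra.
    by split => //; rewrite cabsE lecR leNgt; apply/negP => h; apply: nz.
  have [w0 w0R fine] := fine_limit oU hf s0 R0 hphi phi0 phi1 phiN' erefl erefl.
  have graph_le V u (c d0 : RR) := @psh_graph_le _ _ _ _ _ _ oU hf s0 hphi phi0 fine V u c d0.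
  exists w0; split; first by rewrite cabsE lecR.
  split; last first.
    (* If [u] is [-oo] on the graph, it is at most [c] there for every real [c], and [graph_le]
       carries each of these bounds to [(z0, w0)]. *)
    split => // u /pshP hu uNy; apply: ereal_eqNy => c.
    apply: (graph_le _ u c 1 hu Dz0 ltr01) => z DAz _ _.
    by rewrite uNy ?leNye //; split.
  case=> [nacc|[V [u [oV V0 /pshP hu lim]]]].
    have [V [/nbhsC2E [d d0 dV] hV]] : exists V, nbhs (z0, w0) V /\
        forall y, graph D A f y -> ~ V y.
      apply: contrapT => h; apply: nacc => V nV; apply: contrapT => h2; apply: h.
      exists V; split => // y gy Vy; apply: h2; exists y; split => //.
      by apply/eqP => E; move: gy; rewrite E => -[[_ /(_ Az0)]].
    (* Were a neighbourhood of [(z0, w0)] free of graph points, [graph_le] would hold vacuously for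
       [u = 0] and [c = - 1]. *)
    have : (0%:E <= (- 1)%:E :> \bar RR)%E.
      apply: (graph_le setT (fun=> 0%:E) (- 1) d _ _ d0) => //.
        by apply: gpsh_cst; exact: openT.
      move=> z DAz zd fd; exfalso; apply: (hV (z, f z)); first by split.
      exact: dV.
    by rewrite lee_fin; lra.
  have [_ uy _ _] := hu.
  have [a ua] : exists a : RR, u (z0, w0) = a%:E.
    move: lim (uy _ V0); case: (u (z0, w0)) => [a| |] //; first by exists a.
    by rewrite ltNge leNye.
  move: lim; rewrite ua => /ereal_inf_lt [_ [Q nQ <-] /lt_ereal_between [b Qb ba]].
  have /nbhsC2E [d d0 dQ] : nbhs (z0, w0) (fun p => (graph D A f `\ (z0, w0)) p -> Q p) := nQ.
  have : (u (z0, w0) <= b%:E)%E.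
    apply: (graph_le V u b d hu V0 d0) => z DAz zd fd; apply: ltW; apply: le_lt_trans Qb.
    apply: ereal_sup_ubound; exists (z, f z) => //; apply: dQ => //; split; first by split.
    by move=> [E _]; case: DAz; rewrite E.
  by rewrite ua lee_fin leNgt ba.
split; last exact: main.
split => [empty R R0 hthin|nonthin].
  have [w0 [_ [_ hw0]]] := main R R0 hthin.
  suff : (set0 : set (CC * CC)) (z0, w0) by [].
  by rewrite -empty; split.
rewrite -subset0 => -[z w] [/= ->] h.
exact: (hull_fibre_empty oD AD clA pA hf Az0 nonthin h).
Qed.
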